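(* Let $p,q\ge 0$ be integers with $p+q=2$. (1) Let $C\in\mathcal{W}_{\mathcal{B}}(p,q)$ be such that $\nabla^C$ is not of Type $\mathcal{C}$, and let $P\in\mathbb{R}^+\times\mathbb{R}$. Then $\mathcal{X}_C(P)=\mathcal{G}$ (the elements of $\mathcal{G}$ being regarded as germs at $P$), $\mathfrak{X}_C(P)=\mathfrak{h}$, and $\nabla^C$ is not of Type $\mathcal{A}$. (2) The oriented moduli space $\mathfrak{W}_{\mathcal{B}}^+(p,q)$ may be identified with the orbit space $\mathcal{W}_{\mathcal{B}}(p,q)/\mathcal{I}^+$. That is, two elements $C,\tilde C\in\mathcal{W}_{\mathcal{B}}(p,q)$ define the same point of $\mathfrak{W}_{\mathcal{B}}^+(p,q)$ if and only if they lie in the same $\mathcal{I}^+$-orbit. (3) $\mathfrak{W}_{\mathcal{B}}^+(p,q)$ has a natural real-analytic manifold structure, namely a quotient structure on $\mathcal{W}_{\mathcal{B}}(p,q)/\mathcal{I}^+$ for which (4) holds. (4) The natural projection $\mathcal{W}_{\mathcal{B}}(p,q)\rightarrow\mathfrak{W}_{\mathcal{B}}^+(p,q)$ is a trivial $\mathcal{I}^+$ principal bundle.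
   Context: Connections. A connection $\nabla$ on the tangent bundle of a surface (torsion is allowed) has Christoffel symbols $\Gamma_{ij}{}^k$ in local coordinates $(x^1,x^2)$, defined by $\nabla_{\partial_{x^i}}\partial_{x^j}=\Gamma_{ij}{}^k\partial_{x^k}$ (summation over repeated indices). No symmetry $\Gamma_{ij}{}^k=\Gamma_{ji}{}^k$ is assumed. The curvature operator is $R(X,Y)=\nabla_X\nabla_Y-\nabla_Y\nabla_X-\nabla_{[X,Y]}$. The Ricci tensor is $\rho(X,Y)=\operatorname{Tr}(Z\mapsto R(Z,X)Y)$, and the symmetric Ricci tensor is $\rho_s(X,Y)=\frac12\{\rho(X,Y)+\rho(Y,X)\}$. The space of structures. Let $\mathcal{W}_{\mathcal{B}}(2)=(\mathbb{R}^2)^*\otimes(\mathbb{R}^2)^*\otimes\mathbb{R}^2\cong\mathbb{R}^8$. For $C=(C_{ij}{}^k)\in\mathcal{W}_{\mathcal{B}}(2)$, let $\nabla^C$ be the connection on $\mathbb{R}^+\times\mathbb{R}$ (coordinates $(x^1,x^2)$, $x^1>0$) with Christoffel symbols $\Gamma_{ij}{}^k=(x^1)^{-1}C_{ij}{}^k$. A connection of this form on (an open subset of) $\mathbb{R}^+\times\mathbb{R}$ is said to be of Type $\mathcal{B}$. Let $\rho_{s,C}$ be the symmetric Ricci tensor of $\nabla^C$; its coefficients are $(x^1)^{-2}$ times constants. For $p+q=2$, let $\mathcal{W}_{\mathcal{B}}(p,q)$ be the open subset of those $C\in\mathcal{W}_{\mathcal{B}}(2)$ for which $\rho_{s,C}$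 is non-degenerate of signature $(p,q)$. (The order convention for the signature is immaterial, since the result is stated for all $p+q=2$.) Types. $\nabla^C$ is of Type $\mathcal{A}$ if there are local coordinates in which the Christoffel symbols of $\nabla^C$ are constant. $\nabla^C$ is of Type $\mathcal{C}$ if it is locally the Levi-Civita connection of a metric (Riemannian or Lorentzian) of constant Gauss curvature. Groups. $\mathcal{G}=\{(x^1,x^2)\mapsto(mx^1,ax^1+bx^2+d): m>0,\ b\neq0,\ a,d\in\mathbb{R}\}$; $\mathcal{H}=\{(x^1,x^2)\mapsto(mx^1,mx^2+d): m>0,\ d\in\mathbb{R}\}\subset\mathcal{G}$; $\mathcal{I}^+=\{(x^1,x^2)\mapsto(x^1,ax^1+bx^2): a\in\mathbb{R},\ b>0\}\subset\mathcal{G}$. Let $\mathfrak{h}=\operatorname{Span}_{\mathbb{R}}\{x^1\partial_{x^1}+x^2\partial_{x^2},\ \partial_{x^2}\}$ be the Lie algebra of $\mathcal{H}$. The group $\mathcal{I}^+$ acts linearly on $\mathcal{W}_{\mathcal{B}}(2)$, preserving each $\mathcal{W}_{\mathcal{B}}(p,q)$, by the usual tensor action: $T\in\mathcal{I}^+$ transforms $C$ so that $T$ intertwines $\nabla^C$ and the connection $\nabla^{TC}$. Explicitly, for $T(x^1,x^2)=(x^1,ax^1+bx^2)$, $(TC)_{ij}{}^k=C(e_i,e_j,e^k)$ with $e_1=\partial_{x^1}-ab^{-1}\partial_{x^2}$, $e_2=b^{-1}\partial_{x^2}$, $e^1=dx^1$, $e^2=a\,dx^1+b\,dx^2$. Moduli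 space. $\mathfrak{W}^+_{\mathcal{B}}(p,q)$ is the set of equivalence classes of elements of $\mathcal{W}_{\mathcal{B}}(p,q)$, where $C$ and $\tilde C$ are identified if there is an orientation preserving local diffeomorphism (germ) of $\mathbb{R}^+\times\mathbb{R}$ intertwining $\nabla^{C}$ and $\nabla^{\tilde C}$. Germs. For $C\in\mathcal{W}_{\mathcal{B}}(2)$ and $P\in\mathbb{R}^+\times\mathbb{R}$, $\mathcal{X}_C(P)$ is the set of germs at $P$ of diffeomorphisms $\Phi$ of $\mathbb{R}^+\times\mathbb{R}$ such that $\Phi^*\nabla^C:=\Phi^{-1}\circ\nabla^C\circ\Phi$ is again a connection of Type $\mathcal{B}$. (Because $\mathcal{H}$ acts transitively and preserves every Type $\mathcal{B}$ connection, the choice of $P$ is irrelevant.) A vector field $X$ is an affine Killing vector field of $\nabla$ if its local flow preserves $\nabla$, equivalently $\mathcal{L}_X\nabla=0$. $\mathfrak{X}_C(P)$ denotes the Lie algebra of germs at $P$ of affine Killing vector fields of $\nabla^C$. *)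

(* Defs.v *)
From HB Require Import structures.
From mathcomp Require Import all_boot all_order all_algebra.
From mathcomp Require Import all_classical all_reals all_analysis.

Set Implicit Arguments.
Unset Strict Implicit.
Unset Printing Implicit Defensive.

Import Order.TTheory GRing.Theory Num.Theory numFieldNormedType.Exports.
Local Open Scope classical_set_scope.
Local Open Scope ring_scope.

(* Indices 0, 1 : 'I_2 stand for the indices 1, 2 of the coordinates          *)
(* (x^1, x^2); points and tangent vectors of R^2 are row vectors.             *)

Section Smooth.
Variables (R : realType) (n : nat) (V : normedModType R).

Fixpoint iter_partial (s : seq 'I_n) (f : 'rV[R]_n -> V) : 'rV[R]_n -> V :=
  if s is i :: s' then fun x => 'D_(delta_mx 0 i) (iter_partial s' f) x else f.

(* C^oo on U; only meaningful for open U, since derivatives look at a full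
   neighbourhood *)
Definition smooth_on (U : set 'rV[R]_n) (f : 'rV[R]_n -> V) : Prop :=
  forall (s : seq 'I_n) (x : 'rV[R]_n), U x -> differentiable (iter_partial s f) x.

End Smooth.

Section RealAnalytic.
Variable R : realType.

(* monomial x^m for the multi-index m, whose entries are all < N *)
Definition monom n N (m : {ffun 'I_n -> 'I_N}) (x : 'rV[R]_n) : R :=
  \prod_i x 0 i ^+ m i.

Definition coeff_at n N (c : {ffun 'I_n -> nat} -> R)
  (m : {ffun 'I_n -> 'I_N}) : R := c [ffun i => m i : nat].

(* Near x, f is the sum of an absolutely convergent power series in y - x; the
   series is summed over the growing boxes of multi-indices {0, .., N - 1}^n. *)
Definition analytic_at n (f : 'rV[R]_n -> R) (x : 'rV[R]_n) : Prop :=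
  exists c : {ffun 'I_n -> nat} -> R, \forall y \near x,
    cvgn (fun N => \sum_(m : {ffun 'I_n -> 'I_N})
                     `|coeff_at c m * monom m (y - x)|) /\
    (fun N => \sum_(m : {ffun 'I_n -> 'I_N}) coeff_at c m * monom m (y - x))
      @ \oo --> f y.

Definition analytic_on n k (U : set 'rV[R]_n) (h : 'rV[R]_n -> 'rV[R]_k) : Prop :=
  forall x, U x -> forall j, analytic_at (fun y => h y 0 j) x.

End RealAnalytic.

(* Real-analytic manifolds are subsets M of a type T together with a set of
   charts; the topology is the one determined by the charts. *)
Section Manifolds.
Variable R : realType.

Record chart (T : Type) (n : nat) :=
  Chart { chart_dom : set T; chart_map : T -> 'rV[R]_n }.

Definition chart_analytic T T' n n' (c : chart T n) (c' : chart T' n')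
    (f : T -> T') : Prop :=
  let D := chart_dom c `&` f @^-1` chart_dom c' in
  open (chart_map c @` D) /\
  exists2 h : 'rV[R]_n -> 'rV[R]_n', analytic_on (chart_map c @` D) h &
    forall x, D x -> h (chart_map c x) = chart_map c' (f x).

Definition analytic_atlas T n (M : set T) (A : set (chart T n)) : Prop :=
  [/\ forall c, A c -> chart_dom c `<=` M /\ set_inj (chart_dom c) (chart_map c),
      forall x, M x -> exists2 c, A c & chart_dom c x &
      forall c c', A c -> A c' -> chart_analytic c c' id].

Definition mopen T n (M : set T) (A : set (chart T n)) (V : set T) : Prop :=
  V `<=` M /\ forall c, A c -> open (chart_map c @` (chart_dom c `&` V)).

Definition mhausdorff T n (M : set T) (A : set (chart T n)) : Prop :=
  forall x y, M x -> M y -> x <> y ->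
    exists V V', [/\ mopen M A V, mopen M A V', V x, V' y & V `&` V' = set0].

Definition msecond_countable T n (M : set T) (A : set (chart T n)) : Prop :=
  exists B : nat -> set T, (forall i, mopen M A (B i)) /\
    forall V x, mopen M A V -> V x -> exists i, B i x /\ B i `<=` V.

Definition analytic_manifold T n (M : set T) (A : set (chart T n)) : Prop :=
  [/\ analytic_atlas M A, mhausdorff M A & msecond_countable M A].

(* The first component of chart_analytic gives the continuity of f. *)
Definition analytic_map T n (M : set T) (A : set (chart T n))
    T' n' (M' : set T') (A' : set (chart T' n')) (f : T -> T') : Prop :=
  (forall x, M x -> M' (f x)) /\
  forall c c', A c -> A' c' -> chart_analytic c c' f.

Definition prod_chart T T' n n' (c : chart T n) (c' : chart T' n') :
    chart (T * T') (n + n') :=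
  Chart (chart_dom c `*` chart_dom c')
        (fun z => row_mx (chart_map c z.1) (chart_map c' z.2)).

Definition prod_atlas T T' n n' (A : set (chart T n)) (A' : set (chart T' n')) :
    set (chart (T * T') (n + n')) :=
  [set prod_chart c c' | c in A & c' in A'].

(* The projection pi : E -> B is a trivial principal bundle for the group K,
   with multiplication mul, acting on E from the left by act: there is an
   analytic diffeomorphism e |-> (tau e, pi e) of E onto K x B which is
   equivariant for left translation on the factor K. *)
Definition trivial_principal_bundle
    TK nK (K : set TK) (AK : set (chart TK nK)) (mul : TK -> TK -> TK)
    TE nE (E : set TE) (AE : set (chart TE nE)) (act : TK -> TE -> TE)
    TB nB (B : set TB) (AB : set (chart TB nB)) (pi : TE -> TB) : Prop :=
  (forall g e, K g -> E e -> E (act g e)) /\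
  exists (tau : TE -> TK) (theta : TK * TB -> TE),
    let triv := fun e => (tau e, pi e) in
    [/\ analytic_map E AE (K `*` B) (prod_atlas AK AB) triv,
        analytic_map (K `*` B) (prod_atlas AK AB) E AE theta,
        (forall e, E e -> theta (triv e) = e),
        (forall z, (K `*` B) z -> triv (theta z) = z) &
        (forall g e, K g -> E e -> triv (act g e) = (mul g (tau e), pi e))].

End Manifolds.

Section Connections.
Variable R : realType.
Local Notation pt := 'rV[R]_2.

Definition christoffel := 'I_2 -> 'I_2 -> 'I_2 -> pt -> R.

(* (nabla_X Y)^k = X(Y^k) + X^i Y^j Gamma_ij^k *)
Definition covd (G : christoffel) (X Y : pt -> pt) (x : pt) : pt :=
  'D_(X x) Y x + \row_k \sum_i \sum_j X x 0 i * Y x 0 j * G i j k x.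

Definition lie_bracket (X Y : pt -> pt) (x : pt) : pt :=
  'D_(X x) Y x - 'D_(Y x) X x.

Definition curvature (G : christoffel) (X Y Z : pt -> pt) (x : pt) : pt :=
  covd G X (covd G Y Z) x - covd G Y (covd G X Z) x
  - covd G (lie_bracket X Y) Z x.

Definition coord_field (i : 'I_2) : pt -> pt := fun=> delta_mx 0 i.

(* rho (d_j, d_k) = Tr (Z |-> R (Z, d_j) d_k) *)
Definition ricci (G : christoffel) (x : pt) : 'M[R]_2 :=
  \matrix_(j, k) \sum_i
    curvature G (coord_field i) (coord_field j) (coord_field k) x 0 i.

Definition sym_ricci (G : christoffel) (x : pt) : 'M[R]_2 :=
  2^-1 *: (ricci G x + (ricci G x)^T).

(* The symmetric bilinear form with Gram matrix S is diagonal in some basis,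
   with p positive and q negative diagonal entries. *)
Definition has_signature n (S : 'M[R]_n) (p q : nat) : Prop :=
  exists (B : 'M[R]_n) (d : 'rV[R]_n),
    [/\ B \in unitmx, B *m S *m B^T = diag_mx d,
        #|[set i | 0 < d 0 i]%SET| = p & #|[set i | d 0 i < 0]%SET| = q].

(* Phi is a diffeomorphism of the open set U onto the open set V, with inverse
   Psi. *)
Definition diffeo (U V : set pt) (Phi Psi : pt -> pt) : Prop :=
  [/\ open U /\ open V,
      (forall x, U x -> V (Phi x) /\ Psi (Phi x) = x),
      (forall y, V y -> U (Psi y) /\ Phi (Psi y) = y),
      smooth_on U Phi & smooth_on V Psi].

(* Phi_* X, for Phi with inverse Psi *)
Definition pushforward (Phi Psi : pt -> pt) (X : pt -> pt) (y : pt) : pt :=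
  'D_(X (Psi y)) Phi (Psi y).

(* Christoffel symbols of Phi^* nabla = Phi^-1 o nabla o Phi *)
Definition pullback (Phi Psi : pt -> pt) (G : christoffel) : christoffel :=
  fun i j k x =>
    pushforward Psi Phi
      (covd G (pushforward Phi Psi (coord_field i))
              (pushforward Phi Psi (coord_field j))) x 0 k.

(* L_X nabla = 0 on U *)
Definition affine_killing (U : set pt) (G : christoffel) (X : pt -> pt) : Prop :=
  smooth_on U X /\
  forall Y Z : pt -> pt, smooth_on U Y -> smooth_on U Z -> forall x, U x ->
    lie_bracket X (covd G Y Z) x
    = covd G (lie_bracket X Y) Z x + covd G Y (lie_bracket X Z) x.

Definition bform (S : 'M[R]_2) (u v : pt) : R := (u *m S *m v^T) 0 0.

Definition levi_civita (U : set pt) (g : pt -> 'M[R]_2) (G : christoffel) : Prop :=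
  forall X Y Z : pt -> pt, smooth_on U X -> smooth_on U Y -> smooth_on U Z ->
    forall x, U x ->
      covd G X Y x - covd G Y X x = lie_bracket X Y x /\
      'D_(Z x) (fun y => bform (g y) (X y) (Y y)) x
      = bform (g x) (covd G Z X x) (Y x) + bform (g x) (X x) (covd G Z Y x).

(* K = g (R (d_1, d_2) d_2, d_1) / (g_11 g_22 - g_12 ^ 2) *)
Definition gauss_curvature (g : pt -> 'M[R]_2) (G : christoffel) (x : pt) : R :=
  bform (g x)
    (curvature G (coord_field 0) (coord_field 1) (coord_field 1) x)
    (coord_field 0 x) / \det (g x).

Definition germ (P : pt) (f : pt -> pt) : set (pt -> pt) :=
  [set g | \forall x \near P, g x = f x].

End Connections.

Section TypeB.
Variable R : realType.
Local Notation pt := 'rV[R]_2.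

Definition row2 (u v : R) : pt := \row_j (if j == 0 then u else v).

Definition half_plane : set pt := [set x | 0 < x 0 0].

(* C i j k is the structure constant C_ij^k. *)
Definition WB2 := 'I_2 -> 'I_2 -> 'I_2 -> R.

Definition nablaB (C : WB2) : christoffel R := fun i j k x => (x 0 0)^-1 * C i j k.

Definition WB (p q : nat) : set WB2 :=
  [set C | forall x, half_plane x -> has_signature (sym_ricci (nablaB C) x) p q].

(* Type B connections are locally homogeneous (by the action of the group H), so
   in the next two definitions one could equally require the local condition at
   a single point. *)
Definition typeA (C : WB2) : Prop :=
  forall P, half_plane P -> exists (U V : set pt) (Phi Psi : pt -> pt) (A : WB2),
    [/\ U P, U `<=` half_plane, diffeo U V Phi Psi &
        forall y, V y -> forall i j k, pullback Psi Phi (nablaB C) i j k y = A i j k].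

Definition typeC (C : WB2) : Prop :=
  forall P, half_plane P -> exists (U : set pt) (g : pt -> 'M[R]_2) (K : R),
    [/\ open U /\ U P, U `<=` half_plane,
        smooth_on U g /\ (forall x, U x -> (g x)^T = g x),
        (forall x, U x -> has_signature (g x) 2 0) \/
        (forall x, U x -> has_signature (g x) 1 1) &
        levi_civita U g (nablaB C) /\
        forall x, U x -> gauss_curvature g (nablaB C) x = K].

Definition groupG : set (pt -> pt) :=
  [set T | exists m a b d : R, [/\ 0 < m, b != 0 &
     forall x : pt, T x = row2 (m * x 0 0) (a * x 0 0 + b * x 0 1 + d)]].

(* the span of x^1 d_1 + x^2 d_2 and d_2 *)
Definition algh : set (pt -> pt) :=
  [set X | exists s t : R, forall x : pt,
     X x = s *: row2 (x 0 0) (x 0 1) + t *: row2 0 1].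

(* The set of germs at P of diffeomorphisms pulling nabla^C back to a connection
   of Type B. *)
Definition calX (C : WB2) (P : pt) : set (set (pt -> pt)) :=
  germ P @` [set Phi | exists (U V : set pt) (Psi : pt -> pt) (C' : WB2),
    [/\ U P, U `<=` half_plane /\ V `<=` half_plane, diffeo U V Phi Psi &
        forall x, U x -> forall i j k,
          pullback Phi Psi (nablaB C) i j k x = nablaB C' i j k x]].

Definition killing_germs (C : WB2) (P : pt) : set (set (pt -> pt)) :=
  germ P @` [set X | exists U : set pt,
    [/\ open U, U P, U `<=` half_plane & affine_killing U (nablaB C) X]].

(* Some germ of an orientation preserving diffeomorphism intertwines nabla^C and
   nabla^C'. *)
Definition oriented_equiv (C C' : WB2) : Prop :=
  exists (P : pt) (U V : set pt) (Phi Psi : pt -> pt),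
    [/\ U P, U `<=` half_plane /\ V `<=` half_plane, diffeo U V Phi Psi,
        forall x, U x -> 0 < \det (jacobian Phi x) &
        forall x, U x -> forall i j k,
          pullback Phi Psi (nablaB C') i j k x = nablaB C i j k x].

(* the equivalence class of C, i.e. the point of the moduli space defined by C *)
Definition moduli_class (p q : nat) (C : WB2) : set WB2 :=
  [set C' | WB p q C' /\ oriented_equiv C C'].

Definition moduli (p q : nat) : set (set WB2) := moduli_class p q @` WB p q.

(* g = (a, b) with 0 < b encodes (x^1, x^2) |-> (x^1, a x^1 + b x^2). *)
Definition Iplus : set pt := [set g | 0 < g 0 1].

Definition Iplus_map (g : pt) (x : pt) : pt :=
  row2 (x 0 0) (g 0 0 * x 0 0 + g 0 1 * x 0 1).

Definition Iplus_mul (g h : pt) : pt :=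
  row2 (g 0 0 + g 0 1 * h 0 0) (g 0 1 * h 0 1).

Lemma Iplus_mapM g h : Iplus_map (Iplus_mul g h) = Iplus_map g \o Iplus_map h.
Proof.
apply: funext => x; apply/rowP => j; rewrite !mxE /=.
by case: ifP => // _; rewrite mulrDl mulrDr !mulrA addrA.
Qed.

(* the frame e_1 = d_1 - a b^-1 d_2, e_2 = b^-1 d_2 and its dual coframe
   e^1 = dx^1, e^2 = a dx^1 + b dx^2 *)
Definition Iplus_frame (g : pt) (i : 'I_2) : pt :=
  if i == 0 then row2 1 (- (g 0 0 / g 0 1)) else row2 0 (g 0 1)^-1.

Definition Iplus_coframe (g : pt) (k : 'I_2) : pt :=
  if k == 0 then row2 1 0 else row2 (g 0 0) (g 0 1).

Definition Iplus_act (g : pt) (C : WB2) : WB2 := fun i j k =>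
  \sum_l \sum_m \sum_n
    Iplus_frame g i 0 l * Iplus_frame g j 0 m * Iplus_coframe g k 0 n * C l m n.

Definition WB_coord (C : WB2) : 'rV[R]_8 :=
  \row_l C (inord (l %/ 4)) (inord (l %/ 2 %% 2)) (inord (l %% 2)).

Definition WB_atlas (p q : nat) : set (chart R WB2 8) :=
  [set Chart (WB p q) WB_coord].

Definition Iplus_atlas : set (chart R pt 2) := [set Chart Iplus id].

End TypeB.

(* Main.v *)
Require Import Defs.
From mathcomp Require Import all_boot all_order all_algebra.
From mathcomp Require Import all_classical all_reals all_analysis.
From mathcomp Require Import ring lra.

(* A diffeomorphism Phi intertwining two Type B connections is encoded by the matrix
   M = (x^1 / Phi^1) D Phi in the frame x^1 d_i, which satisfies a first order system
   x^1 d_i M = Q_i(M), with Q_i quadratic in M.  Its integrability conditions say that M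
   intertwines the constant symmetric Ricci matrices S and S'; differentiating this, the
   derivatives x^1 d_i M lie in the line spanned by J M, where J generates the isometry
   algebra of S.  A second differentiation shows that either these derivatives vanish, or
   the deviation of nabla from the Levi-Civita connection of the Ricci metric is annihilated
   by J, hence is 0; the latter gives Type C.  In the former case M is constant and
   triangular, so that Phi lies in G.  Affine Killing fields are treated by the linearised
   system, and Type A by the same system with x^1 replaced by 1 on the source.  The
   remaining structures of Type C with det S <> 0 form one I+ orbit.

   An explicit analytic map tau to I+, equivariant for left translation, trivialises the
   quotient; three kinds of invariant open sets carrying slices of the action cover the
   space of structures and give the charts. *)

Import Order.TTheory GRing.Theory Num.Theory numFieldNormedType.Exports.
Local Open Scope classical_set_scope.
Local Open Scope ring_scope.

Set Implicit Arguments.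
Unset Strict Implicit.
Unset Printing Implicit Defensive.

(** * Summable families and power series *)

(** The obstacle is that preserving S leaves the derivatives of [M] a one-dimensional freedom at
    each point; the deviation tensor is introduced to remove it. The action of J on this tensor is
    injective because J has the eigenvalues [mu] and [- mu], with [mu ^ 2 = - det S], on each of its
    three slots, and a signed sum of three equal nonzero numbers is not zero. Third derivatives of
    the map never enter: by the system, the first derivatives of [M] are polynomials in [M] over the
    weight, hence differentiable, and equality of mixed derivatives is used for the entries of [M]
    themselves. Constancy of [M] alone does not make it triangular; this comes from the bracket of
    the frame [x^1 d_i], which [M] must respect. On the quotient side, local slices give charts but
    neither separation of orbits nor a global section; the equivariant map tau supplies both. Since
    tau contains inverses and square roots, analyticity is developed through the series of
    [1 / (1 - t)] and [sqrt (1 - 4 t)], with unconditional sums, which may be regrouped freely, in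
    place of sums over boxes. *)

Section Summation.
Variable R : realType.

(** The extended-real sum of a nonnegative family always exists; equating it with a finite [A]
    expresses summability and the value at once. *)
Definition nsum (T : choiceType) (g : T -> R) (A : R) :=
  (forall i, 0 <= g i) /\ (\esum_(i in [set: T]) (g i)%:E = A%:E)%E.

(* Signed families are written as differences of nonnegative ones, since esum is only
   additive on the latter. *)
Definition hassum (T : choiceType) (f : T -> R) (s : R) :=
  exists g h A B, [/\ nsum g A, nsum h B, forall i, f i = g i - h i & s = A - B].

Definition asum (T : choiceType) (f : T -> R) := exists A, nsum (fun i => `|f i|) A.

Lemma nsum_ext (T : choiceType) (g g' : T -> R) A :
  (forall i, g i = g' i) -> nsum g A -> nsum g' A.
Proof. by move=> e; rewrite (_ : g = g') //; apply/funext. Qed.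

Lemma hassum_ext (T : choiceType) (g g' : T -> R) A :
  (forall i, g i = g' i) -> hassum g A -> hassum g' A.
Proof. by move=> e; rewrite (_ : g = g') //; apply/funext. Qed.

Lemma nsum_uniq (T : choiceType) (g : T -> R) A B : nsum g A -> nsum g B -> A = B.
Proof. by move=> [_ eA] [_]; rewrite eA => -[]. Qed.

Lemma nsum_ge0 (T : choiceType) (g : T -> R) A : nsum g A -> 0 <= A.
Proof.
by move=> [g0 eA]; rewrite -lee_fin -eA; apply: esum_ge0 => i _; rewrite lee_fin.
Qed.

Lemma nsum_dom (T : choiceType) (g G : T -> R) A :
  (forall i, 0 <= g i <= G i) -> nsum G A -> exists2 B, nsum g B & B <= A.
Proof.
move=> gG [G0 eA].
have le : (\esum_(i in [set: T]) (g i)%:E <= A%:E)%E.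
  by rewrite -eA; apply: le_esum => i _; rewrite lee_fin; case/andP: (gG i).
have ge : (0%:E <= \esum_(i in [set: T]) (g i)%:E)%E.
  by apply: esum_ge0 => i _; rewrite lee_fin; case/andP: (gG i).
move: le ge; case e: (\esum_(_ in _) _)%E => [b||] //; rewrite !lee_fin => le ge.
by exists b => //; split=> // i; case/andP: (gG i).
Qed.

Lemma nsum_le (T : choiceType) (g G : T -> R) A B :
  (forall i, g i <= G i) -> nsum g A -> nsum G B -> A <= B.
Proof.
move=> gG nA nB; case: (@nsum_dom _ g G B) => // [i|C nC CB].
  by rewrite (proj1 nA) gG.
by rewrite (nsum_uniq nA nC).
Qed.

Lemma nsumD (T : choiceType) (g h : T -> R) A B :
  nsum g A -> nsum h B -> nsum (fun i => g i + h i) (A + B).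
Proof.
move=> [g0 eA] [h0 eB]; split=> [i|]; first by rewrite addr_ge0.
rewrite EFinD -eA -eB -esumD => [|i _|i _]; rewrite ?lee_fin //.
Qed.

Lemma nsum0 (T : choiceType) : nsum (fun _ : T => 0) 0.
Proof. by split=> //; apply: esum1. Qed.

Lemma nsum_fubini (J K : choiceType) (g : J * K -> R) (t : J -> R) A :
  (forall x, 0 <= g x) -> (forall j, nsum (fun k => g (j, k)) (t j)) ->
  (nsum t A <-> nsum g A).
Proof.
move=> g0 gt.
have E : (\esum_(j in [set: J]) (t j)%:E = \esum_(x in [set: J * K]) (g x)%:E)%E.
  transitivity (\esum_(j in [set: J]) \esum_(k in [set: K]) (g (j, k))%:E)%E.
    by apply: eq_esum => j _; rewrite (proj2 (gt j)).
  rewrite esum_esum => [|i j _ _]; last by rewrite lee_fin.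
  rewrite (_ : [set: J] `*`` _ = setT); last by apply/seteqP; split.
  by apply: eq_esum => -[a b].
split=> -[_ e]; split=> //; first by rewrite -E.
  by move=> j; exact: nsum_ge0 (gt j).
by rewrite E.
Qed.

(** Each row is the family reindexed along the injection [k => (j, k)], so its sum is bounded by the
    total and is finite; Fubini then applies to the row sums. *)
Lemma nsum_inner (J K : choiceType) (g : J * K -> R) A :
  nsum g A -> exists2 t, forall j, nsum (fun k => g (j, k)) (t j) & nsum t A.
Proof.
move=> nA; have g0 := proj1 nA.
have h j : exists t, nsum (fun k => g (j, k)) t.
  have ge : (0%:E <= \esum_(k in [set: K]) (g (j, k))%:E)%E.
    by apply: esum_ge0 => i _; rewrite lee_fin.
  have le : (\esum_(k in [set: K]) (g (j, k))%:E <= A%:E)%E.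
    rewrite -(proj2 nA).
    rewrite -(@esum_image _ _ _ [set: K] (fun k => (j, k)) (fun x => (g x)%:E)).
      rewrite [leRHS]esum_mkcond [leLHS]esum_mkcond; apply: le_esum => x _.
      by rewrite in_setT; case: ifP => // _; rewrite lee_fin.
    by move=> x y _ _ [].
  move: ge le; case e: (\esum_(_ in _) _)%E => [b||] //; exists b.
  by split.
case: (choice h) => t ht; exists t => //.
exact/(nsum_fubini A g0 ht).
Qed.

Lemma nsum_inj (T T' : choiceType) (e : T' -> T) (g : T -> R) A :
  injective e -> (forall i, (forall j, e j <> i) -> g i = 0) -> (forall i, 0 <= g i) ->
  (nsum (fun j => g (e j)) A <-> nsum g A).
Proof.
move=> inj z g0.
have E : (\esum_(j in [set: T']) (g (e j))%:E = \esum_(i in [set: T]) (g i)%:E)%E.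
  rewrite -(@esum_image _ _ _ [set: T'] e (fun x => (g x)%:E)); last first.
    by move=> x y _ _; exact: inj.
  rewrite [LHS]esum_mkcond; apply: eq_esum => i _.
  case: ifP => // /negP h; rewrite z // => j ej.
  by apply: h; rewrite inE; exists j.
by split=> -[_ e']; split=> //; rewrite -?E // E.
Qed.

Lemma nsumZ (T : choiceType) (g : T -> R) (a A : R) :
  0 <= a -> nsum g A -> nsum (fun i => a * g i) (a * A).
Proof.
move=> a0 [g0 eA]; split=> [i|]; first by rewrite mulr_ge0.
rewrite EFinM -eA /esum -ereal_supZl //; last first.
  apply/set0P; exists 0%E; exists set0; first exact: fsets_set0.
  by rewrite fsbig_set0.
rewrite image_comp; congr ereal_sup; apply: eq_imagel => X [fX _] /=.
rewrite ge0_mule_fsumr => [|i]; last by rewrite lee_fin.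
by apply: eq_fsbigr => i _; rewrite EFinM.
Qed.

Lemma nsum_point (T : choiceType) (a : T) (c : R) :
  0 <= c -> nsum (fun i => if i == a then c else 0) c.
Proof.
move=> c0; split=> [i|]; first by case: ifP.
rewrite -(@esum_set1 _ _ a (fun=> c%:E)) ?lee_fin // [RHS]esum_mkcond.
apply: eq_esum => i _; rewrite (_ : (i \in [set a]) = (i == a)); first by case: ifP.
by apply/idP/eqP; rewrite inE.
Qed.

Lemma nsum_seq (T : choiceType) (s : seq T) (g : T -> R) : uniq s ->
  (forall i, 0 <= g i) ->
  nsum (fun i => if i \in s then g i else 0) (\sum_(i <- s) g i).
Proof.
move=> us g0; elim: s us => [_|a s IH /= /andP[as_ us]].
  by rewrite big_nil; apply: nsum_ext (nsum0 T) => i.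
rewrite big_cons; apply: nsum_ext (nsumD (nsum_point a (g0 a)) (IH us)) => i.
rewrite inE; case: eqP => [->|_] /=; last by rewrite add0r.
by rewrite (negbTE as_) addr0.
Qed.

Lemma nsum_seq_le (T : choiceType) (s : seq T) (g : T -> R) A : uniq s ->
  nsum g A -> \sum_(i <- s) g i <= A.
Proof.
move=> us nA; apply: (nsum_le _ (nsum_seq us (proj1 nA)) nA) => i.
by case: ifP => // _; exact: (proj1 nA).
Qed.

Lemma nsum_bound (T : choiceType) (g : T -> R) M : (forall i, 0 <= g i) ->
  (forall s, uniq s -> \sum_(i <- s) g i <= M) -> exists2 A, nsum g A & A <= M.
Proof.
move=> g0 gM.
have le : (\esum_(i in [set: T]) (g i)%:E <= M%:E)%E.
  apply: ge_ereal_sup => _ [X [fX _] <-].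
  rewrite fsumEFin // lee_fin fsbig_finite //; apply: gM.
  exact: finmap.fset_uniq.
have ge : (0%:E <= \esum_(i in [set: T]) (g i)%:E)%E.
  by apply: esum_ge0 => i _; rewrite lee_fin.
move: le ge; case e: (\esum_(_ in _) _)%E => [b||] //; rewrite !lee_fin => le ge.
by exists b.
Qed.

Lemma nsum_approx (T : choiceType) (g : T -> R) A e : 0 < e -> nsum g A ->
  exists2 s, uniq s & A - e < \sum_(i <- s) g i.
Proof.
move=> e0 [g0 eA]; have := @ub_ereal_sup_adherent _
  [set \sum_(x \in X) (g x)%:E | X in fsets [set: T]]%E e e0.
rewrite -/(esum [set: T] (fun i => (g i)%:E)) eA => /(_ erefl) [_ [X [fX _] <-]].
rewrite fsumEFin // -EFinB lte_fin fsbig_finite // => h.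
by eexists; last exact: h; exact: finmap.fset_uniq.
Qed.

Lemma nsum_nat_bound (g : nat -> R) M : (forall i, 0 <= g i) ->
  (forall n, \sum_(i < n) g i <= M) -> exists2 A, nsum g A & A <= M.
Proof.
move=> g0 gM; apply: nsum_bound => // s us.
have [n sn] : exists n, forall i, i \in s -> (i < n)%N.
  exists (\max_(i <- s) i).+1 => i si; rewrite ltnS.
  by rewrite (big_rem i) //= leq_maxl.
apply: le_trans (gM n); rewrite -(big_mkord xpredT g).
have /(nsum_seq_le us) : nsum (fun i => if i \in index_iota 0 n then g i else 0)
   (\sum_(0 <= i < n) g i) by apply: nsum_seq => //; exact: iota_uniq.
apply: le_trans; rewrite big_seq [leRHS]big_seq; apply: ler_sum => i si.
by rewrite mem_index_iota sn.
Qed.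

Lemma hassum_uniq (T : choiceType) (f : T -> R) s t :
  hassum f s -> hassum f t -> s = t.
Proof.
move=> [g [h [A [B [nA nB e ->]]]]] [g' [h' [A' [B' [nA' nB' e' ->]]]]].
have := nsumD nA nB'; have := nsumD nA' nB.
have ee : forall i, g' i + h i = g i + h' i.
  by move=> i; have := e i; rewrite e' => /eqP; rewrite subr_eq addrAC eq_sym subr_eq => /eqP ->.
move=> /(nsum_ext ee) n1 /(nsum_uniq n1) h1; lra.
Qed.

Lemma hassum_nsum (T : choiceType) (g : T -> R) A : nsum g A -> hassum g A.
Proof.
move=> nA; exists g, (fun=> 0), A, 0; split=> //; first exact: nsum0.
  by move=> i; rewrite subr0.
by rewrite subr0.
Qed.

(** The positive and negative parts are named explicitly because, unlike an arbitrary decomposition,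
    they are determined pointwise by [f] and so survive reindexing. *)
Lemma asum_parts (T : choiceType) (f : T -> R) A : nsum (fun i => `|f i|) A ->
  exists P N, [/\ nsum (fun i => Num.max (f i) 0) P,
    nsum (fun i => Num.max (- f i) 0) N, hassum f (P - N) & `|P - N| <= A].
Proof.
move=> nA.
have [|P nP PA] := @nsum_dom _ (fun i => Num.max (f i) 0) (fun i => `|f i|) A _ nA.
  by move=> i; rewrite le_max lexx orbT ge_max ler_norm normr_ge0.
have [|N nN NA] := @nsum_dom _ (fun i => Num.max (- f i) 0) (fun i => `|f i|) A _ nA.
  by move=> i; rewrite le_max lexx orbT ge_max -normrN ler_norm normr_ge0.
exists P, N; split=> //.
  exists (fun i => Num.max (f i) 0), (fun i => Num.max (- f i) 0), P, N.
  split=> // i; rewrite /Num.max; case: ltP => ?; case: ltP => ?; lra.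
have := nsum_ge0 nP; have := nsum_ge0 nN => *.
by rewrite ler_norml; apply/andP; split; lra.
Qed.

Lemma asum_hassum (T : choiceType) (f : T -> R) A : nsum (fun i => `|f i|) A ->
  exists2 s, hassum f s & `|s| <= A.
Proof. by move=> /asum_parts [P [N [_ _ h1 h2]]]; exists (P - N). Qed.

Lemma hassum_asum (T : choiceType) (f : T -> R) s : hassum f s -> asum f.
Proof.
move=> [g [h [A [B [nA nB e _]]]]].
have [|C nC _] := @nsum_dom _ (fun i => `|f i|) _ _ _ (nsumD nA nB).
  move=> i; rewrite normr_ge0 e; apply: le_trans (ler_normB _ _) _.
  by rewrite !ger0_norm ?(proj1 nA) ?(proj1 nB).
by exists C.
Qed.

Lemma hassum_le (T : choiceType) (f : T -> R) s A :
  hassum f s -> nsum (fun i => `|f i|) A -> `|s| <= A.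
Proof. by move=> hs /asum_hassum[t /(hassum_uniq hs) ->]. Qed.

Lemma hassumD (T : choiceType) (f f' : T -> R) s s' :
  hassum f s -> hassum f' s' -> hassum (fun i => f i + f' i) (s + s').
Proof.
move=> [g [h [A [B [nA nB e ->]]]]] [g' [h' [A' [B' [nA' nB' e' ->]]]]].
exists (fun i => g i + g' i), (fun i => h i + h' i), (A + A'), (B + B').
split; [exact: nsumD|exact: nsumD| |]; last by ring.
by move=> i; rewrite e e'; ring.
Qed.

Lemma hassumN (T : choiceType) (f : T -> R) s :
  hassum f s -> hassum (fun i => - f i) (- s).
Proof.
move=> [g [h [A [B [nA nB e ->]]]]]; exists h, g, B, A; split=> //.
  by move=> i; rewrite e opprB.
by rewrite opprB.
Qed.

Lemma hassumZ (T : choiceType) (f : T -> R) a s :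
  hassum f s -> hassum (fun i => a * f i) (a * s).
Proof.
move=> hs; wlog a0 : a / 0 <= a => [hw|].
  case: (leP 0 a) => [/hw //|a0].
  have /hw /hassumN : 0 <= - a by lra.
  by rewrite mulNr opprK; apply: hassum_ext => i; ring.
case: hs => [g [h [A [B [nA nB e ->]]]]].
exists (fun i => a * g i), (fun i => a * h i), (a * A), (a * B).
split; [exact: nsumZ|exact: nsumZ| |]; last by ring.
by move=> i; rewrite e; ring.
Qed.

Lemma hassum_fubini (J K : choiceType) (f : J * K -> R) (t : J -> R) s :
  hassum f s -> (forall j, hassum (fun k => f (j, k)) (t j)) -> hassum t s.
Proof.
move=> [g [h [A [B [nA nB e ->]]]]] ft.
have [a ha nA'] := nsum_inner nA; have [b hb nB'] := nsum_inner nB.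
exists a, b, A, B; split=> // j; apply: hassum_uniq (ft j) _.
by exists (fun k => g (j, k)), (fun k => h (j, k)), (a j), (b j); split.
Qed.

(** A decomposition [g - h] of [f] may have [g = h] nonzero off the image of [e]; passing to
    positive and negative parts, which vanish there, reduces the claim to nonnegative families. *)
Lemma hassum_inj (T T' : choiceType) (e : T' -> T) (f : T -> R) s :
  injective e -> (forall i, (forall j, e j <> i) -> f i = 0) ->
  (hassum (fun j => f (e j)) s <-> hassum f s).
Proof.
move=> inj z.
have K A : nsum (fun i => `|f i|) A ->
    exists2 t, hassum f t & hassum (fun j => f (e j)) t.
  move=> /asum_parts [P [N [nP nN ff _]]]; exists (P - N) => //.
  exists (fun i => Num.max (f (e i)) 0), (fun i => Num.max (- f (e i)) 0), P, N.
  split=> //.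
  - apply/(nsum_inj (g := fun i => Num.max (f i) 0) P inj) => // i.
      by move=> /z ->; rewrite maxxx.
    by rewrite le_max lexx orbT.
  - apply/(nsum_inj (g := fun i => Num.max (- f i) 0) N inj) => // i.
      by move=> /z ->; rewrite oppr0 maxxx.
    by rewrite le_max lexx orbT.
  - by move=> i; rewrite /Num.max; case: ltP => ?; case: ltP => ?; lra.
split=> hs; have [A nA] := hassum_asum hs.
  have /K [t ht /(hassum_uniq hs) -> //] : nsum (fun i => `|f i|) A.
  by apply/(nsum_inj A inj) => // i /z ->; rewrite normr0.
by have [t /(hassum_uniq hs) ->] := K A nA.
Qed.

Lemma hassum_seq (T : choiceType) (s : seq T) (f : T -> R) : uniq s ->
  (forall i, i \notin s -> f i = 0) -> hassum f (\sum_(i <- s) f i).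
Proof.
move=> us; elim: s us f => [_|a s IH /= /andP[as_ us]] f f0.
  by rewrite big_nil; apply/hassum_nsum/nsum_ext/(nsum0 T) => i; rewrite f0.
rewrite big_cons; have := IH us (fun i => if i == a then 0 else f i).
rewrite (@eq_big_seq _ _ _ _ s _ f); last first.
  by move=> i si; case: eqP => // ia; rewrite -ia si in as_.
have ha : hassum (fun i => if i == a then f a else 0) (f a).
  have [h|h] := leP 0 (f a); first exact/hassum_nsum/nsum_point.
  rewrite -[f a]opprK; apply: hassum_ext (hassumN (hassum_nsum (nsum_point a _))).
    by move=> i; case: eqP; rewrite ?oppr0.
  by lra.
move=> h; apply: hassum_ext (hassumD ha (h _)) => i; case: eqP => [->|].
- by rewrite addr0.
- by rewrite add0r.
- by [].
- by move=> /eqP ia si; rewrite f0 // inE negb_or ia.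
Qed.

Lemma nsumM (J K : choiceType) (u : J -> R) (v : K -> R) U V :
  nsum u U -> nsum v V -> nsum (fun x : J * K => u x.1 * v x.2) (U * V).
Proof.
move=> nU nV; apply/(@nsum_fubini _ _ _ (fun j => u j * V)).
- by move=> x; rewrite mulr_ge0 ?(proj1 nU) ?(proj1 nV).
- by move=> j /=; apply: nsumZ => //; exact: (proj1 nU).
by rewrite mulrC; apply: nsum_ext (nsumZ (nsum_ge0 nV) nU) => j; rewrite mulrC.
Qed.

Lemma hassumM (J K : choiceType) (f : J -> R) (g : K -> R) s t :
  hassum f s -> hassum g t -> hassum (fun x : J * K => f x.1 * g x.2) (s * t).
Proof.
move=> [a [b [A [B [nA nB e ->]]]]] [c [d [C [D [nC nD e' ->]]]]].
exists (fun x => a x.1 * c x.2 + b x.1 * d x.2),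
  (fun x => a x.1 * d x.2 + b x.1 * c x.2),
  (A * C + B * D), (A * D + B * C); split.
- by apply: nsumD; apply: nsumM.
- by apply: nsumD; apply: nsumM.
- by move=> x; rewrite e e'; ring.
- by ring.
Qed.

(* Fubini for the family [mu t = m] f t on I * T. *)
Lemma nsum_regroup (T I : choiceType) (mu : T -> I) (f : T -> R) A :
  nsum f A ->
  exists2 t, forall m, nsum (fun i => if mu i == m then f i else 0) (t m) & nsum t A.
Proof.
move=> nA.
have : nsum (fun x : I * T => if mu x.2 == x.1 then f x.2 else 0) A.
  apply/(@nsum_inj _ _ (fun i => (mu i, i))).
  - by move=> i j [].
  - by move=> [m i] h /=; case: eqP => // e; case: (h i); rewrite e.
  - by move=> x; case: ifP => // _; exact: (proj1 nA).
  by apply: nsum_ext nA => i /=; rewrite eqxx.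
by move=> /nsum_inner [t h1 h2]; exists t.
Qed.

Lemma hassum_regroup (T I : choiceType) (mu : T -> I) (f : T -> R) (t : I -> R) s :
  hassum f s ->
  (forall m, hassum (fun i => if mu i == m then f i else 0) (t m)) -> hassum t s.
Proof.
move=> hs ht; apply: (@hassum_fubini _ _
  (fun x : I * T => if mu x.2 == x.1 then f x.2 else 0)) ht.
apply/(@hassum_inj _ _ (fun i => (mu i, i))).
- by move=> i j [].
- by move=> [m i] h /=; case: eqP => // e; case: (h i); rewrite e.
by apply: hassum_ext hs => i /=; rewrite eqxx.
Qed.

Lemma hassum_natS (f : nat -> R) s :
  hassum (fun k => f k.+1) s -> hassum f (f 0%N + s).
Proof.
move=> hs.
have h0 : hassum (fun k => if k == 0%N then f 0%N else 0) (f 0%N).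
  have := @hassum_seq _ [:: 0%N] (fun k => if k == 0%N then f 0%N else 0) erefl.
  by rewrite big_seq1 eqxx; apply=> i; rewrite inE => /negbTE ->.
have hS : hassum (fun k => if k == 0%N then 0 else f k) s.
  apply/(@hassum_inj _ _ S); [by move=> i j []|by case=> // n /(_ n)|].
  exact: hs.
by apply: hassum_ext (hassumD h0 hS) => -[|i] /=; rewrite ?addr0 ?add0r.
Qed.

End Summation.

(** * Convergent power series in several variables *)

Section PowerSeries.
Variables (R : realType) (n : nat).
Local Notation idx := {ffun 'I_n -> nat}.
Implicit Types (m : idx) (z : 'rV[R]_n) (c : idx -> R).

Definition mon m z : R := \prod_i z 0 i ^+ m i.

Definition ix0 : idx := [ffun=> 0%N].
Definition ixD m m' : idx := [ffun i => (m i + m' i)%N].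

Lemma monD m m' z : mon (ixD m m') z = mon m z * mon m' z.
Proof. by rewrite -big_split; apply: eq_bigr => i _; rewrite ffunE exprD. Qed.

Lemma mon0 z : mon ix0 z = 1.
Proof. by rewrite /mon big1 // => i _; rewrite ffunE expr0. Qed.

Lemma mon_at0 m : mon m 0 = (m == ix0)%:R.
Proof.
case: eqP => [->|ne]; first exact: mon0.
have [i mi] : exists i, m i != 0%N.
  apply/existsP; rewrite -negb_forall; apply/negP => /forallP h; apply: ne.
  by apply/ffunP => i; rewrite ffunE; exact/eqP.
by rewrite /mon (bigD1 i) //= mxE expr0n (negbTE mi) mul0r.
Qed.

Lemma mon_ge0 m (r : R) : 0 <= r -> 0 <= mon m (const_mx r).
Proof. by move=> r0; apply: prodr_ge0 => i _; rewrite mxE exprn_ge0. Qed.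

Lemma mon_gt0 m (r : R) : 0 < r -> 0 < mon m (const_mx r).
Proof. by move=> r0; apply: prodr_gt0 => i _; rewrite mxE exprn_gt0. Qed.

Lemma mon_le m z r : (forall i, `|z 0 i| <= r) -> `|mon m z| <= mon m (const_mx r).
Proof.
move=> zr; rewrite normr_prod; apply: ler_prod => i _.
by rewrite normr_ge0 mxE normrX lerXn2r ?nnegrE // (le_trans _ (zr i)).
Qed.

(** One positive exponent already yields a factor [t]; the other factors only decrease. *)
Lemma mon_scale m (t r : R) : 0 <= t <= 1 -> 0 <= r -> m != ix0 ->
  mon m (const_mx (t * r)) <= t * mon m (const_mx r).
Proof.
move=> /andP[t0 t1] r0 ne.
have [i mi] : exists i, m i != 0%N.
  apply/existsP; rewrite -negb_forall; apply/negP => /forallP h; case/eqP: ne.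
  by apply/ffunP => i; rewrite ffunE; exact/eqP.
rewrite /mon (bigD1 i) //= (bigD1 (P := xpredT) (F := fun j => const_mx r 0 j ^+ m j) i) //=.
rewrite !mxE mulrA; apply: ler_pM.
- by rewrite exprn_ge0 // mulr_ge0.
- by apply: prodr_ge0 => j _; rewrite mxE exprn_ge0 // mulr_ge0.
- rewrite exprMn ler_wpM2r ?exprn_ge0 //.
  by case: (m i) mi => // k _; rewrite exprS ler_piMr // exprn_ile1.
- apply: ler_prod => j _; rewrite !mxE exprn_ge0 ?mulr_ge0 //=.
  by rewrite lerXn2r ?nnegrE ?mulr_ge0 // ler_piMl.
Qed.

(** [b] is the weighted l^1 norm of the coefficients on the polydisc of radius [rho]: it bounds
    [phi] there and is submultiplicative, which controls the powers occurring in a composition. *)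
Definition rep (rho b : R) c (phi : 'rV[R]_n -> R) :=
  nsum (fun m => `|c m| * mon m (const_mx rho)) b /\
  forall z, (forall i, `|z 0 i| <= rho) -> hassum (fun m => c m * mon m z) (phi z).

Lemma rep_coef0 rho b c phi : 0 <= rho -> rep rho b c phi -> c ix0 = phi 0.
Proof.
move=> r0 [_ /(_ 0)] h; have {}h : hassum (fun m => c m * mon m 0) (phi 0).
  by apply: h => i; rewrite mxE normr0.
have := @hassum_seq R _ [:: ix0] (fun m => c m * mon m 0) erefl.
rewrite big_seq1 mon_at0 eqxx mulr1 => h'; apply: hassum_uniq (h' _) h.
by move=> m; rewrite inE mon_at0 => /negbTE ->; rewrite mulr0.
Qed.

Lemma rep_dom (T : choiceType) (c : T -> R) (mu : T -> idx) r b z :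
  nsum (fun t => `|c t| * mon (mu t) (const_mx r)) b -> (forall i, `|z 0 i| <= r) ->
  exists2 A, nsum (fun t => `|c t * mon (mu t) z|) A & A <= b.
Proof.
move=> nb zr; apply: nsum_dom nb => t.
by rewrite normr_ge0 normrM ler_wpM2l // mon_le.
Qed.

Lemma rep_bound rho b c phi z : rep rho b c phi -> (forall i, `|z 0 i| <= rho) ->
  `|phi z| <= b.
Proof.
move=> [nb h] zr; have [A nA] := rep_dom nb zr.
by apply: le_trans; apply: hassum_le (h _ zr) nA.
Qed.

(** Many indices [t] may carry the same monomial. Dividing the summable fibre over [m] by the
    positive number [mon m (const_mx rho)] shows that its coefficients are summable; their sum is
    the new coefficient. This serves both products and compositions. *)
Lemma rep_regroup (T : choiceType) (mu : T -> idx) (c : T -> R) rho b phi :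
  0 < rho -> nsum (fun t => `|c t| * mon (mu t) (const_mx rho)) b ->
  (forall z, (forall i, `|z 0 i| <= rho) ->
     hassum (fun t => c t * mon (mu t) z) (phi z)) ->
  exists c' b', rep rho b' c' phi /\ b' <= b.
Proof.
move=> r0 nb h; have [t nt st] := nsum_regroup mu nb.
have /choice [c' hc'] : forall m, exists d,
    hassum (fun i => if mu i == m then c i else 0) d /\
    `|d| * mon m (const_mx rho) <= t m.
  move=> m; have M0 := mon_gt0 m r0.
  have /asum_hassum[d hd ld] :
      nsum (fun i => `|if mu i == m then c i else 0|) ((mon m (const_mx rho))^-1 * t m).
    apply: nsum_ext (nsumZ _ (nt m)); last by rewrite invr_ge0 ltW.
    move=> i; case: eqP => [->|_]; last by rewrite normr0 mulr0.
    by rewrite mulrCA mulVf ?mulr1 // gt_eqF.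
  by exists d; split => //; rewrite -ler_pdivlMr // mulrC.
have [|b' nb' lb'] := nsum_dom (g := fun m => `|c' m| * mon m (const_mx rho)) _ st.
  by move=> m; rewrite mulr_ge0 ?mon_ge0 ?(ltW r0) //; case: (hc' m).
exists c', b'; split=> //; split=> // z zr.
apply: (hassum_regroup (mu := mu) (h z zr)) => m.
rewrite mulrC; apply: hassum_ext (hassumZ (mon m z) (proj1 (hc' m))) => i.
by case: eqP => [->|_]; rewrite ?mulr0 // mulrC.
Qed.

Lemma rep_shrink rho rho' b c phi : 0 <= rho' <= rho -> rep rho b c phi ->
  exists2 b', b' <= b & rep rho' b' c phi.
Proof.
move=> /andP[r0 rr] [nb h].
have [|b' nb' lb'] := nsum_dom (g := fun m => `|c m| * mon m (const_mx rho')) _ nb.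
  move=> m; rewrite mulr_ge0 ?mon_ge0 //= ler_wpM2l //.
  rewrite -[leLHS]ger0_norm ?mon_ge0 //; apply: mon_le => i.
  by rewrite mxE ger0_norm.
exists b' => //; split=> // z zr; apply: h => i.
exact: le_trans (zr i) rr.
Qed.

(** As the constant term vanishes, every remaining monomial gains a factor [t] on the shrunken
    polydisc, so the norm can be made arbitrarily small. *)
Lemma rep_scale rho b c phi t : 0 <= t <= 1 -> 0 <= rho -> phi 0 = 0 ->
  rep rho b c phi -> exists2 b', b' <= t * b & rep (t * rho) b' c phi.
Proof.
move=> /andP[t0 t1] r0 p0 hr; have c0 := rep_coef0 r0 hr; rewrite p0 in c0.
case: hr => nb h.
have [|b' nb' lb'] := nsum_dom (g := fun m => `|c m| * mon m (const_mx (t * rho))) _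
   (nsumZ t0 nb).
  move=> m; rewrite mulr_ge0 ?mon_ge0 ?mulr_ge0 //= mulrCA.
  have [->|ne] := eqVneq m ix0; first by rewrite c0 normr0 !mul0r.
  by rewrite ler_wpM2l // mon_scale // t0.
exists b' => //; split=> // z zr; apply: h => i; apply: le_trans (zr i) _.
by rewrite ler_piMl.
Qed.

Lemma rep_cst rho k : 0 <= rho ->
  rep rho `|k| (fun m => if m == ix0 then k else 0) (fun=> k).
Proof.
move=> r0; split=> [|z _].
  apply: nsum_ext (nsum_point ix0 (normr_ge0 k)) => m.
  by case: eqP => [->|_]; rewrite ?mon0 ?mulr1 // normr0 mul0r.
have := @hassum_seq R _ [:: ix0] (fun m => (if m == ix0 then k else 0) * mon m z) erefl.
rewrite big_seq1 eqxx mon0 mulr1; apply=> m.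
by rewrite inE => /negbTE ->; rewrite mul0r.
Qed.

Lemma repD rho b b' c c' phi phi' : 0 <= rho ->
  rep rho b c phi -> rep rho b' c' phi' ->
  exists b'', rep rho b'' (fun m => c m + c' m) (fun z => phi z + phi' z).
Proof.
move=> r0 [nb h] [nb' h'].
have [|d nd _] := nsum_dom (g := fun m => `|c m + c' m| * mon m (const_mx rho)) _ (nsumD nb nb').
  move=> m; rewrite mulr_ge0 ?mon_ge0 //= -mulrDl ler_wpM2r ?mon_ge0 //.
  exact: ler_normD.
exists d; split=> // z zr; apply: hassum_ext (hassumD (h z zr) (h' z zr)) => m.
by rewrite mulrDl.
Qed.

Lemma repM rho b b' c c' phi phi' : 0 < rho ->
  rep rho b c phi -> rep rho b' c' phi' ->
  exists c'' b'', rep rho b'' c'' (fun z => phi z * phi' z) /\ b'' <= b * b'.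
Proof.
move=> r0 [nb h] [nb' h'].
apply: (@rep_regroup _ (fun x : idx * idx => ixD x.1 x.2) (fun x => c x.1 * c' x.2)) => //.
  by apply: nsum_ext (nsumM nb nb') => x; rewrite normrM monD; ring.
move=> z zr; apply: hassum_ext (hassumM (h z zr) (h' z zr)) => x.
by rewrite monD; ring.
Qed.

(* Unlike that of analytic_at, this summability is unconditional, which gives closure under
   products and composition. *)
Definition pan (f : 'rV[R]_n -> R) x :=
  exists rho b c, 0 < rho /\ rep rho b c (fun z => f (x + z)).

Lemma pan_cst k x : pan (fun=> k) x.
Proof.
exists 1, `|k|, (fun m => if m == ix0 then k else 0); split=> //.
exact: (rep_cst _ ler01).
Qed.

Lemma pan2 f g x : pan f x -> pan g x -> exists r b c b' c', [/\ 0 < r,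
  rep r b c (fun z => f (x + z)) & rep r b' c' (fun z => g (x + z))].
Proof.
move=> [r [b [c [r0 h]]]] [r' [b' [c' [r0' h']]]]; exists (Num.min r r').
have [|b1 _ h1] := rep_shrink (rho' := Num.min r r') _ h.
  by rewrite le_min (ltW r0) (ltW r0') ge_min lexx.
have [|b2 _ h2] := rep_shrink (rho' := Num.min r r') _ h'.
  by rewrite le_min (ltW r0) (ltW r0') ge_min lexx orbT.
by exists b1, c, b2, c'; split=> //; rewrite lt_min r0.
Qed.

Lemma panD f g x : pan f x -> pan g x -> pan (fun y => f y + g y) x.
Proof.
move=> hf hg; have [r [b [c [b' [c' [r0 h h']]]]]] := pan2 hf hg.
by have [b'' h''] := repD (ltW r0) h h'; exists r, b'', (fun m => c m + c' m).
Qed.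

Lemma panM f g x : pan f x -> pan g x -> pan (fun y => f y * g y) x.
Proof.
move=> hf hg; have [r [b [c [b' [c' [r0 h h']]]]]] := pan2 hf hg.
by have [c'' [b'' [h'' _]]] := repM r0 h h'; exists r, b'', c''.
Qed.

Lemma pan_coord i x : pan (fun y => y 0 i) x.
Proof.
have hx : pan (fun=> x 0 i) x := pan_cst _ x.
have hi : pan (fun y => (y - x) 0 i) x.
  pose e : idx := [ffun j => (j == i : nat)].
  have me z : mon e z = z 0 i.
    rewrite /mon (bigD1 i) //= ffunE eqxx expr1 big1 ?mulr1 // => j /negbTE ji.
    by rewrite ffunE ji expr0.
  exists 1, 1, (fun m => if m == e then 1 else 0); split=> //; split=> [|z _].
    apply: nsum_ext (nsum_point e ler01) => m.
    by case: eqP => [->|_]; rewrite ?me ?mxE ?normr1 ?mul1r // normr0 mul0r.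
  have := @hassum_seq R _ [:: e] (fun m => (if m == e then 1 else 0) * mon m z) erefl.
  rewrite big_seq1 eqxx me mul1r (addrC x) addrK; apply=> m.
  by rewrite inE => /negbTE ->; rewrite mul0r.
rewrite (_ : (fun y => _) = fun y => (y - x) 0 i + x 0 i); first exact: panD.
by apply/funext => y; rewrite !mxE addrNK.
Qed.

Lemma pan_sum (I : Type) (s : seq I) (P : pred I) (F : I -> 'rV[R]_n -> R) x :
  (forall i, P i -> pan (F i) x) -> pan (fun y => \sum_(i <- s | P i) F i y) x.
Proof.
move=> h; elim: s => [|a s IH].
  by rewrite (_ : (fun y => _) = fun=> 0);
    [exact: pan_cst|apply/funext => y; rewrite big_nil].
have [Pa|/negbTE Pa] := boolP (P a).
  rewrite (_ : (fun y => _) = fun y => F a y + \sum_(i <- s | P i) F i y).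
    by apply: panD => //; exact: h.
  by apply/funext => y; rewrite big_cons Pa.
by rewrite (_ : (fun y => _) = fun y => \sum_(i <- s | P i) F i y) //;
  apply/funext => y; rewrite big_cons Pa.
Qed.

Lemma panN f x : pan f x -> pan (fun y => - f y) x.
Proof.
move=> hf; rewrite (_ : (fun y => _) = fun y => -1 * f y).
  by apply: panM => //; exact: pan_cst.
by apply/funext => y; rewrite mulN1r.
Qed.

Lemma panB f g x : pan f x -> pan g x -> pan (fun y => f y - g y) x.
Proof. by move=> hf hg; apply: panD => //; exact: panN. Qed.

Lemma panX f k x : pan f x -> pan (fun y => f y ^+ k) x.
Proof.
move=> hf; elim: k => [|k IH]; first exact: pan_cst.
rewrite (_ : (fun y => _) = fun y => f y * f y ^+ k); first exact: panM.
by apply/funext => y; rewrite exprS.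
Qed.

(* Coefficients of the powers [w ^ k] vanishing at the origin are dominated by a
   geometric series after shrinking the polydisc. *)
Lemma pan_comp (w : 'rV[R]_n -> R) x (al : nat -> R) A (F : R -> R) :
  pan w x -> w x = 0 -> nsum (fun k => `|al k| * 8^-1 ^+ k) A ->
  (forall t, `|t| <= 8^-1 -> hassum (fun k => al k * t ^+ k) (F t)) ->
  pan (fun y => F (w y)) x.
Proof.
move=> [r [b [c [r0 h]]]] wx nA hF.
have b0 : 0 <= b.
  exact: nsum_ge0 (proj1 h).
(* With this factor [t * b <= 8^-1], the radius at which the outer series is summable. *)
pose t := (8 * b + 1)^-1.
have t0 : 0 < t by rewrite invr_gt0; lra.
have t1 : t <= 1 by rewrite invf_le1; lra.
have [||b1 lb1 h1] := rep_scale (t := t) _ (ltW r0) _ h.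
- by rewrite (ltW t0).
- by rewrite addr0.
have {}lb1 : b1 <= 8^-1.
  apply: le_trans lb1 _; rewrite mulrC ler_pdivrMr; lra.
have b10 := nsum_ge0 (proj1 h1).
set s := t * r in h1; have s0 : 0 < s by rewrite mulr_gt0.
have /choice [ck hck] : forall k, exists cb : (idx -> R) * R,
    rep s cb.2 cb.1 (fun z => w (x + z) ^+ k) /\ cb.2 <= 8^-1 ^+ k.
  elim=> [|k [[c' b'] [/= hr lb]]].
    exists ((fun m => if m == ix0 then 1 else 0), `|1|); split=> /=.
      rewrite (_ : (fun z => _) = fun=> 1); first exact: (rep_cst _ (ltW s0)).
      by apply/funext => z; rewrite expr0.
    by rewrite normr1.
  have [c2 [b2 [hr2 lb2]]] := repM s0 h1 hr; exists (c2, b2); split=> /=.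
    by rewrite (_ : (fun z => _) = fun z => w (x + z) * w (x + z) ^+ k) //;
      apply/funext => z; rewrite exprS.
  apply: le_trans lb2 _; rewrite exprS; apply: ler_pM => //.
  exact: nsum_ge0 (proj1 hr).
have gt0 k m : 0 <= `|al k| * (`|(ck k).1 m| * mon m (const_mx s)).
  by rewrite !mulr_ge0 ?mon_ge0 // ltW.
have [|B nB lB] := nsum_dom (g := fun k => `|al k| * (ck k).2) _ nA.
  move=> k; have [hr lb] := hck k.
  by rewrite mulr_ge0 ?(nsum_ge0 (proj1 hr)) //= ler_wpM2l.
have nT : nsum (fun y : nat * idx =>
    `|al y.1 * (ck y.1).1 y.2| * mon y.2 (const_mx s)) B.
  apply/(@nsum_fubini _ _ _ _ (fun k => `|al k| * (ck k).2)) => //.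
    by move=> [k m]; rewrite /= normrM -mulrA.
  move=> k; have [hr lb] := hck k.
  apply: nsum_ext (nsumZ (normr_ge0 (al k)) (proj1 hr)) => m.
  by rewrite /= normrM mulrA.
have [|c' [b' [hr _]]] := rep_regroup (mu := snd) (phi := fun z => F (w (x + z))) s0 nT.
  move=> z zs; have [A' nA' _] := rep_dom nT zs.
  have [S hS _] := asum_hassum nA'.
  suff -> : F (w (x + z)) = S by [].
  have wz : `|w (x + z)| <= 8^-1 by apply: le_trans lb1; exact: rep_bound h1 zs.
  apply: hassum_uniq (hF _ wz) (hassum_fubini hS _) => k.
  have [[_ hr] _] := hck k.
  by apply: hassum_ext (hassumZ (al k) (hr z zs)) => m /=; rewrite mulrA.
by exists s, b', c'.
Qed.

Lemma pan_near f x e : pan f x -> 0 < e ->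
  exists2 d, 0 < d & forall z, (forall i, `|z 0 i| <= d) -> `|f (x + z) - f x| < e.
Proof.
move=> hf e0; have := panB hf (pan_cst (f x) x) => -[r [b [c [r0 h]]]].
have b0 := nsum_ge0 (proj1 h).
(* The shrinking factor [e / (b + e)] is at most 1 and brings the norm [b] below [e]. *)
have t0 : 0 < e * (b + e)^-1 by rewrite mulr_gt0 ?invr_gt0 ?addr_gt0_ge0 //; lra.
have t1 : e * (b + e)^-1 <= 1 by rewrite ler_pdivrMr; lra.
have [||b1 lb1 h1] := rep_scale (t := e * (b + e)^-1) _ (ltW r0) _ h.
- by rewrite (ltW t0).
- by rewrite addr0 subrr.
exists (e * (b + e)^-1 * r); first by rewrite mulr_gt0.
move=> z zr; apply: le_lt_trans (rep_bound h1 zr) _; apply: le_lt_trans lb1 _.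
by rewrite mulrAC ltr_pdivrMr ?ltr_pM2l //; lra.
Qed.

End PowerSeries.

(** * Analyticity of inverses and square roots *)

Section InverseSqrt.
Variable R : realType.

Lemma geometric_nsum : exists A, nsum (fun k => `|1| * 8^-1 ^+ k : R) A.
Proof.
have [||A nA _] := @nsum_nat_bound R (fun k => `|1| * 8^-1 ^+ k) 2.
- by move=> k; rewrite mulr_ge0 // exprn_ge0 // invr_ge0.
- move=> n; have p m : 0 <= 8^-1 ^+ m :> R by rewrite exprn_ge0 // invr_ge0.
  (* The additional term makes the induction work: [8^-n + 2 * 8^-(n+1) <= 2 * 8^-n]. *)
  suff : \sum_(i < n) `|1| * 8^-1 ^+ i + 2 * 8^-1 ^+ n <= 2 :> R.
    by have := p n; lra.
  elim: n => [|n IH]; first by rewrite big_ord0 expr0; lra.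
  by rewrite big_ord_recr /= exprS normr1; have := p n; rewrite normr1 in IH; lra.
by exists A.
Qed.

Lemma geometric_hassum (t : R) : `|t| <= 8^-1 ->
  hassum (fun k => 1 * t ^+ k) (1 - t)^-1.
Proof.
move=> ht; have [A nA] := geometric_nsum.
have [|B nB _] := @nsum_dom R _ (fun k => `|1 * t ^+ k|) _ _ _ nA.
  by move=> k; rewrite normr_ge0 normrM ler_wpM2l // normrX lerXn2r ?nnegrE // invr_ge0.
have [s hs _] := asum_hassum nB.
(* Splitting off the first term gives [s = 1 + t s], hence the closed form. *)
have := @hassum_natS R (fun k => 1 * t ^+ k) (t * s).
rewrite expr0 mul1r => h.
have /h /(hassum_uniq hs) e : hassum (fun k => 1 * t ^+ k.+1) (t * s).
  by apply: hassum_ext (hassumZ t hs) => k; rewrite exprS !mul1r.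
have t1 : 1 - t != 0.
  by apply/negP => /eqP h1; move: ht; rewrite (_ : t = 1) ?normr1; lra.
rewrite (_ : (1 - t)^-1 = s) //; apply: (mulfI t1); rewrite divff //.
by rewrite mulrBl mul1r; lra.
Qed.

(* The Catalan numbers: sqrt (1 - 4 t) = 1 - 2 t y, where y = 1 + t y ^ 2 is their
   generating series. *)
Fixpoint catalan_seq n : seq R :=
  if n is n'.+1 then
    let l := catalan_seq n' in
    rcons l (if n' is k.+1 then \sum_(i < k.+1) l`_i * l`_(k - i) else 1)
  else [::].

Definition catalan k := (catalan_seq k.+1)`_k.

Lemma size_catalan_seq n : size (catalan_seq n) = n.
Proof. by elim: n => //= n IH; rewrite size_rcons IH. Qed.

Lemma nth_catalan_seq n k : (k < n)%N -> (catalan_seq n)`_k = catalan k.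
Proof.
elim: n => // n IH; rewrite ltnS leq_eqVlt => /predU1P[-> //|kn].
by rewrite -IH //= nth_rcons size_catalan_seq kn.
Qed.

Lemma catalan0 : catalan 0 = 1. Proof. by []. Qed.

Lemma catalanS k : catalan k.+1 = \sum_(i < k.+1) catalan i * catalan (k - i).
Proof.
rewrite {1}/catalan.
rewrite -[catalan_seq k.+2]/(rcons (catalan_seq k.+1) (\sum_(i < k.+1)
  (catalan_seq k.+1)`_i * (catalan_seq k.+1)`_(k - i))).
rewrite nth_rcons size_catalan_seq ltnn eqxx.
apply: eq_bigr => i _; by rewrite !nth_catalan_seq // ltnS leq_subr.
Qed.

Lemma catalan_ge0 k : 0 <= catalan k.
Proof.
elim/ltn_ind: k => -[|k] IH; first by rewrite catalan0.
rewrite catalanS; apply: sumr_ge0 => i _; apply: mulr_ge0; apply: IH => //.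
by rewrite ltnS leq_subr.
Qed.

(** The left side runs over the pairs [(i, k - i)] with sum below [n], a part of the square of pairs
    of numbers below [n]. *)
Lemma conv_le (a : nat -> R) n : (forall k, 0 <= a k) ->
  \sum_(k < n) \sum_(i < k.+1) a i * a (k - i)%N <= (\sum_(k < n) a k) ^+ 2.
Proof.
move=> a0.
have -> : \sum_(k < n) \sum_(i < k.+1) a i * a (k - i)%N =
    \sum_(k < n) \sum_(i < n | (i <= k)%N) a i * a (k - i)%N.
  apply: eq_bigr => k _.
  by rewrite (big_ord_widen_cond n xpredT (fun i => a i * a (k - i)%N)).
rewrite (exchange_big_dep xpredT) //= expr2 mulr_suml; apply: ler_sum => i _.
rewrite -mulr_sumr ler_wpM2l //.
rewrite -(big_mkord (fun k => (i <= k)%N) (fun k => a (k - i)%N)) -(big_mkord xpredT a).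
rewrite (@big_cat_nat _ _ _ i) //= ?(ltnW (ltn_ord i)) // [X in X + _]big1_seq; last first.
  by move=> k; rewrite mem_index_iota leq0n /= leqNgt => /andP[/negP].
rewrite add0r -{1}[val i]add0n big_addn (@big_cat_nat _ _ _ (n - i)%N 0 n) ?leq_subr //=.
rewrite (eq_bigr a) => [|k _]; last by rewrite addnK.
rewrite [leLHS](eq_bigl xpredT) => [|k]; last by rewrite leq_addl.
by rewrite lerDl sumr_ge0.
Qed.

(** By [conv_le] and the recursion, successive partial sums satisfy [T' <= 1 + T ^ 2 / 8], which
    preserves the bound [T <= 2]. *)
Lemma catalan_nsum : exists2 A, nsum (fun k => catalan k * 8^-1 ^+ k) A & A <= 2.
Proof.
have p k : 0 <= catalan k * 8^-1 ^+ k.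
  by rewrite mulr_ge0 ?catalan_ge0 // exprn_ge0 // invr_ge0.
apply: nsum_nat_bound => // n; elim: n => [|n IH]; first by rewrite big_ord0.
rewrite big_ord_recl /= catalan0 expr0 mulr1.
rewrite (eq_bigr (fun k : 'I_n => 8^-1 * \sum_(i < k.+1)
    (catalan i * 8^-1 ^+ i) * (catalan (k - i) * 8^-1 ^+ (k - i)))); last first.
  move=> k _; rewrite /bump leq0n add1n catalanS exprS mulrCA; congr (_ * _).
  rewrite mulr_suml; apply: eq_bigr => i _.
  have -> : 8^-1 ^+ k = 8^-1 ^+ i * 8^-1 ^+ (k - i) :> R.
    by rewrite -exprD subnKC // -ltnS.
  ring.
rewrite -mulr_sumr.
have := @conv_le (fun k => catalan k * 8^-1 ^+ k) n p.
have T0 : 0 <= \sum_(k < n) catalan k * 8^-1 ^+ k by apply: sumr_ge0 => k _.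
by move: IH T0; set T := \sum_(k < n) catalan k * _; nra.
Qed.

Lemma catalan_hassum (t : R) : `|t| <= 8^-1 -> exists y,
  [/\ hassum (fun k => catalan k * t ^+ k) y, y = 1 + t * y ^+ 2 & `|y| <= 2].
Proof.
move=> ht; have [A nA lA] := catalan_nsum.
have [|B nB lB] := @nsum_dom R _ (fun k => `|catalan k * t ^+ k|) _ _ _ nA.
  move=> k; rewrite normr_ge0 normrM ger0_norm ?catalan_ge0 // ler_wpM2l ?catalan_ge0 //.
  by rewrite normrX lerXn2r ?nnegrE // invr_ge0.
have [y hy ly] := asum_hassum nB; exists y; split=> //; last first.
  exact: le_trans (le_trans ly lB) lA.
have h2 : hassum (fun k => catalan k.+1 * t ^+ k) (y ^+ 2).
  (* The product of the series with itself is grouped by total degree; by the recursion, the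
     coefficient of [t ^ k] is [catalan k.+1]. *)
  rewrite expr2; apply: (hassum_regroup (mu := fun x => (x.1 + x.2)%N) (hassumM hy hy)) => k.
  have -> : catalan k.+1 * t ^+ k = \sum_(x <- [seq (i, k - i)%N | i <- iota 0 k.+1])
     (if (x.1 + x.2)%N == k then (catalan x.1 * t ^+ x.1) * (catalan x.2 * t ^+ x.2) else 0).
    rewrite big_map catalanS mulr_suml -[iota 0 k.+1]/(index_iota 0 k.+1) big_mkord.
    apply: eq_bigr => i _ /=; have ik : (i <= k)%N by rewrite -ltnS.
    have -> : t ^+ k = t ^+ i * t ^+ (k - i) by rewrite -exprD subnKC.
    by rewrite subnKC // eqxx; ring.
  apply: hassum_seq => [|[i j]].
    by rewrite map_inj_uniq ?iota_uniq // => i j [].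
  case: eqP => // <- /negP h; case: h; apply/mapP.
  by exists i => /=; rewrite ?addKn // (mem_iota 0 (i + j).+1) ltnS leq_addr.
have := @hassum_natS R (fun k => catalan k * t ^+ k) (t * y ^+ 2).
rewrite expr0 catalan0 mul1r => h; apply: hassum_uniq hy (h _).
by apply: hassum_ext (hassumZ t h2) => k; rewrite exprS; ring.
Qed.

Definition sqrt_coef k : R := if k is k'.+1 then - 2 * catalan k' else 1.

Lemma sqrt_hassum (t : R) : `|t| <= 8^-1 ->
  hassum (fun k => sqrt_coef k * t ^+ k) (Num.sqrt (1 - 4 * t)).
Proof.
move=> ht; have [y [hy ey ly]] := catalan_hassum ht.
have -> : Num.sqrt (1 - 4 * t) = 1 - 2 * (t * y).
  (* This bound makes [1 - 2 t y] positive and so singles out the right square root. *)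
  have ty : `|t * y| <= 8^-1 * 2 by rewrite normrM ler_pM.
  have -> : 1 - 4 * t = (1 - 2 * (t * y)) ^+ 2.
    have e1 : y - t * y ^+ 2 = 1 by rewrite [in X in X - _]ey addrK.
    by transitivity (1 - 4 * t * (y - t * y ^+ 2)); [rewrite e1 mulr1|ring].
  rewrite sqrtr_sqr ger0_norm //; move: ty; rewrite ler_norml; lra.
have := @hassum_natS R (fun k => sqrt_coef k * t ^+ k) (- 2 * t * y).
rewrite expr0 mul1r (_ : 1 + _ = 1 - 2 * (t * y)); last by ring.
by apply; apply: hassum_ext (hassumZ (- 2 * t) hy) => k; rewrite /= exprS; ring.
Qed.

Lemma sqrt_nsum : exists A, nsum (fun k => `|sqrt_coef k| * 8^-1 ^+ k) A.
Proof.
have [|A nA] := hassum_asum (@sqrt_hassum 8^-1 _); first by rewrite ger0_norm // invr_ge0.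
exists A; apply: nsum_ext nA => k; rewrite normrM; congr (_ * _).
by rewrite ger0_norm // exprn_ge0 // invr_ge0.
Qed.

Variable n : nat.

(** [1 / f] is [1 / f x] times the geometric series in [w = 1 - f / f x], which vanishes at [x]. *)
Lemma panV (f : 'rV[R]_n -> R) x : pan f x -> f x != 0 -> pan (fun y => (f y)^-1) x.
Proof.
move=> hf fx; have [A nA] := geometric_nsum.
rewrite (_ : (fun y => _) = fun y => (f x)^-1 * (1 - (1 - (f x)^-1 * f y))^-1); last first.
  by apply/funext => y; rewrite opprB addrC subrK invfM invrK mulKf.
apply: panM; first exact: pan_cst.
apply: (pan_comp (w := fun y => 1 - (f x)^-1 * f y) (F := fun t => (1 - t)^-1)
  (al := fun=> 1) _ _ nA) => [||t]; last exact: geometric_hassum.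
- by apply: panB; [exact: pan_cst|apply: panM => //; exact: pan_cst].
- by rewrite mulVf // subrr.
Qed.

(** Same normalisation as for the inverse; the factor [4^-1] fits [w] to the series of
    [sqrt (1 - 4 t)]. *)
Lemma pan_sqrt (f : 'rV[R]_n -> R) x : pan f x -> 0 < f x ->
  pan (fun y => Num.sqrt (f y)) x.
Proof.
move=> hf fx; have [A nA] := sqrt_nsum.
rewrite (_ : (fun y => _) = fun y => Num.sqrt (f x) *
    Num.sqrt (1 - 4 * (4^-1 * (1 - (f x)^-1 * f y)))); last first.
  apply/funext => y; rewrite mulrA divff ?pnatr_eq0 // mul1r opprB addrC subrK.
  by rewrite -sqrtrM ?(ltW fx) // mulVKf // gt_eqF.
apply: panM; first exact: pan_cst.
apply: (pan_comp (w := fun y => 4^-1 * (1 - (f x)^-1 * f y))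
  (F := fun t => Num.sqrt (1 - 4 * t)) _ _ nA) => [||t]; last exact: sqrt_hassum.
- apply: panM; first exact: pan_cst.
  by apply: panB; [exact: pan_cst|apply: panM => //; exact: pan_cst].
- by rewrite mulVf ?gt_eqF // subrr mulr0.
Qed.

End InverseSqrt.

(** * From unconditional sums to sums over boxes *)

Section BoxSums.
Variables (R : realType) (n : nat).
Local Notation idx := {ffun 'I_n -> nat}.

Definition of_box N (m : {ffun 'I_n -> 'I_N}) : idx := [ffun i => m i : nat].

Lemma of_box_inj N : injective (@of_box N).
Proof.
move=> m m' /ffunP h; apply/ffunP => i; apply: val_inj.
by have := h i; rewrite !ffunE.
Qed.

Definition box N : seq idx := map (@of_box N) (index_enum _).

Lemma uniq_box N : uniq (box N).
Proof. by rewrite map_inj_uniq ?index_enum_uniq //; exact: of_box_inj. Qed.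

Lemma mem_box N (m : idx) : (forall i, (m i < N)%N) -> m \in box N.
Proof.
move=> mN; apply/mapP; exists [ffun i => Ordinal (mN i)]; first exact: mem_index_enum.
by apply/ffunP => i; rewrite !ffunE.
Qed.

Lemma nsum_box (g : idx -> R) A : nsum g A ->
  (fun N => \sum_(m : {ffun 'I_n -> 'I_N}) g (of_box m)) @ \oo --> A.
Proof.
move=> nA; have -> : (fun N => \sum_(m : {ffun 'I_n -> 'I_N}) g (of_box m)) =
    fun N => \sum_(m <- box N) g m.
  by apply/funext => N; rewrite /box big_map.
apply/cvgrPdist_lt => e e0; have [s us sA] := nsum_approx e0 nA.
pose N0 := \max_(m <- s) (\max_(i < n) m i).+1.
exists N0 => // N /= N0N; rewrite ger0_norm ?subr_ge0 ?nsum_seq_le ?uniq_box //.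
suff : \sum_(i <- s) g i <= \sum_(m <- box N) g m by lra.
have g0 := proj1 nA.
apply: (nsum_le _ (nsum_seq us g0) (nsum_seq (uniq_box N) g0)) => m.
case: ifP => [ms|_]; last by case: ifP.
rewrite mem_box // => i; apply: leq_trans N0N.
rewrite /N0 (big_rem m) //= leq_max; apply/orP; left.
by rewrite ltnS; exact: (leq_bigmax_cond (F := fun i => m i)).
Qed.

Lemma hassum_box (f : idx -> R) s : hassum f s ->
  (fun N => \sum_(m : {ffun 'I_n -> 'I_N}) f (of_box m)) @ \oo --> s.
Proof.
move=> [g [h [A [B [/nsum_box hA /nsum_box hB e ->]]]]].
have -> : (fun N => \sum_(m : {ffun 'I_n -> 'I_N}) f (of_box m)) =
    (fun N => \sum_(m : {ffun 'I_n -> 'I_N}) g (of_box m)) \-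
    (fun N => \sum_(m : {ffun 'I_n -> 'I_N}) h (of_box m)).
  by apply/funext => N /=; rewrite -sumrB; apply: eq_bigr => m _.
exact: cvgB.
Qed.

Lemma near_box (x : 'rV[R]_n) (P : 'rV[R]_n -> Prop) (d : R) : 0 < d ->
  (forall z : 'rV[R]_n, (forall i, `|z 0 i| <= d) -> P (x + z)) -> \forall y \near x, P y.
Proof.
move=> d0 h; apply/nbhs_ballP; exists d => //= y [_ xy].
rewrite -[y](subrKC x); apply: h => i.
by have := xy 0 i; rewrite /ball /= !mxE distrC => /ltW.
Qed.

Lemma pan_analytic_at (f : 'rV[R]_n -> R) x : pan f x -> analytic_at f x.
Proof.
move=> [r [b [c [r0 [nb h]]]]]; exists c; apply: (near_box r0) => z zr.
rewrite (addrC x) addrK; have hz := h z zr.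
have E N (m : {ffun 'I_n -> 'I_N}) : coeff_at c m * monom m z =
    c (of_box m) * mon (of_box m) z.
  congr (_ * _); apply: eq_bigr => i _; by rewrite ffunE.
split.
  have [A nA] := hassum_asum hz; apply/cvg_ex; exists A.
  rewrite (_ : (fun N => _) = fun N => \sum_(m : {ffun 'I_n -> 'I_N})
      `|c (of_box m) * mon (of_box m) z|); first exact: (nsum_box nA).
  by apply/funext => N; apply: eq_bigr => m _; rewrite E.
rewrite (_ : (fun N => _) = fun N => \sum_(m : {ffun 'I_n -> 'I_N})
    c (of_box m) * mon (of_box m) z); first by rewrite addrC; exact: (hassum_box hz).
by apply/funext => N; apply: eq_bigr => m _; rewrite E.
Qed.

Lemma pan_gt0 (f : 'rV[R]_n -> R) x : pan f x -> 0 < f x ->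
  \forall y \near x, 0 < f y.
Proof.
move=> hf fx; have [d d0 h] := pan_near hf fx; apply: (near_box d0) => z /h.
by rewrite ltr_norml; lra.
Qed.

Lemma pan_neq0 (f : 'rV[R]_n -> R) x : pan f x -> f x != 0 ->
  \forall y \near x, f y != 0.
Proof.
move=> hf fx.
have h : 0 < f x * f x by rewrite -expr2 exprn_even_gt0.
have [d d0 hd] := pan_near (panM hf hf) h; apply: (near_box d0) => z /hd.
by apply: contraTneq => ->; rewrite mulr0 sub0r normrN ger0_norm ?ltxx // ltW.
Qed.

End BoxSums.

(** * Differentiation in the plane *)

Section Calculus.
Variable R : realType.
Local Notation pt := 'rV[R]_2.
Implicit Types (f g : pt -> R) (x y v : pt).

Definition dir (i : 'I_2) : pt := delta_mx 0 i.

Lemma forall_ord2 (P : 'I_2 -> Prop) : P 0 -> P 1 -> forall i, P i.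
Proof. by move=> P0 P1; case=> -[|[|//]] h; [move: P0|move: P1]; congr P; apply: val_inj. Qed.

Lemma sum_ord2 (V : nmodType) (F : 'I_2 -> V) : \sum_i F i = F 0 + F 1.
Proof.
rewrite big_ord_recl big_ord_recl big_ord0 addr0; congr (_ + F _).
exact: val_inj.
Qed.

Lemma pt_decomp v : v = v 0 0 *: dir 0 + v 0 1 *: dir 1.
Proof.
apply/rowP; apply: forall_ord2; rewrite !mxE /= ?mulr1 ?mulr0 ?addr0 ?add0r //.
Qed.

(** Differentiability is bundled in because partial derivatives alone do not determine the
    directional ones; the explicit [d] lets derivatives be compared by [ring] and [field]. *)
Definition hasd f x (d : 'I_2 -> R) :=
  differentiable f x /\ forall i, 'D_(dir i) f x = d i.

Lemma hasd_eq f x d d' : hasd f x d -> (forall i, d i = d' i) -> hasd f x d'.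
Proof. by move=> [h1 h2] e; split=> // i; rewrite h2. Qed.

Lemma hasd_derive f x d v : hasd f x d -> 'D_v f x = v 0 0 * d 0 + v 0 1 * d 1.
Proof.
move=> [df e]; rewrite deriveE // {1}[v]pt_decomp linearD !linearZ /=.
by rewrite -!deriveE // !e.
Qed.

Lemma hasd_cst k x : hasd (fun=> k) x (fun=> 0).
Proof. by split=> [|i]; [exact: differentiable_cst|exact: derive_cst]. Qed.

Lemma hasd_comp (F : pt -> pt) x c : differentiable F x ->
  hasd (fun y => F y 0 c) x (fun i => ('D_(dir i) F x) 0 c).
Proof.
move=> dF; split=> [|i].
  exact: (differentiable_comp dF (@differentiable_coord R 1 2 (F x) 0 c)).
by rewrite (@derive_mx R _ 1 2 F) ?mxE //; exact: diff_derivable.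
Qed.

Lemma hasd_coord j x : hasd (fun y => y 0 j) x (fun i => (i == j)%:R).
Proof.
apply: hasd_eq (hasd_comp (F := id) j _) _ => // i.
by rewrite derive_id mxE eqxx eq_sym.
Qed.

Lemma hasdD f g x d d' : hasd f x d -> hasd g x d' ->
  hasd (fun y => f y + g y) x (fun i => d i + d' i).
Proof.
move=> [df e] [dg e']; split=> [|i]; first exact: differentiableD.
by rewrite -e -e'; apply: deriveD; exact: diff_derivable.
Qed.

Lemma hasdN f x d : hasd f x d -> hasd (fun y => - f y) x (fun i => - d i).
Proof.
move=> [df e]; split=> [|i]; first exact: differentiableN.
by rewrite -e; apply: deriveN; exact: diff_derivable.
Qed.

Lemma hasdM f g x d d' : hasd f x d -> hasd g x d' ->
  hasd (fun y => f y * g y) x (fun i => d i * g x + f x * d' i).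
Proof.
move=> [df e] [dg e']; split=> [|i]; first exact: differentiableM.
rewrite -e -e' addrC [X in _ + X]mulrC.
by apply: deriveM; exact: diff_derivable.
Qed.

Lemma hasdV f x d : f x != 0 -> hasd f x d ->
  hasd (fun y => (f y)^-1) x (fun i => - d i / f x ^+ 2).
Proof.
move=> fx [df e]; split=> [|i]; first exact: differentiableV.
rewrite -e mulNr mulrC -mulNr; apply: deriveV => //; exact: diff_derivable.
Qed.

Lemma hasdZ k f x d : hasd f x d -> hasd (fun y => k * f y) x (fun i => k * d i).
Proof.
by move=> h; apply: hasd_eq (hasdM (hasd_cst k x) h) _ => i; rewrite mul0r add0r.
Qed.

Lemma hasdB f g x d d' : hasd f x d -> hasd g x d' ->
  hasd (fun y => f y - g y) x (fun i => d i - d' i).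
Proof. by move=> h h'; apply: hasdD => //; exact: hasdN. Qed.

Lemma hasd_sum (I : Type) (s : seq I) (F : I -> pt -> R) x (d : I -> 'I_2 -> R) :
  (forall k, hasd (F k) x (d k)) ->
  hasd (fun y => \sum_(k <- s) F k y) x (fun i => \sum_(k <- s) d k i).
Proof.
move=> h; elim: s => [|k s IH].
  rewrite (_ : (fun y => _) = fun=> 0); last by apply/funext => y; rewrite big_nil.
  by apply: hasd_eq (hasd_cst _ _) _ => i; rewrite big_nil.
rewrite (_ : (fun y => _) = fun y => F k y + \sum_(j <- s) F j y); last first.
  by apply/funext => y; rewrite big_cons.
by apply: hasd_eq (hasdD (h k) IH) _ => i; rewrite big_cons.
Qed.

Lemma hasd_near_uniq f g x d d' : (\near x, f x = g x) -> hasd f x d -> hasd g x d' ->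
  forall i, d i = d' i.
Proof.
by move=> fg [_ e] [_ e'] i; rewrite -e -e'; exact: near_eq_derive.
Qed.

Lemma hasd_eps f x d e : hasd f x d -> 0 < e -> \forall h \near (0 : pt),
  `|f (x + h) - f x - (h 0 0 * d 0 + h 0 1 * d 1)| <= e * `|h|.
Proof.
move=> hf e0; have df := hf.1; have := diff_locally df.
move=> /eqaddoP /(_ e e0); apply: filterS => h /=.
rewrite -![(_ - _ : _ -> _) _]/(_ - _) -![(_ + _ : _ -> _) _]/(_ + _) /= /shift /=.
by rewrite opprD addrA (addrC h) -(hasd_derive h hf) deriveE.
Qed.

Lemma line_is_derive f x v t : derivable f (x + t *: v) v ->
  is_derive t 1 (fun s => f (x + s *: v)) ('D_v f (x + t *: v)).
Proof.
move=> df.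
have E : (fun h => h^-1 *: (((fun s => f (x + s *: v)) \o shift t) (h *: 1) - f (x + t *: v)))
   = (fun h => h^-1 *: ((f \o shift (x + t *: v)) (h *: v) - f (x + t *: v))).
  apply/funext => h; congr (_ *: (f _ - _)); rewrite /shift /=.
  by rewrite scalerDl [h *: 1]mulr1 addrCA.
by split; rewrite /derivable /derive E.
Qed.

End Calculus.

(** * Mixed second derivatives and local constancy *)

Section Young.
Variable R : realType.
Local Notation pt := 'rV[R]_2.
Local Notation dir := (@dir R).
Implicit Types (f g : pt -> R) (x y v : pt).

Lemma near_norm_ex x (P : pt -> Prop) : (\forall y \near x, P y) ->
  exists2 d : R, 0 < d & forall v, `|v| < d -> P (x + v).
Proof.
move=> /nbhs_ballP [d /= d0 h]; exists d => // v vd; apply: h.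
by rewrite -ball_normE /ball_ /= opprD addrA subrr sub0r normrN.
Qed.

Lemma near_norm_in x (P : pt -> Prop) (d : R) : 0 < d ->
  (forall v, `|v| < d -> P (x + v)) -> \forall y \near x, P y.
Proof.
move=> d0 h; apply/nbhs_ballP; exists d => //= y.
rewrite -ball_normE /ball_ /= distrC => /h.
by rewrite (addrC x) subrK.
Qed.

Lemma line_continuous f x v (a b : R) :
  (forall t, t \in `[a, b]%R -> differentiable f (x + t *: v)) ->
  {within `[a, b], continuous (fun s => f (x + s *: v))}.
Proof.
move=> h; apply: continuous_in_subspaceT => t.
rewrite inE => tab; have /h df := tab.
have := line_is_derive (diff_derivable df) => -[/derivable1_diffP].
by move=> /differentiable_continuous.
Qed.

Lemma line_MVT f x v (h : R) (df : R -> R) : 0 < h ->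
  (forall t, 0 <= t <= h -> differentiable f (x + t *: v)) ->
  (forall t, 0 <= t <= h -> 'D_v f (x + t *: v) = df t) ->
  exists2 t, 0 <= t <= h & f (x + h *: v) - f x = h * df t.
Proof.
move=> h0 hd e.
have [||t] := @MVT R (fun s => f (x + s *: v)) df 0 h h0.
- move=> t; rewrite in_itv /= => /andP[/ltW t0 /ltW t1].
  rewrite -e ?t0 // ; apply: line_is_derive; apply: diff_derivable; apply: hd.
  by rewrite t0.
- by apply: line_continuous => t; rewrite in_itv /= => /hd.
rewrite in_itv /= scale0r addr0 subr0 => /andP[/ltW t0 /ltW t1] E.
by exists t; rewrite ?t0 // E mulrC.
Qed.

Lemma translate_derive f x w v : differentiable f (x + w) ->
  differentiable (fun y => f (y + w)) x /\ 'D_v (fun y => f (y + w)) x = 'D_v f (x + w).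
Proof.
move=> df; split; first exact: (@differentiable_comp _ _ _ _ (fun y => y + w) f).
have E : (fun h => h^-1 *: (((fun y => f (y + w)) \o shift x) (h *: v) - f (x + w)))
   = (fun h => h^-1 *: ((f \o shift (x + w)) (h *: v) - f (x + w))).
  by apply/funext => h; rewrite /shift /= addrA.
by rewrite /derive E.
Qed.

(** The mean value theorem along [dir i], applied to [y => f (y + h *: dir j) - f y], turns the
    second difference into [h] times an increment of [gi], which differentiability of [gi] at [x]
    evaluates up to [o(h)]. *)
Lemma increment2 f (i j : 'I_2) (gi : pt -> R) x (d : 'I_2 -> R) e : 0 < e -> i != j ->
  (\forall y \near x, differentiable f y /\ 'D_(dir i) f y = gi y) -> hasd gi x d ->
  exists2 r, 0 < r & forall h, 0 < h < r ->
    `|f (x + h *: dir j + h *: dir i) - f (x + h *: dir i) - f (x + h *: dir j) + f x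
      - h ^+ 2 * d j| <= e * h ^+ 2.
Proof.
(* [h * K] bounds every displacement that occurs, whatever the norms of the basis vectors. *)
move=> e0 ij nf hg; pose K := 2 * (`|dir 0| + `|dir 1|) + 1 : R.
have K1 : 1 <= K by rewrite lerDr mulr_ge0 // addr_ge0.
have dK : forall k, `|dir k| <= `|dir 0| + `|dir 1|.
  by apply: forall_ord2; rewrite ?lerDl ?lerDr.
have K0 : 0 < K by lra.
have dirK k l (s t : R) : k != l -> 0 <= s -> 0 <= t -> s <= t ->
    `|s *: dir k + t *: dir l| <= t * K.
  move=> kl s0 t0 st; apply: le_trans (ler_normD _ _) _.
  rewrite !normrZ !ger0_norm //; apply: (@le_trans _ _ (t * (`|dir k| + `|dir l|))).
    by rewrite mulrDr lerD2r ler_wpM2r.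
  by rewrite ler_wpM2l // /K; have := dK k; have := dK l; lra.
have [r1 r10 h1] := near_norm_ex nf.
(* Two remainders occur, each at most [e1 * (h * K) = e * h / 2]. *)
pose e1 := e / (2 * K); have e10 : 0 < e1 by rewrite divr_gt0 // mulr_gt0.
have [r2 r20 h2] := near_norm_ex (hasd_eps hg e10).
exists (Num.min r1 r2 / K) => [|h /andP[h0]].
  by rewrite divr_gt0 // lt_min r10.
rewrite ltr_pdivlMr // lt_min => /andP[hr1 hr2].
have ji : j != i by rewrite eq_sym.
have B t : 0 <= t <= h -> `|t *: dir i + h *: dir j| <= h * K.
  by move=> /andP[t0 th]; apply: dirK => //; exact: ltW.
have B' t : 0 <= t <= h -> `|t *: dir i| <= h * K.
  move=> /andP[t0 th]; have := dirK j i 0 t ji (lexx 0) t0 t0.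
  by rewrite scale0r add0r => /le_trans; apply; rewrite ler_wpM2r // ltW.
pose F y := f (y + h *: dir j) - f y.
have hF t : 0 <= t <= h -> differentiable F (x + t *: dir i) /\
    'D_(dir i) F (x + t *: dir i) = gi (x + (t *: dir i + h *: dir j)) - gi (x + t *: dir i).
  move=> th.
  have [d1 <-] := h1 _ (le_lt_trans (B t th) hr1).
  have [d2 <-] := h1 _ (le_lt_trans (B' t th) hr1).
  have sh : differentiable (fun y => f (y + h *: dir j)) (x + t *: dir i) /\
      'D_(dir i) (fun y => f (y + h *: dir j)) (x + t *: dir i) =
      'D_(dir i) f (x + (t *: dir i + h *: dir j)).
    by rewrite addrA in d1 *; exact: translate_derive.
  split; first by apply: differentiableB => //; exact: sh.1.
  rewrite -sh.2; apply: deriveB; apply: diff_derivable => //; exact: sh.1.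
have [t th] := line_MVT h0 (fun t th => (hF t th).1) (fun t th => (hF t th).2).
rewrite /F => E.
have E1 := h2 (t *: dir i + h *: dir j) _; have E2 := h2 (t *: dir i) _.
rewrite !add0r in E1 E2.
have {E1} := E1 (le_lt_trans (B t th) hr2); have {E2} := E2 (le_lt_trans (B' t th) hr2).
move=> E2 E1.
have {}E1 := le_trans E1 (ler_wpM2l (ltW e10) (B t th)).
have {}E2 := le_trans E2 (ler_wpM2l (ltW e10) (B' t th)).
have ee : e1 * (h * K) = e * h / 2 by rewrite /e1; field; rewrite gt_eqF.
rewrite ee in E1 E2.
rewrite [X in `|X|](_ : _ = h * ((gi (x + (t *: dir i + h *: dir j)) - gi x -
    ((t *: dir i + h *: dir j) 0 0 * d 0 + (t *: dir i + h *: dir j) 0 1 * d 1)) -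
  (gi (x + t *: dir i) - gi x - ((t *: dir i) 0 0 * d 0 + (t *: dir i) 0 1 * d 1)))).
  have -> : e * h ^+ 2 = h * (e * h) by ring.
  rewrite normrM (ger0_norm (ltW h0)) (ler_wpM2l (ltW h0)) //.
  apply: le_trans (ler_normB _ _) _; lra.
transitivity ((f (x + h *: dir i + h *: dir j) - f (x + h *: dir i) -
   (f (x + h *: dir j) - f x)) - h ^+ 2 * d j); first by rewrite (addrAC x (h *: dir j)); ring.
rewrite E; have -> : d j = (dir j) 0 0 * d 0 + (dir j) 0 1 * d 1.
  by move: (j); apply: forall_ord2; rewrite !mxE /=; ring.
by rewrite !mxE; ring.
Qed.

(** Both orders of differentiation approximate the same second difference, so the two values differ
    by at most [2 * e]. Differentiability of the first partials at the point suffices, which is what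
    solutions of a first order system provide. *)
Lemma young f (g : 'I_2 -> pt -> R) x (d0 d1 : 'I_2 -> R) :
  (\forall y \near x, hasd f y (g^~ y)) -> hasd (g 0) x d0 -> hasd (g 1) x d1 ->
  d0 1 = d1 0.
Proof.
move=> nf h0 h1.
have key e : 0 < e -> `|d0 1 - d1 0| <= 2 * e.
  move=> e0.
  have [||r r0 H] := @increment2 f 0 1 (g 0) x d0 e e0 _ _ h0 => //.
    by apply: filterS nf => y [df E].
  have [||r' r'0 H'] := @increment2 f 1 0 (g 1) x d1 e e0 _ _ h1 => //.
    by apply: filterS nf => y [df E].
  pose h := Num.min r r' / 2.
  have m0 : 0 < Num.min r r' by rewrite lt_min r0.
  have hm : 0 < h < Num.min r r' by rewrite /h; apply/andP; split; lra.
  have [hp] := andP hm; rewrite lt_min => /andP[hr hr'].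
  have {H} := H h; have {H'} := H' h; rewrite hp hr hr' => /(_ isT) A /(_ isT) B.
  have h2 : 0 < h ^+ 2 by rewrite exprn_gt0.
  rewrite -(ler_pM2l h2) -[h ^+ 2 in leLHS](ger0_norm (ltW h2)) -normrM.
  rewrite (addrAC x (h *: dir 1)) in B.
  move: A B; set u := f _; set v := f _; set w := f _ => A B.
  rewrite [X in `|X|](_ : _ =
    (u - v - w + f x - h ^+ 2 * d1 0) - (u - w - v + f x - h ^+ 2 * d0 1)); last by ring.
  apply: le_trans (ler_normB _ _) _; lra.
apply/eqP; rewrite -subr_eq0 -normr_le0; apply/ler_addgt0Pr => e e0.
rewrite add0r; have := key (e / 2) (divr_gt0 e0 _); rewrite mulrC divfK //.
by apply.
Qed.

Lemma locally_constant f x : (\forall y \near x, hasd f y (fun=> 0)) ->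
  \forall y \near x, f y = f x.
Proof.
move=> /near_norm_ex [r r0 h]; apply: (near_norm_in r0) => v vr.
have D t : 0 <= t <= 1 -> hasd f (x + t *: v) (fun=> 0).
  move=> /andP[t0 t1]; apply: h; rewrite normrZ ger0_norm //.
  by apply: le_lt_trans vr; rewrite ler_piMl.
have [t th|t th|t _] := @line_MVT f x v 1 (fun=> 0) ltr01.
- by have [] := D t th.
- by rewrite (hasd_derive _ (D t th)) !mulr0 addr0.
by rewrite mulr0 scale1r => /eqP; rewrite subr_eq0 => /eqP.
Qed.

End Young.

(** * Algebra of the structure constants *)

Section Algebra.
Variable R : realType.
Implicit Types (C : WB2 R) (m n : 'I_2 -> 'I_2 -> R) (e : R) (i j k c : 'I_2).

(** The symbols of the connection [w^-1 C] in the frame [w d_i], where [dw = e dx^1]: the extra term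
    is the derivative of [w]. *)
Definition frame_symbol e C : WB2 R := fun i j k =>
  C i j k + e * (i == 0)%:R * (j == k)%:R.

Definition mdet m : R := m 0 0 * m 1 1 - m 0 1 * m 1 0.

(** At frame symbols this is the right side of [w d_i M = Q_i(M)]: the failure of a constant [m] to
    carry the connection [C'] to [C]. The index [c] belongs to the target, [i] and [j] to the
    source. *)
Definition qform C' C m i c j : R :=
  \sum_k C' i j k * m c k - \sum_a \sum_b C a b c * (m a i * m b j).

Definition qform_lin C' C m n i c j : R :=
  \sum_k C' i j k * n c k - \sum_a \sum_b C a b c * (n a i * m b j + m a i * n b j).

(** Up to the factor [w ^ -2], the operator [R(d_1, d_2)] of the connection [w^-1 C]; the term in
    [e] comes from differentiating [w^-1]. *)
Definition curv e C c j : R :=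
  \sum_b (C 0 b c * C 1 j b - C 1 b c * C 0 j b) - e * C 1 j c.

(** Compares the antisymmetrised system with the brackets of the frames, [[e_0, e_1] = e e_1] on the
    source and [[e_0, e_1] = e_1] on the target. It vanishes on Jacobians by equality of mixed
    derivatives. *)
Definition tors e C' C m c : R :=
  qform (frame_symbol e C') (frame_symbol 1 C) m 0 c 1
  - qform (frame_symbol e C') (frame_symbol 1 C) m 1 c 0
  - (e * m c 1 - (m 0 0 * m c 1 - m 0 1 * m c 0)).

(** Integrability of the system: the left side is the commutator of [w d_0] and [w d_1] on [M], less
    its bracket term. Once [tors] vanishes, what remains says that [m] carries one curvature
    operator to the other, with the factor [mdet m] of a 2-form. *)
Lemma qform_commutator e C' C m c j :
  qform_lin (frame_symbol e C') (frame_symbol 1 C) m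
    (qform (frame_symbol e C') (frame_symbol 1 C) m 0) 1 c j
  - qform_lin (frame_symbol e C') (frame_symbol 1 C) m
    (qform (frame_symbol e C') (frame_symbol 1 C) m 1) 0 c j
  - e * qform (frame_symbol e C') (frame_symbol 1 C) m 1 c j
  = \sum_k m c k * curv e C' k j - mdet m * \sum_k curv 1 C c k * m k j
   - \sum_a \sum_b frame_symbol 1 C a b c * (tors e C' C m a * m b j).
Proof.
move: c j; do 2! (apply: forall_ord2);
  by rewrite /tors /qform_lin /qform /curv /mdet /frame_symbol !sum_ord2 /=; ring.
Qed.

Implicit Types (A B D : R) (r : 'I_2 -> 'I_2 -> R).

(* The entries of the symmetric Ricci tensor -eps r, eps = [[0, 1], [-1, 0]], of the
   curvature operator r. *)
Definition sA r := - r 1 0.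
Definition sB r := (r 0 0 - r 1 1) / 2.
Definition sD r := r 0 1.

Definition sbil A B D m n j k : R :=
  A * (m 0 j * n 0 k) + B * (m 0 j * n 1 k + m 1 j * n 0 k) + D * (m 1 j * n 1 k).

(** Here [r' = mdet m * m^-1 r m]. Since [m^T eps m = mdet m * eps], lowering with [eps] turns this
    into the congruence [eps r' = m^T (eps r) m], whose symmetric part is the claim; the trace of
    [r] sits in the antisymmetric part. *)
Lemma ricci_natural r r' m : mdet m != 0 ->
  (forall c j, \sum_k m c k * r' k j = mdet m * \sum_k r c k * m k j) ->
  [/\ sA r' = sbil (sA r) (sB r) (sD r) m m 0 0,
      sB r' = sbil (sA r) (sB r) (sD r) m m 0 1 &
      sD r' = sbil (sA r) (sB r) (sD r) m m 1 1].
Proof.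
move=> d0 E.
have r0 j : r' 0 j = m 1 1 * \sum_k r 0 k * m k j - m 0 1 * \sum_k r 1 k * m k j.
  apply: (mulfI d0); transitivity (m 1 1 * (\sum_k m 0 k * r' k j) -
    m 0 1 * (\sum_k m 1 k * r' k j)); first by rewrite !sum_ord2 /mdet; ring.
  by rewrite !E; ring.
have r1 j : r' 1 j = m 0 0 * \sum_k r 1 k * m k j - m 1 0 * \sum_k r 0 k * m k j.
  apply: (mulfI d0); transitivity (m 0 0 * (\sum_k m 1 k * r' k j) -
    m 1 0 * (\sum_k m 0 k * r' k j)); first by rewrite !sum_ord2 /mdet; ring.
  by rewrite !E; ring.
by rewrite /sA /sB /sD /sbil !r0 !r1 !sum_ord2; split; field.
Qed.

(** [J = eps S], so that [S J = S eps S] is antisymmetric and [J ^ 2 = - det S]: for [det S <> 0] it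
    spans the Lie algebra of isometries of [S]. *)
Definition Jmat A B D c j : R :=
  if c == 0 then (if j == 0 then B else D) else (if j == 0 then - A else - B).

Definition Jmul A B D m c j : R := \sum_k Jmat A B D c k * m k j.

(** The hypothesis makes [n m^-1] skew for the form, hence a multiple of [J]. The multiple is read
    off the off-diagonal entry of [m^T S n], as [m^T S J m = det S * mdet m * eps]. *)
Lemma skew_multiple A B D m n : A * D - B ^+ 2 != 0 -> mdet m != 0 ->
  (forall j k, sbil A B D n m j k + sbil A B D m n j k = 0) ->
  exists l, forall c j, n c j = l * Jmul A B D m c j.
Proof.
move=> s0 d0 E; exists (sbil A B D m n 0 1 / (mdet m * (A * D - B ^+ 2))).
have P0 : mdet m * (A * D - B ^+ 2) != 0 by rewrite mulf_neq0.
move=> c j; apply: (mulfI P0); rewrite mulrA mulrCA divff // mulr1.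
have sym j' k : sbil A B D n m j' k = sbil A B D m n k j'.
  by rewrite /sbil; ring.
have T00 : sbil A B D m n 0 0 = 0 by have := E 0 0; rewrite sym; lra.
have T11 : sbil A B D m n 1 1 = 0 by have := E 1 1; rewrite sym; lra.
have T10 : sbil A B D m n 1 0 = - sbil A B D m n 0 1 by have := E 0 1; rewrite sym; lra.
have K : forall c j, mdet m * (A * D - B ^+ 2) * n c j = if c == 0 then
   D * (m 1 1 * sbil A B D m n 0 j - m 1 0 * sbil A B D m n 1 j)
   - B * (m 0 0 * sbil A B D m n 1 j - m 0 1 * sbil A B D m n 0 j)
  else A * (m 0 0 * sbil A B D m n 1 j - m 0 1 * sbil A B D m n 0 j)
   - B * (m 1 1 * sbil A B D m n 0 j - m 1 0 * sbil A B D m n 1 j).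
  by do 2! (apply: forall_ord2); rewrite /sbil /mdet /=; ring.
rewrite K; move: c j; do 2! (apply: forall_ord2);
  by rewrite /= ?T00 ?T11 ?T10 /Jmul /Jmat sum_ord2 /=; ring.
Qed.

(* The deviation from the Levi-Civita connection of the Ricci metric: in the invariant
   frame the latter has symbols gamma_i J. *)
Definition dev A B D e C i j k : R :=
  frame_symbol e C i j k - e * ((if i == 0 then B else D) / (A * D - B ^+ 2)) * Jmat A B D k j.

Lemma Jmul_det A B D m c j :
  \sum_k m c k * Jmat (sbil A B D m m 0 0) (sbil A B D m m 0 1) (sbil A B D m m 1 1) k j
  = mdet m * Jmul A B D m c j.
Proof.
move: c j; do 2! (apply: forall_ord2);
  by rewrite /Jmul /Jmat /sbil /mdet !sum_ord2 /=; ring.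
Qed.

Lemma sbil_det A B D m : sbil A B D m m 0 0 * sbil A B D m m 1 1 - sbil A B D m m 0 1 ^+ 2
  = (A * D - B ^+ 2) * mdet m ^+ 2.
Proof. by rewrite /sbil /mdet; ring. Qed.

Lemma columns_free m (x y : R) : mdet m != 0 ->
  (forall c, x * m c 0 + y * m c 1 = 0) -> x = 0 /\ y = 0.
Proof.
move=> d0 E; split; apply: (mulfI d0); rewrite mulr0.
  transitivity (m 1 1 * (x * m 0 0 + y * m 0 1) - m 0 1 * (x * m 1 0 + y * m 1 1)).
    by rewrite /mdet; ring.
  by rewrite !E !mulr0 subr0.
transitivity (m 0 0 * (x * m 1 0 + y * m 1 1) - m 1 0 * (x * m 0 0 + y * m 0 1)).
  by rewrite /mdet; ring.
by rewrite !E !mulr0 subr0.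
Qed.

Lemma mdet_Jmul A B D m : mdet (Jmul A B D m) = (A * D - B ^+ 2) * mdet m.
Proof. by rewrite /mdet /Jmul /Jmat !sum_ord2 /=; ring. Qed.

(** The Levi-Civita parts lie in the span of [J], so a priori the two sides differ by [nu i] times
    [J m]. Vanishing torsion equates [nu 0] times column 1 of [J m] with [nu 1] times column 0; the
    columns are independent, so [nu = 0]. This is the uniqueness of the Levi-Civita connection in
    the present setting. *)
Lemma dev_natural A B D e C' C m (l : 'I_2 -> R) : A * D - B ^+ 2 != 0 -> mdet m != 0 ->
  (forall i c j, qform (frame_symbol e C') (frame_symbol 1 C) m i c j =
     l i * Jmul A B D m c j) ->
  (forall c, tors e C' C m c = 0) ->
  forall i j c, \sum_k m c k *
    dev (sbil A B D m m 0 0) (sbil A B D m m 0 1) (sbil A B D m m 1 1) e C' i j k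
    = \sum_a \sum_b dev A B D 1 C a b c * (m a i * m b j).
Proof.
move=> s0 d0 Eq Et.
pose s := A * D - B ^+ 2.
pose g' i := (if i == 0 then sbil A B D m m 0 1 else sbil A B D m m 1 1) /
  (s * mdet m ^+ 2).
pose g i := (B * m 0 i + D * m 1 i) / s.
pose nu i := l i - e * g' i * mdet m + g i.
have K i j c : \sum_k m c k *
    dev (sbil A B D m m 0 0) (sbil A B D m m 0 1) (sbil A B D m m 1 1) e C' i j k
    - \sum_a \sum_b dev A B D 1 C a b c * (m a i * m b j) = nu i * Jmul A B D m c j.
  transitivity (qform (frame_symbol e C') (frame_symbol 1 C) m i c j
    - e * g' i * (\sum_k m c k * Jmat (sbil A B D m m 0 0) (sbil A B D m m 0 1)
        (sbil A B D m m 1 1) k j) + g i * Jmul A B D m c j).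
    rewrite /dev sbil_det -/s -/(g' i) /qform.
    rewrite !sum_ord2 /g /Jmul !sum_ord2 /=.
    by move: (Jmat A B D) => JJ; ring.
  by rewrite Eq Jmul_det /nu; ring.
have dJ : mdet (Jmul A B D m) != 0 by rewrite mdet_Jmul mulf_neq0.
have [n1 n0] : - nu 1 = 0 /\ nu 0 = 0.
  apply: (columns_free dJ) => c; rewrite mulNr addrC -!K.
  transitivity (tors e C' C m c + e * m c 1
    - (e * g' 0 * (\sum_k m c k * Jmat (sbil A B D m m 0 0) (sbil A B D m m 0 1)
        (sbil A B D m m 1 1) k 1) - e * g' 1 * (\sum_k m c k * Jmat (sbil A B D m m 0 0)
        (sbil A B D m m 0 1) (sbil A B D m m 1 1) k 0))
    - (m 0 0 * m c 1 - m 0 1 * m c 0) + (g 0 * Jmul A B D m c 1 - g 1 * Jmul A B D m c 0)).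
    rewrite /dev sbil_det -/s -/(g' 0) -/(g' 1) /tors /qform.
    rewrite !sum_ord2 /g /Jmul !sum_ord2 /=.
    by move: (Jmat A B D) => JJ; ring.
  rewrite Et !Jmul_det /g /g' /Jmul /Jmat /sbil !sum_ord2 /=.
  move: c s0 d0; rewrite /s; apply: forall_ord2 => s0 d0 /=; rewrite /mdet in d0 *; field;
  by rewrite ?s0 ?d0.
move=> i j c; apply/eqP; rewrite -subr_eq0 K; apply/eqP.
suff -> : nu i = 0 by rewrite mul0r.
by move: i; apply: forall_ord2 => //; move/eqP: n1; rewrite oppr_eq0 => /eqP.
Qed.

Implicit Types a : WB2 R.

Lemma bilinear_columns (T : WB2 R) m : mdet m != 0 ->
  (forall i j c, \sum_a \sum_b T a b c * (m a i * m b j) = 0) ->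
  forall i j c, T i j c = 0.
Proof.
move=> d0 E i j c; pose v j b := T 0 b c * m 0 j + T 1 b c * m 1 j.
have V j' : v j' 0 = 0 /\ v j' 1 = 0.
  have [||h0 h1] := @columns_free (fun b k => m k b) (v j' 0) (v j' 1).
  - by move: d0; rewrite /mdet [m 1 0 * _]mulrC.
  - by move=> k; have := E j' k c; rewrite !sum_ord2 => <-; rewrite /v; ring.
  by [].
have W b : T 0 b c = 0 /\ T 1 b c = 0.
  apply: (@columns_free (fun b k => m k b)).
    by move: d0; rewrite /mdet [m 1 0 * _]mulrC.
  by move=> k; have [] := V k; move: b; apply: forall_ord2; rewrite /v.
by have [] := W j; move: i; apply: forall_ord2.
Qed.

Definition Jact A B D a : WB2 R := fun i j c =>
  \sum_d Jmat A B D c d * a i j d - \sum_b Jmat A B D b i * a b j c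
  - \sum_b Jmat A B D b j * a i b c.

Definition J0 A B D a : WB2 R := fun i j c => \sum_d Jmat A B D c d * a i j d.
Definition J1 A B D a : WB2 R := fun i j c => \sum_b Jmat A B D b i * a b j c.
Definition J2 A B D a : WB2 R := fun i j c => \sum_b Jmat A B D b j * a i b c.

(* With X, Y, Z the actions of J on the three slots, X^2 = Y^2 = Z^2 = - s, so that
   (X + Y + Z) (s + 2 Y Z) (X - Y - Z) = - 3 s ^ 2. *)
Lemma Jact_eq0 A B D a : A * D - B ^+ 2 != 0 -> (forall i j c, Jact A B D a i j c = 0) ->
  forall i j c, a i j c = 0.
Proof.
move=> s0 E; pose s := A * D - B ^+ 2.
pose t i j c := s * Jact A B D a i j c + 2 * J1 A B D (J2 A B D (Jact A B D a)) i j c.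
have K i j c : - (3 * s ^+ 2) * a i j c = J0 A B D t i j c + J1 A B D t i j c + J2 A B D t i j c.
  move: i j c; do 3! (apply: forall_ord2);
  by rewrite /t /s /Jact /J0 /J1 /J2 !sum_ord2 /Jmat /=; ring.
have t0 i j c : t i j c = 0.
  by rewrite /t /J1 /J2 !sum_ord2 !E; ring.
move=> i j c; have s2 : - (3 * s ^+ 2) != 0.
  by rewrite oppr_eq0 mulf_neq0 ?pnatr_eq0 // expf_neq0.
by apply: (mulfI s2); rewrite K mulr0 /J0 /J1 /J2 !sum_ord2 !t0; ring.
Qed.

(** The hypothesis is the derivative of the relation of [dev_natural] in a direction in which [M]
    changes by [l J M]: [l] times the action of [J] on the deviation, pulled back by [m], is
    zero. *)
Lemma dev_flat A B D C m (l : R) : A * D - B ^+ 2 != 0 -> mdet m != 0 ->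
  (forall i j c, l * (\sum_k Jmat A B D c k *
      (\sum_a \sum_b dev A B D 1 C a b k * (m a i * m b j))
    - \sum_a \sum_b dev A B D 1 C a b c *
      (Jmul A B D m a i * m b j + m a i * Jmul A B D m b j)) = 0) ->
  l != 0 -> forall i j k, dev A B D 1 C i j k = 0.
Proof.
move=> s0 d0 E l0; apply: (Jact_eq0 s0); apply: (bilinear_columns d0) => i j c.
apply: (mulfI l0); rewrite mulr0 -[RHS](E i j c); congr (_ * _).
rewrite /Jact /Jmul !sum_ord2; move: (Jmat A B D) (dev A B D 1 C) => JJ d.
by ring.
Qed.

(** The derivative of [qform C C m] in [m] at the identity, hence the linearised system for Killing
    fields. *)
Definition lin_act C n i c j : R :=
  \sum_k C i j k * n c k - \sum_k C k j c * n k i - \sum_k C i k c * n k j.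

Lemma lin_act_commutator C n c j :
  lin_act (frame_symbol 1 C) (lin_act (frame_symbol 1 C) n 0) 1 c j
  - lin_act (frame_symbol 1 C) (lin_act (frame_symbol 1 C) n 1) 0 c j
  - lin_act (frame_symbol 1 C) n 1 c j
  = \sum_k n c k * curv 1 C k j - \sum_k curv 1 C c k * n k j
    - (n 0 0 + n 1 1) * curv 1 C c j
   - \sum_a frame_symbol 1 C a j c *
      (lin_act (frame_symbol 1 C) n 0 a 1 - lin_act (frame_symbol 1 C) n 1 a 0
       - (if a == 1 then - n 0 0 else n 0 1)).
Proof.
move: c j; do 2! (apply: forall_ord2);
  rewrite /lin_act /curv /frame_symbol !sum_ord2 /=; ring.
Qed.

Definition idm : 'I_2 -> 'I_2 -> R := fun i j => (i == j)%:R.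

Lemma mdet_idm : mdet idm = 1.
Proof. by rewrite /mdet /idm /=; ring. Qed.

Lemma Jmul_idm A B D c j : Jmul A B D idm c j = Jmat A B D c j.
Proof. by move: c j; do 2! (apply: forall_ord2); rewrite /Jmul /idm sum_ord2 /=; ring. Qed.

(** Linearised [ricci_natural]: an infinitesimal automorphism of the curvature is skew for the
    symmetric Ricci form. *)
Lemma ricci_skew (r n : 'I_2 -> 'I_2 -> R) :
  (forall c j, \sum_k n c k * r k j - \sum_k r c k * n k j - (n 0 0 + n 1 1) * r c j = 0) ->
  forall j k, sbil (sA r) (sB r) (sD r) n idm j k + sbil (sA r) (sB r) (sD r) idm n j k = 0.
Proof.
move=> E; have := E 0 0; have := E 0 1; have := E 1 0; have := E 1 1.
rewrite !sum_ord2 => h11 h10 h01 h00.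
by do 2! (apply: forall_ord2); rewrite /sbil /sA /sB /sD /idm /=; lra.
Qed.

Lemma lin_dev_flat A B D C (n : 'I_2 -> 'I_2 -> R) (t : R) (l : 'I_2 -> R) :
  A * D - B ^+ 2 != 0 -> (forall c j, n c j = t * Jmat A B D c j) ->
  (forall i c j, lin_act (frame_symbol 1 C) n i c j = l i * Jmat A B D c j) ->
  (forall c, lin_act (frame_symbol 1 C) n 0 c 1 - lin_act (frame_symbol 1 C) n 1 c 0
     = (if c == 1 then - n 0 0 else n 0 1)) ->
  t != 0 -> forall i j k, dev A B D 1 C i j k = 0.
Proof.
move=> s0 En El Et t0.
pose s := A * D - B ^+ 2.
pose g i := (if i == 0 then B else D) / s.
pose nu i := l i + t * (\sum_b g b * Jmat A B D b i).
have K i j c : t * Jact A B D (dev A B D 1 C) i j c = nu i * Jmat A B D c j.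
  rewrite /nu mulrDl -El /lin_act /Jact !sum_ord2 !En /dev -/s -!/(g _) !mul1r.
  by rewrite /g /=; ring.
have dJ : mdet (Jmat A B D) != 0.
  by rewrite (_ : mdet _ = A * D - B ^+ 2) // /mdet /Jmat /=; ring.
have [n1 n0] : - nu 1 = 0 /\ nu 0 = 0.
  apply: (columns_free dJ) => c; rewrite mulNr addrC /nu !mulrDl -!El.
  have := Et c; rewrite !En => Et'.
  transitivity ((if c == 1 then - (t * Jmat A B D 0 0) else t * Jmat A B D 0 1) +
    (t * (\sum_b g b * Jmat A B D b 0) * Jmat A B D c 1
    - t * (\sum_b g b * Jmat A B D b 1) * Jmat A B D c 0)); first by rewrite -Et'; ring.
  rewrite !sum_ord2 /g /s; move: c {Et'}; apply: forall_ord2; rewrite /Jmat /=; by field.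
apply: (Jact_eq0 s0) => i j c; apply: (mulfI t0); rewrite mulr0 K.
suff -> : nu i = 0 by rewrite mul0r.
by move: i; apply: forall_ord2 => //; move/eqP: n1; rewrite oppr_eq0 => /eqP.
Qed.

Definition ricA C := sA (curv 1 C).
Definition ricB C := sB (curv 1 C).
Definition ricD C := sD (curv 1 C).
Definition ricdet C := ricA C * ricD C - ricB C ^+ 2.

Lemma curv_frame e C c j :
  curv e C c j = curv 0 (frame_symbol e C) c j - e * frame_symbol e C 1 j c.
Proof.
by move: c j; do 2! (apply: forall_ord2); rewrite /curv /frame_symbol !sum_ord2 /=; ring.
Qed.

(** With symbols [gamma_i J] the quadratic terms of the curvature cancel, since [J] commutes with
    itself, and only [- gamma_1 J] is left. Its Ricci form is [- gamma_1] times the given one, so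
    [gamma_1 = ricD C / ricdet C] equals [-1]. *)
Lemma dev0_ricdet C : ricdet C != 0 ->
  (forall i j k, dev (ricA C) (ricB C) (ricD C) 1 C i j k = 0) -> ricdet C = - ricD C.
Proof.
move=> s0 E; have F i j k : frame_symbol 1 C i j k =
    (if i == 0 then ricB C else ricD C) / ricdet C * Jmat (ricA C) (ricB C) (ricD C) k j.
  by have /eqP := E i j k; rewrite /dev subr_eq0 mul1r => /eqP.
have G c j : curv 1 C c j = - (ricD C / ricdet C) * Jmat (ricA C) (ricB C) (ricD C) c j.
  by rewrite curv_frame /curv !sum_ord2 !F /=; ring.
have hA : ricA C = - (ricD C / ricdet C) * ricA C by rewrite {1}/ricA /sA G /Jmat /=; ring.
have hB : ricB C = - (ricD C / ricdet C) * ricB C by rewrite {1}/ricB /sB !G /Jmat /=; field.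
have hD : ricD C = - (ricD C / ricdet C) * ricD C by rewrite {1}/ricD /sD G /Jmat /=; ring.
have h2 : ricdet C * (1 + ricD C / ricdet C) = 0.
  have : (1 + ricD C / ricdet C) * (ricA C * ricD C - ricB C ^+ 2) = 0.
    have zA : (1 + ricD C / ricdet C) * ricA C = 0 by rewrite mulrDl mul1r [X in X + _]hA; ring.
    have zB : (1 + ricD C / ricdet C) * ricB C = 0 by rewrite mulrDl mul1r [X in X + _]hB; ring.
    transitivity ((1 + ricD C / ricdet C) * ricA C * ricD C -
      (1 + ricD C / ricdet C) * ricB C * ricB C).
      by ring.
    by rewrite zA zB; ring.
  by rewrite mulrC.
move: h2; rewrite mulrDr mulr1 mulrCA divff // mulr1 => /eqP.
by rewrite addr_eq0 => /eqP.
Qed.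

End Algebra.

(** * The overdetermined system satisfied by an intertwining map *)

Section FormDerivatives.
Variable R : realType.
Local Notation pt := 'rV[R]_2.

Lemma hasd_qform (P' P : WB2 R) (M : pt -> 'I_2 -> 'I_2 -> R) x (n : 'I_2 -> 'I_2 -> 'I_2 -> R)
  i c j : (forall c j, hasd (fun y => M y c j) x (fun l => n l c j)) ->
  hasd (fun y => qform P' P (M y) i c j) x (fun l => qform_lin P' P (M x) (n l) i c j).
Proof.
move=> h; apply: hasdB.
  by apply: hasd_sum => k; apply: hasdZ.
apply: hasd_sum => a; apply: hasd_sum => b; apply: hasdZ.
exact: hasdM.
Qed.

Lemma hasd_sbil (A B D : R) (M : pt -> 'I_2 -> 'I_2 -> R) x (n : 'I_2 -> 'I_2 -> 'I_2 -> R)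
  j k : (forall c j, hasd (fun y => M y c j) x (fun l => n l c j)) ->
  hasd (fun y => sbil A B D (M y) (M y) j k) x
    (fun l => sbil A B D (n l) (M x) j k + sbil A B D (M x) (n l) j k).
Proof.
move=> h; apply: hasd_eq.
  by apply: hasdD; [apply: hasdD|];
    [apply/hasdZ/hasdM|apply: hasdZ; apply: hasdD; apply: hasdM|apply/hasdZ/hasdM]; exact: h.
by move=> l; rewrite /sbil; ring.
Qed.

Lemma hasd_const_near (f : pt -> R) x d k : (\near x, f x = k) -> hasd f x d -> forall i, d i = 0.
Proof. by move=> fk hf; apply: (hasd_near_uniq _ hf (hasd_cst k x)). Qed.

End FormDerivatives.

Lemma qform_frameE (R : realType) (C' C : WB2 R) m e i c j :
  qform (frame_symbol e C') (frame_symbol 1 C) m i c j =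
  \sum_k C' i j k * m c k - \sum_a \sum_b C a b c * (m a i * m b j)
  + e * (i == 0)%:R * m c j - m 0 i * m c j.
Proof.
move: i c j; do 3! (apply: forall_ord2); rewrite /qform /frame_symbol !sum_ord2 /=; ring.
Qed.

Section Intertwining.
Variable R : realType.
Local Notation pt := 'rV[R]_2.
Variables (U : set pt) (w : pt -> R) (e : R) (C' C : WB2 R).
Variables (phi : 'I_2 -> pt -> R) (D : 'I_2 -> 'I_2 -> pt -> R)
  (DD : 'I_2 -> 'I_2 -> 'I_2 -> pt -> R).
Hypothesis openU : open U.
Hypothesis w0 : forall x, U x -> w x != 0.
Hypothesis hw : forall x, U x -> hasd w x (fun i => e * (i == 0)%:R).
Hypothesis phi0 : forall x, U x -> phi 0 x != 0.
Hypothesis hphi : forall x c, U x -> hasd (phi c) x (fun j => D j c x).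
Hypothesis hD : forall x c j, U x -> hasd (D j c) x (fun i => DD i j c x).
Hypothesis det0 : forall x, U x -> mdet (fun c j => D j c x) != 0.
Hypothesis pde : forall x, U x -> forall i j c, DD i j c x =
  (w x)^-1 * (\sum_k C' i j k * D k c x)
  - (phi 0 x)^-1 * (\sum_a \sum_b C a b c * (D i a x * D j b x)).
Hypothesis s0 : ricdet C != 0.

(** The Jacobian in the frames [w d_j] of the source and [x^1 d_c] of the target, in which the
    coefficients of the system are constant. A Type B source has [w = x^1] and [e = 1], a Type A
    source [w = 1] and [e = 0]. *)
Definition frame_jac y c j := w y * D j c y / phi 0 y.
Local Notation M := frame_jac.
Local Notation Q := (qform (frame_symbol e C') (frame_symbol 1 C)).

Lemma nearU x (P : pt -> Prop) : U x -> (forall y, U y -> P y) -> \forall y \near x, P y.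
Proof. by move=> Ux h; have := open_nbhs_nbhs (conj openU Ux); apply: filterS. Qed.

Lemma mdet_frame_jac x : U x -> mdet (M x) != 0.
Proof.
move=> Ux; rewrite (_ : mdet (M x) = (w x / phi 0 x) ^+ 2 * mdet (fun c j => D j c x)).
  by rewrite mulf_neq0 ?det0 // expf_neq0 // mulf_neq0 ?invr_eq0 ?w0 ?phi0.
by rewrite /mdet /frame_jac; field; rewrite phi0.
Qed.

Lemma hasd_frame_jac x c j : U x ->
  hasd (fun y => M y c j) x (fun i => (w x)^-1 * Q (M x) i c j).
Proof.
move=> Ux; have p0 := phi0 Ux; have wx := w0 Ux.
apply: hasd_eq (hasdM (hasdM (hw Ux) (hD c j Ux)) (hasdV p0 (hphi 0 Ux))) _ => i.
rewrite (pde Ux) qform_frameE !sum_ord2 /frame_jac.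
by field; rewrite p0.
Qed.

Lemma tors_frame_jac x c : U x -> tors e C' C (M x) c = 0.
Proof.
move=> Ux; have E : DD 1 0 c x = DD 0 1 c x.
  apply: (@young _ (phi c) (fun i => D i c) x (fun l => DD l 0 c x) (fun l => DD l 1 c x)).
  - by apply: nearU => // y Uy; exact: hphi.
  - exact: hD.
  - exact: hD.
have p0 := phi0 Ux; have wx := w0 Ux.
suff -> : tors e C' C (M x) c = w x ^+ 2 / phi 0 x * (DD 0 1 c x - DD 1 0 c x).
  by rewrite E subrr mulr0.
by rewrite !(pde Ux) /tors !qform_frameE !sum_ord2 /frame_jac /=; field; rewrite p0.
Qed.

Lemma qform_linZ P' P m n k i c j :
  qform_lin P' P m (fun c j => k * n c j) i c j = k * qform_lin P' P m n i c j :> R.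
Proof. by rewrite /qform_lin !sum_ord2; ring. Qed.

Lemma ricci_frame_jac x : U x ->
  [/\ sA (curv e C') = sbil (ricA C) (ricB C) (ricD C) (M x) (M x) 0 0,
      sB (curv e C') = sbil (ricA C) (ricB C) (ricD C) (M x) (M x) 0 1 &
      sD (curv e C') = sbil (ricA C) (ricB C) (ricD C) (M x) (M x) 1 1].
Proof.
move=> Ux; apply: (ricci_natural (mdet_frame_jac Ux)) => c j.
have wx := w0 Ux.
pose g i y := (w y)^-1 * Q (M y) i c j.
pose dg i l := - (e * (l == 0)%:R) / w x ^+ 2 * Q (M x) i c j +
  (w x)^-1 * ((w x)^-1 * qform_lin (frame_symbol e C') (frame_symbol 1 C) (M x) (Q (M x) l) i c j).
have hg i : hasd (g i) x (dg i).
  apply: hasd_eq (hasdM (hasdV wx (hw Ux)) (hasd_qform _ _ i c j _)) _.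
    by move=> c' j'; exact: (hasd_frame_jac c' j' Ux).
  by move=> l; rewrite qform_linZ.
have := @young _ (fun y => M y c j) g x _ _ _ (hg 0) (hg 1).
move=> /(_ (nearU Ux (fun y Uy => hasd_frame_jac c j Uy))).
rewrite /dg /= => /eqP; rewrite -subr_eq0 => /eqP E.
have K := qform_commutator e C' C (M x) c j.
have T a : tors e C' C (M x) a = 0 by exact: tors_frame_jac.
have Z : \sum_a \sum_b frame_symbol 1 C a b c * (tors e C' C (M x) a * M x b j) = 0.
  by rewrite big1 // => a _; rewrite big1 // => b _; rewrite T mul0r mulr0.
rewrite Z subr0 in K.
apply/eqP; rewrite -subr_eq0 -K; apply/eqP.
set q0 := qform_lin _ _ _ _ 1 _ _ in E *; set q1 := qform_lin _ _ _ _ 0 _ _ in E *.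
apply: (mulfI (expf_neq0 2 (invr_neq0 wx))); rewrite mulr0.
rewrite -[RHS]oppr0 -E; by field.
Qed.

(** By [ricci_frame_jac] the pulled-back form is the constant form of the source; its derivatives
    vanish, so [Q_l(M)] is skew relative to [M]. *)
Lemma qform_skew x l : U x -> exists t, forall c j,
  Q (M x) l c j = t * Jmul (ricA C) (ricB C) (ricD C) (M x) c j.
Proof.
move=> Ux; apply: skew_multiple => //; first exact: mdet_frame_jac.
have wx := w0 Ux.
have h j k s' : (forall y, U y -> s' = sbil (ricA C) (ricB C) (ricD C) (M y) (M y) j k) ->
   sbil (ricA C) (ricB C) (ricD C) (Q (M x) l) (M x) j k +
   sbil (ricA C) (ricB C) (ricD C) (M x) (Q (M x) l) j k = 0.
  move=> hs; have hn : \near x, sbil (ricA C) (ricB C) (ricD C) (M x) (M x) j k = s'.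
    by apply: nearU => // y Uy; rewrite -hs.
  have E := hasd_const_near hn (hasd_sbil (ricA C) (ricB C) (ricD C) j k
    (fun c j => hasd_frame_jac c j Ux)) l.
  apply: (mulfI (invr_neq0 wx)); rewrite mulr0 -[RHS]E.
  by rewrite /sbil; ring.
apply: forall_ord2; apply: forall_ord2.
- by apply: (h _ _ (sA (curv e C'))) => y /ricci_frame_jac[].
- by apply: (h _ _ (sB (curv e C'))) => y /ricci_frame_jac[].
- rewrite -[RHS](h 0 1 (sB (curv e C'))); first by rewrite /sbil; ring.
  by move=> y /ricci_frame_jac[].
- by apply: (h _ _ (sD (curv e C'))) => y /ricci_frame_jac[].
Qed.

Local Notation d := (dev (ricA C) (ricB C) (ricD C) 1 C).
Local Notation d' := (dev (sA (curv e C')) (sB (curv e C')) (sD (curv e C')) e C').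

Lemma dev_frame_jac x i j c : U x ->
  \sum_k M x c k * d' i j k = \sum_a \sum_b d a b c * (M x a i * M x b j).
Proof.
move=> Ux; have [-> -> ->] := ricci_frame_jac Ux.
have /choice [l hl] : forall l, exists t, forall c j,
    Q (M x) l c j = t * Jmul (ricA C) (ricB C) (ricD C) (M x) c j.
  by move=> l; exact: qform_skew.
apply: (dev_natural (l := l)) => //; first exact: mdet_frame_jac.
by move=> c'; exact: tors_frame_jac.
Qed.

(** The argument is pointwise: if [Q_l(M)] is a nonzero multiple of [J M] at one point,
    differentiating [dev_frame_jac] there makes [J] annihilate the deviation. *)
Lemma qform_frame_jac0 x l : U x -> ~ (forall i j k, d i j k = 0) ->
  forall c j, Q (M x) l c j = 0.
Proof.
move=> Ux dn; have [t ht] := qform_skew l Ux.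
have [t0|tn c j] := eqVneq t 0; first by move=> c j; rewrite ht t0 mul0r.
case: dn; apply: (@dev_flat _ _ _ _ _ (M x) t s0 (mdet_frame_jac Ux)) => // i j' c'.
pose n l c j := (w x)^-1 * Q (M x) l c j.
have h1 : hasd (fun y => \sum_k M y c' k * d' i j' k) x (fun l => \sum_k n l c' k * d' i j' k).
  apply: hasd_sum => k.
  apply: hasd_eq (hasdM (hasd_frame_jac c' k Ux) (hasd_cst (d' i j' k) x)) _ => l'.
  by rewrite mulr0 addr0.
have h2 : hasd (fun y => \sum_a \sum_b d a b c' * (M y a i * M y b j')) x
   (fun l => \sum_a \sum_b d a b c' * (n l a i * M x b j' + M x a i * n l b j')).
  apply: hasd_sum => a; apply: hasd_sum => b; apply: hasdZ.
  exact: (hasdM (hasd_frame_jac a i Ux) (hasd_frame_jac b j' Ux)).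
have := hasd_near_uniq (nearU Ux (fun y Uy => dev_frame_jac i j' c' Uy)) h1 h2 l.
rewrite /n !sum_ord2 !ht => E.
have K0 := dev_frame_jac i j' 0 Ux; have K1 := dev_frame_jac i j' 1 Ux.
rewrite !sum_ord2 in K0 K1.
have wx := w0 Ux; apply: (mulfI (invr_neq0 wx)); rewrite mulr0.
rewrite -K0 -K1.
move/eqP: E; rewrite -subr_eq0 => /eqP E; rewrite -[RHS]E /Jmul !sum_ord2.
move: (Jmat _ _ _) (dev _ _ _ 1 C) (dev _ _ _ e C') => J a b.
by ring.
Qed.

(** When all [Q_l] vanish, [tors = 0] reads [M 0 1 * M c 0 + (e - M 0 0) * M c 1 = 0] for both [c],
    and the columns of [M] are independent. *)
Lemma frame_jac_triangular x : U x -> ~ (forall i j k, d i j k = 0) ->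
  M x 0 0 = e /\ M x 0 1 = 0.
Proof.
move=> Ux dn; have Q0 l := qform_frame_jac0 l Ux dn.
have := columns_free (mdet_frame_jac Ux) (x := M x 0 1) (y := e - M x 0 0).
case=> [c|h1 h2]; last by split=> //; apply/eqP; rewrite eq_sym -subr_eq0; exact/eqP.
have := tors_frame_jac c Ux; rewrite /tors !Q0 => E; lra.
Qed.

End Intertwining.

(** * The linearised system of affine Killing fields *)

Section KillingCore.
Variable R : realType.
Local Notation pt := 'rV[R]_2.
Variables (U : set pt) (C : WB2 R).
Variables (xi : 'I_2 -> pt -> R) (D : 'I_2 -> 'I_2 -> pt -> R)
  (DD : 'I_2 -> 'I_2 -> 'I_2 -> pt -> R).
Hypothesis openU : open U.
Hypothesis x0 : forall x, U x -> x 0 0 != 0.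
Hypothesis hxi : forall x c, U x -> hasd (xi c) x (fun j => D j c x).
Hypothesis hD : forall x c j, U x -> hasd (D j c) x (fun i => DD i j c x).
Hypothesis pde : forall x, U x -> forall i j c, DD i j c x =
  xi 0 x / x 0 0 ^+ 2 * C i j c + (x 0 0)^-1 *
  (\sum_k C i j k * D k c x - \sum_k C k j c * D i k x - \sum_k C i k c * D j k x).
Hypothesis s0 : ricdet C != 0.

(** The derivative at [t = 0] of [frame_jac] for the map [x + t xi]. *)
Definition frame_der y c j := D j c y - xi 0 y / y 0 0 * (c == j)%:R.
Local Notation N := frame_der.
Local Notation L := (lin_act (frame_symbol 1 C)).

Lemma lin_act_frameE n i c j : L n i c j =
  lin_act C n i c j - n 0 i * (c == j)%:R.
Proof.
by move: i c j; do 3! (apply: forall_ord2); rewrite /lin_act /frame_symbol !sum_ord2 /=; ring.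
Qed.

Lemma hasd_frame_der x c j : U x ->
  hasd (fun y => N y c j) x (fun i => (x 0 0)^-1 * L (N x) i c j).
Proof.
move=> Ux; have p0 := x0 Ux.
apply: hasd_eq (hasdB (hD c j Ux) (hasdM (hasdM (hxi 0 Ux) (hasdV p0 (hasd_coord 0 x)))
  (hasd_cst (c == j)%:R x))) _ => i.
rewrite (pde Ux) lin_act_frameE /lin_act !sum_ord2 /frame_der.
by move: i c j; do 3! (apply: forall_ord2); rewrite /=; field; rewrite p0.
Qed.

Lemma tors_frame_der x c : U x ->
  L (N x) 0 c 1 - L (N x) 1 c 0 = (if c == 1 then - N x 0 0 else N x 0 1).
Proof.
move=> Ux; have E : DD 1 0 c x = DD 0 1 c x.
  apply: (@young _ (xi c) (fun i => D i c) x (fun l => DD l 0 c x) (fun l => DD l 1 c x)).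
  - by apply: (nearU openU Ux) => y Uy; exact: hxi.
  - exact: hD.
  - exact: hD.
have p0 := x0 Ux.
transitivity (x 0 0 * (DD 0 1 c x - DD 1 0 c x) + (if c == 1 then - N x 0 0 else N x 0 1)).
  rewrite !(pde Ux) !lin_act_frameE /lin_act !sum_ord2 /frame_der /=.
  by move: c E; apply: forall_ord2 => _ /=; field; rewrite p0.
by rewrite E subrr mulr0 add0r.
Qed.

Lemma lin_actZ P n k i c j : lin_act P (fun c j => k * n c j) i c j = k * lin_act P n i c j :> R.
Proof. by rewrite /lin_act !sum_ord2; ring. Qed.

Lemma hasd_lin_act (P : WB2 R) x (n : 'I_2 -> 'I_2 -> 'I_2 -> R) i c j
    (F : pt -> 'I_2 -> 'I_2 -> R) :
  (forall c j, hasd (fun y => F y c j) x (fun l => n l c j)) ->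
  hasd (fun y => lin_act P (F y) i c j) x (fun l => lin_act P (n l) i c j).
Proof. by move=> h; apply: hasdB; [apply: hasdB|]; apply: hasd_sum => k; apply: hasdZ. Qed.

Lemma ricci_frame_der x : U x ->
  forall j k, sbil (ricA C) (ricB C) (ricD C) (N x) (@idm R) j k +
    sbil (ricA C) (ricB C) (ricD C) (@idm R) (N x) j k = 0.
Proof.
move=> Ux; apply: ricci_skew => c j.
have p0 := x0 Ux.
pose g i (y : pt) := (y 0 0)^-1 * L (N y) i c j.
pose dg i l := - (l == 0)%:R / x 0 0 ^+ 2 * L (N x) i c j +
  (x 0 0)^-1 * ((x 0 0)^-1 * lin_act (frame_symbol 1 C) (L (N x) l) i c j).
have hg i : hasd (g i) x (dg i).
  apply: hasd_eq (hasdM (hasdV p0 (hasd_coord 0 x)) (hasd_lin_act (F := N) _ i c j _)) _.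
    by move=> c' j'; exact: (hasd_frame_der c' j' Ux).
  by move=> l; rewrite lin_actZ.
have := @young _ (fun y => N y c j) g x _ _ _ (hg 0) (hg 1).
move=> /(_ (nearU openU Ux (fun y Uy => hasd_frame_der c j Uy))).
rewrite /dg /= => /eqP; rewrite -subr_eq0 => /eqP E.
have K := lin_act_commutator C (N x) c j.
have Z : \sum_a frame_symbol 1 C a j c * (L (N x) 0 a 1 - L (N x) 1 a 0
     - (if a == 1 then - N x 0 0 else N x 0 1)) = 0.
  by rewrite big1 // => a _; rewrite tors_frame_der // subrr mulr0.
rewrite Z subr0 in K.
rewrite -K.
set q0 := lin_act _ _ 1 _ _ in E *; set q1 := lin_act _ _ 0 _ _ in E *.
apply: (mulfI (expf_neq0 2 (invr_neq0 p0))); rewrite mulr0.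
by rewrite -[RHS]oppr0 -E; field.
Qed.

Lemma frame_der_eq0 x : U x ->
  ~ (forall i j k, dev (ricA C) (ricB C) (ricD C) 1 C i j k = 0) -> forall c j, N x c j = 0.
Proof.
move=> Ux dn.
have d1 : mdet (@idm R) != 0 by rewrite mdet_idm oner_neq0.
have [t] := skew_multiple s0 d1 (ricci_frame_der Ux).
move=> /= ht; have {}ht c j : N x c j = t * Jmat (ricA C) (ricB C) (ricD C) c j.
  by rewrite ht Jmul_idm.
have [t0|tn c j] := eqVneq t 0; first by move=> c j; rewrite ht t0 mul0r.
have p0 := x0 Ux.
have /choice [l hl] : forall i, exists t, forall c j,
    L (N x) i c j = t * Jmat (ricA C) (ricB C) (ricD C) c j.
  move=> i; have [j' k|t' ht'] := @skew_multiple R (ricA C) (ricB C) (ricD C) (@idm R)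
    (L (N x) i) s0 d1; last by exists t' => c' j'; rewrite ht' Jmul_idm.
  have hh : hasd (fun y => sbil (ricA C) (ricB C) (ricD C) (N y) (@idm R) j' k +
      sbil (ricA C) (ricB C) (ricD C) (@idm R) (N y) j' k) x
    (fun i => (x 0 0)^-1 * (sbil (ricA C) (ricB C) (ricD C) (L (N x) i) (@idm R) j' k +
      sbil (ricA C) (ricB C) (ricD C) (@idm R) (L (N x) i) j' k)).
    have h c' j'' k' := hasdM (hasd_frame_der c' j'' Ux) (hasd_cst k' x).
    have h' c' j'' k' := hasdM (hasd_cst k' x) (hasd_frame_der c' j'' Ux).
    apply: hasd_eq.
      by apply: hasdD; (apply: hasdD; [apply: hasdD|]);
        [apply: hasdZ; exact: h|apply: hasdZ; apply: hasdD; exact: h|apply: hasdZ; exact: h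
        |apply: hasdZ; exact: h'|apply: hasdZ; apply: hasdD; exact: h'|apply: hasdZ; exact: h'].
    by move=> i'; rewrite /sbil; ring.
  apply: (mulfI (invr_neq0 p0)); rewrite mulr0.
  apply: (hasd_const_near (k := 0) _ hh i).
  by apply: (nearU openU Ux) => y Uy; exact: ricci_frame_der.
case: dn; apply: (lin_dev_flat s0 ht hl) => // a; exact: tors_frame_der.
Qed.

(** For [N = 0] the differential of [xi] is [xi 0 / x^1] times the identity; hence this quotient is
    a constant [s], and then [xi 1 - s x^2] is constant too. *)
Lemma killing_integrate P : U P -> (forall x, U x -> forall c j, N x c j = 0) ->
  exists s t, \forall x \near P, xi 0 x = s * x 0 0 /\ xi 1 x = s * x 0 1 + t.
Proof.
move=> UP N0.
have h1 : \forall x \near P, xi 0 x / x 0 0 = xi 0 P / P 0 0.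
  apply: locally_constant; apply: (nearU openU UP) => x Ux; have p0 := x0 Ux.
  apply: hasd_eq (hasdM (hxi 0 Ux) (hasdV p0 (hasd_coord 0 x))) _ => i.
  have := N0 x Ux 0 i; rewrite /frame_der => /eqP; rewrite subr_eq0 => /eqP ->.
  by move: i; apply: forall_ord2 => /=; field.
pose s := xi 0 P / P 0 0.
have h2 : \forall x \near P, xi 1 x - s * x 0 1 = xi 1 P - s * P 0 1.
  apply: locally_constant.
  have := h1 => /near_norm_ex [r r0 hr].
  have [r' r'0 hr'] := near_norm_ex (nearU openU UP (fun y Uy => Uy)).
  have m0 : 0 < Num.min r r' by rewrite lt_min r0.
  apply: (near_norm_in m0) => v; rewrite lt_min => /andP[vr vr'].
  have Ux := hr' _ vr'; have e := hr _ vr.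
  apply: hasd_eq (hasdB (hxi 1 Ux) (hasdZ s (hasd_coord 1 (P + v)))) _ => i.
  have := N0 _ Ux 1 i; rewrite /frame_der e -/s => /eqP; rewrite subr_eq0 => /eqP ->.
  by rewrite eq_sym subrr.
exists s, (xi 1 P - s * P 0 1).
have h3 : \forall x \near P, U x by exact: (nearU openU UP (fun y Uy => Uy)).
apply: filterS3 h1 h2 h3 => x e1 e2 Ux; have p0 := x0 Ux.
by rewrite -e2 /s -e1; split; [rewrite divfK|ring].
Qed.

End KillingCore.

Section Integrate.
Variable R : realType.
Local Notation pt := 'rV[R]_2.
Variables (U : set pt) (C' C : WB2 R).
Variables (phi : 'I_2 -> pt -> R) (D : 'I_2 -> 'I_2 -> pt -> R).
Hypothesis openU : open U.
Hypothesis x0 : forall x, U x -> x 0 0 != 0.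
Hypothesis phi0 : forall x, U x -> phi 0 x != 0.
Hypothesis hphi : forall x c, U x -> hasd (phi c) x (fun j => D j c x).

(** The row [(1, 0)] of [M] makes [phi 0 / x^1] constant; as [M] is constant, so are the derivatives
    of [phi 1], which is therefore affine. *)
Lemma frame_jac_integrate P : U P ->
  (forall x c j, U x -> hasd (fun y => frame_jac (fun y => y 0 0) phi D y c j) x (fun=> 0)) ->
  (forall x, U x -> frame_jac (fun y => y 0 0) phi D x 0 0 = 1 /\
     frame_jac (fun y => y 0 0) phi D x 0 1 = 0) ->
  exists d, \forall x \near P, phi 0 x = phi 0 P / P 0 0 * x 0 0 /\
    phi 1 x = D 0 1 P * x 0 0 + D 1 1 P * x 0 1 + d.
Proof.
move=> UP hM tri; set M := frame_jac _ _ _ in hM tri.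
have DE x c j : U x -> D j c x = phi 0 x / x 0 0 * M x c j.
  by move=> Ux; rewrite /M /frame_jac; field; rewrite x0 ?phi0.
have h1 : \forall x \near P, phi 0 x / x 0 0 = phi 0 P / P 0 0.
  apply: locally_constant; apply: (nearU openU UP) => x Ux; have p0 := x0 Ux.
  apply: hasd_eq (hasdM (hphi 0 Ux) (hasdV p0 (hasd_coord 0 x))) _.
  have [t0 t1] := tri x Ux.
  by apply: forall_ord2; rewrite DE // ?t0 ?t1 /=; field.
have h2 c j : \forall x \near P, M x c j = M P c j.
  by apply: locally_constant; apply: (nearU openU UP) => x Ux; exact: hM.
have h3 : \forall x \near P, U x by exact: (nearU openU UP (fun y Uy => Uy)).
have hDc j : \forall x \near P, D j 1 x = D j 1 P.
  by apply: filterS3 h1 (h2 1 j) h3 => x e1 e2 Ux; rewrite !DE // e1 e2.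
have h4 : \forall x \near P, phi 1 x - D 0 1 P * x 0 0 - D 1 1 P * x 0 1 =
    phi 1 P - D 0 1 P * P 0 0 - D 1 1 P * P 0 1.
  apply: locally_constant.
  apply: filterS3 (hDc 0) (hDc 1) h3 => x e0 e1 Ux.
  apply: hasd_eq (hasdB (hasdB (hphi 1 Ux) (hasdZ (D 0 1 P) (hasd_coord 0 x)))
    (hasdZ (D 1 1 P) (hasd_coord 1 x))) _.
  by apply: forall_ord2; rewrite ?e0 ?e1 /=; ring.
exists (phi 1 P - D 0 1 P * P 0 0 - D 1 1 P * P 0 1).
apply: filterS3 h1 h3 h4 => x e1 Ux e2; have p0 := x0 Ux.
by rewrite -e2 -e1; split; [rewrite divfK|ring].
Qed.

End Integrate.

(** * Type B connections *)

Section Differentials.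
Variable R : realType.
Local Notation pt := 'rV[R]_2.
Local Notation dir := (@dir R).

(* Instances of [mxE], which would unfold the derivatives it meets. *)
Lemma addvE (u v : pt) c : (u + v) 0 c = u 0 c + v 0 c.
Proof. by rewrite mxE. Qed.

Lemma oppvE (u : pt) c : (- u) 0 c = - u 0 c.
Proof. by rewrite mxE. Qed.

Lemma scalevE a (u : pt) c : (a *: u) 0 c = a * u 0 c.
Proof. by rewrite mxE. Qed.

Lemma rowvE (f : 'I_2 -> R) c : (\row_k f k) 0 c = f c.
Proof. by rewrite mxE. Qed.

Lemma dirE i c : dir i 0 c = (c == i)%:R.
Proof. by rewrite mxE eqxx. Qed.

Definition vecE := (addvE, oppvE, scalevE, rowvE, dirE).

Lemma covdE (G : christoffel R) (X Y : pt -> pt) x c : covd G X Y x 0 c =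
  ('D_(X x) Y x) 0 c + \sum_i \sum_j X x 0 i * Y x 0 j * G i j c x.
Proof. by rewrite /covd addvE rowvE. Qed.

Lemma deriveD_dir (F : pt -> pt) x v : differentiable F x ->
  'D_v F x = v 0 0 *: 'D_(dir 0) F x + v 0 1 *: 'D_(dir 1) F x.
Proof. by move=> dF; rewrite !deriveE // {1}[v]pt_decomp linearD !linearZ. Qed.

Lemma derive_comp (F G : pt -> pt) x v : differentiable G x -> differentiable F (G x) ->
  'D_v (F \o G) x = 'D_('D_v G x) F (G x).
Proof.
move=> dG dF; have h := diff_comp dG dF.
rewrite (deriveE v (differentiable_comp dG dF)) (deriveE v dG) (deriveE _ dF).
exact: (congr1 (fun f => f v) h).
Qed.

Lemma derive_inverse (U : set pt) (F G : pt -> pt) x v : open U -> U x ->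
  (forall y, U y -> F (G y) = y) -> differentiable G x -> differentiable F (G x) ->
  'D_('D_v G x) F (G x) = v.
Proof.
move=> oU Ux FG dG dF; rewrite -derive_comp // -[RHS](derive_id x v).
apply: near_eq_derive; exact: (nearU oU Ux FG).
Qed.

Lemma smooth_differentiable (U : set pt) (F : pt -> pt) x :
  smooth_on U F -> U x -> differentiable F x.
Proof. by move=> h Ux; exact: (h [::] x Ux). Qed.

Lemma smooth_differentiable1 (U : set pt) (F : pt -> pt) x j :
  smooth_on U F -> U x -> differentiable (fun y => 'D_(dir j) F y) x.
Proof. by move=> h Ux; exact: (h [:: j] x Ux). Qed.

Definition pd (F : pt -> pt) j c x := ('D_(dir j) F x) 0 c.
Definition pdd (F : pt -> pt) i j c x := ('D_(dir i) (fun y => 'D_(dir j) F y) x) 0 c.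

Lemma pdE (F : pt -> pt) x v c : differentiable F x ->
  ('D_v F x) 0 c = v 0 0 * pd F 0 c x + v 0 1 * pd F 1 c x.
Proof.
move=> dF; rewrite (deriveD_dir v dF) /pd.
by move: ('D_(dir 0) F x) ('D_(dir 1) F x) => a b; rewrite !vecE.
Qed.

Lemma mdet_pd (U V : set pt) Phi Psi x : diffeo U V Phi Psi -> U x ->
  mdet (fun c j => pd Phi j c x) != 0.
Proof.
move=> [[oU oV] UV VU sPhi sPsi] Ux; have [Vx ePsi] := UV x Ux.
have dPhi := smooth_differentiable sPhi Ux.
have dPsi := smooth_differentiable sPsi Vx.
have E j : pd Phi j 0 x *: 'D_(dir 0) Psi (Phi x) + pd Phi j 1 x *: 'D_(dir 1) Psi (Phi x)
    = dir j.
  rewrite -(deriveD_dir _ dPsi).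
  by apply: (derive_inverse (U := U)) => // y /UV [].
have EE j c : pd Phi j 0 x * pd Psi 0 c (Phi x) + pd Phi j 1 x * pd Psi 1 c (Phi x)
    = (c == j)%:R.
  rewrite -(dirE j c) -E; move: (pd Phi j 0 x) (pd Phi j 1 x) => a b.
  by rewrite /pd; move: ('D_(dir 0) Psi _) ('D_(dir 1) Psi _) => u v; rewrite !vecE.
have E00 := EE 0 0; have E01 := EE 0 1; have E10 := EE 1 0; have E11 := EE 1 1.
move: E00 E01 E10 E11 {EE E}; rewrite /mdet.
move: (pd Phi 0 0 x) (pd Phi 0 1 x) (pd Phi 1 0 x) (pd Phi 1 1 x) => p00 p01 p10 p11.
move: (pd Psi 0 0 _) (pd Psi 0 1 _) (pd Psi 1 0 _) (pd Psi 1 1 _) => q00 q01 q10 q11 /=.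
move=> E00 E01 E10 E11.
apply/eqP => d0.
have : (p00 * p11 - p10 * p01) * (q00 * q11 - q10 * q01) = 1.
  transitivity ((p00 * q00 + p01 * q10) * (p10 * q01 + p11 * q11)
   - (p00 * q01 + p01 * q11) * (p10 * q00 + p11 * q10)); first by ring.
  by rewrite E00 E01 E10 E11; ring.
have -> : p00 * p11 - p10 * p01 = 0 by rewrite -[RHS]d0.
by rewrite mul0r => /eqP; rewrite eq_sym oner_eq0.
Qed.

(** The transformation law of Christoffel symbols, solved for the second derivatives: applying
    [D Phi] to the definition of the pullback undoes the outer [D Psi]. *)
Lemma pullback_pde (U V : set pt) Phi Psi (G : christoffel R) (g : 'I_2 -> R) x i j :
  diffeo U V Phi Psi -> U x -> (forall k, pullback Phi Psi G i j k x = g k) ->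
  forall c, pdd Phi i j c x = \sum_k g k * pd Phi k c x
    - \sum_a \sum_b G a b c (Phi x) * (pd Phi i a x * pd Phi j b x).
Proof.
move=> [[oU oV] UV VU sPhi sPsi] Ux hg; have [Vx ePsi] := UV x Ux.
have dPhi := smooth_differentiable sPhi Ux.
have dPsi := smooth_differentiable sPsi Vx.
have dF := smooth_differentiable1 j sPhi Ux.
pose W := covd G (Defs.pushforward Phi Psi (@coord_field R i))
   (Defs.pushforward Phi Psi (@coord_field R j)) (Phi x).
have hW : forall c, W 0 c = pdd Phi i j c x +
    \sum_a \sum_b G a b c (Phi x) * (pd Phi i a x * pd Phi j b x).
  move=> c; pose X k := Defs.pushforward Phi Psi (@coord_field R k).
  have X0 k : X k (Phi x) = 'D_(dir k) Phi x by rewrite /X /Defs.pushforward ePsi.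
  have X1 : 'D_(X i (Phi x)) (X j) (Phi x) = 'D_(dir i) (fun y => 'D_(dir j) Phi y) x.
    have -> : X j = (fun z => 'D_(dir j) Phi z) \o Psi by [].
    have dF' : differentiable (fun z => 'D_(dir j) Phi z) (Psi (Phi x)) by rewrite ePsi.
    rewrite (derive_comp _ dPsi dF') X0 ePsi; apply: (congr1 (fun v => 'D_v _ x)).
    exact: (derive_inverse _ oU Ux (fun y Uy => (UV y Uy).2) dPhi dPsi).
  transitivity (('D_(X i (Phi x)) (X j) (Phi x)) 0 c +
      \sum_a \sum_b (X i (Phi x)) 0 a * (X j (Phi x)) 0 b * G a b c (Phi x)).
    exact: covdE.
  rewrite X1 !X0 /pdd /pd; apply: (congr1 (fun t => _ + t)).
  by apply: eq_bigr => a _; apply: eq_bigr => b _; rewrite mulrC.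
have e1 : 'D_W Psi (Phi x) = \row_k g k.
  by apply/rowP => k; rewrite rowvE -hg.
have e2 : 'D_('D_W Psi (Phi x)) Phi x = W.
  have := @derive_inverse V Phi Psi (Phi x) W oV Vx (fun y Vy => (VU y Vy).2) dPsi.
  by rewrite ePsi; apply.
move=> c; rewrite sum_ord2 -[g 0]rowvE -[g 1](rowvE g) -pdE //.
rewrite -(addrK (\sum_a \sum_b G a b c (Phi x) * (pd Phi i a x * pd Phi j b x))
  (pdd Phi i j c x)) -hW; apply: (congr1 (fun t => t - _)).
by rewrite -[in LHS]e2 e1.
Qed.

Implicit Types C : WB2 R.

Lemma derive_row (F : 'I_2 -> pt -> R) x (d : 'I_2 -> 'I_2 -> R) v :
  (forall c, hasd (F c) x (d c)) ->
  'D_v (fun y => \row_c F c y) x = \row_c (v 0 0 * d c 0 + v 0 1 * d c 1).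
Proof.
move=> h; rewrite derive_mx; last first.
  apply/derivable_mxP => i j; apply: diff_derivable.
  rewrite (_ : (fun y => _) = F j); first by have [] := h j.
  by apply/funext => y; rewrite mxE.
apply/matrixP => i j; rewrite !mxE.
rewrite (_ : (fun y => _) = F j); first exact: hasd_derive (h j).
by apply/funext => y; rewrite mxE.
Qed.

Lemma covd_coord (G : christoffel R) i j x :
  covd G (@coord_field R i) (@coord_field R j) x = \row_k G i j k x.
Proof.
rewrite /covd /coord_field derive_cst add0r; apply/rowP => k; rewrite !vecE.
rewrite (bigD1 i) //= [X in _ + X]big1 => [|a ai]; last first.
  by rewrite big1 // => b _; rewrite !mxE (negbTE ai) andbF !mul0r.
rewrite addr0 (bigD1 j) //= big1 => [|b bj].
  by rewrite !mxE !eqxx !mul1r addr0.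
by rewrite !mxE (negbTE bj) andbF mulr0 mul0r.
Qed.

Lemma hasd_nablaB C i j k (x : pt) : x 0 0 != 0 ->
  hasd (nablaB C i j k) x (fun l => - (l == 0)%:R / x 0 0 ^+ 2 * C i j k).
Proof.
move=> x0; apply: hasd_eq (hasdM (hasdV x0 (hasd_coord 0 x)) (hasd_cst (C i j k) x)) _ => l.
by rewrite mulr0 addr0.
Qed.

Lemma curvature_nablaB C (x : pt) j : x 0 0 != 0 ->
  curvature (nablaB C) (@coord_field R 0) (@coord_field R 1) (@coord_field R j) x
  = \row_c (curv 1 C c j / x 0 0 ^+ 2).
Proof.
move=> x0; rewrite /curvature.
have br : lie_bracket (@coord_field R 0) (@coord_field R 1) x = 0.
  by rewrite /lie_bracket /coord_field !derive_cst subrr.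
have -> : covd (nablaB C) (lie_bracket (@coord_field R 0) (@coord_field R 1))
    (@coord_field R j) x = 0.
  rewrite /covd br /coord_field derive_cst add0r; apply/rowP => k; rewrite !mxE.
  by rewrite big1 // => a _; rewrite big1 // => b _; rewrite mxE !mul0r.
rewrite subr0.
have cc i : covd (nablaB C) (@coord_field R i) (@coord_field R j) =
   fun y => \row_k nablaB C i j k y by apply/funext => y; rewrite covd_coord.
rewrite !cc /covd.
rewrite !(derive_row _ (fun c => hasd_nablaB C _ _ c x0)).
apply/rowP => c; rewrite !mxE !sum_ord2 !mxE /curv sum_ord2 /nablaB /=.
by field.
Qed.

Lemma curvatureN (G : christoffel R) (X Y Z : pt -> pt) x :
  curvature G (@coord_field R 1) (@coord_field R 0) Z x =
  - curvature G (@coord_field R 0) (@coord_field R 1) Z x.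
Proof.
rewrite /curvature.
have br i j : lie_bracket (@coord_field R i) (@coord_field R j) = fun=> 0.
  by apply/funext => y; rewrite /lie_bracket /coord_field !derive_cst subrr.
have z : covd G (fun=> 0) Z x = 0.
  rewrite /covd derive0 add0r; apply/rowP => k; rewrite !mxE.
  by rewrite big1 // => a _; rewrite big1 // => b _; rewrite mxE !mul0r.
by rewrite !br z !subr0 opprB.
Qed.

Lemma curvature_diag (G : christoffel R) i Z x :
  curvature G (@coord_field R i) (@coord_field R i) Z x = 0.
Proof.
rewrite /curvature.
have -> : lie_bracket (@coord_field R i) (@coord_field R i) = fun=> 0.
  by apply/funext => y; rewrite /lie_bracket subrr.
rewrite subrr sub0r; apply/eqP; rewrite oppr_eq0 /covd derive0 add0r; apply/eqP.
apply/rowP => k; rewrite !mxE.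
by rewrite big1 // => a _; rewrite big1 // => b _; rewrite mxE !mul0r.
Qed.

Definition smat (A B D : R) : 'M[R]_2 :=
  \matrix_(i, j) (if i == 0 then if j == 0 then A else B else if j == 0 then B else D).

Definition ricmat C := smat (ricA C) (ricB C) (ricD C).

Lemma sym_ricci_nablaB C (x : pt) : x 0 0 != 0 ->
  sym_ricci (nablaB C) x = (x 0 0) ^- 2 *: ricmat C.
Proof.
move=> x0; have r j k : ricci (nablaB C) x j k =
    (if j == 0 then - curv 1 C 1 k else curv 1 C 0 k) / x 0 0 ^+ 2.
  rewrite mxE sum_ord2; move: j; apply: forall_ord2.
    rewrite curvature_diag (curvatureN _ (fun=> 0) (fun=> 0)) curvature_nablaB // !mxE.
    by rewrite add0r mulNr.
  by rewrite curvature_diag curvature_nablaB // !mxE addr0.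
apply/matrixP; do 2! (apply: forall_ord2); rewrite /sym_ricci [LHS]mxE [X in _ * X]mxE
  [X in _ + X]mxE !r /ricmat !mxE /= /ricA /ricB /ricD /sA /sB /sD; by field.
Qed.

End Differentials.

Section Signature.
Variable R : realType.
Implicit Types C : WB2 R.

Lemma card_ord2 (P : pred 'I_2) : #|[set i | P i]%SET| = (P 0%R + P 1%R)%N.
Proof.
rewrite -sum1_card (eq_bigl P) => [|i]; last by rewrite inE.
by rewrite big_mkcond (sum_ord2 (fun i => (if P i then 1 else 0)%N)); do 2 case: (P _).
Qed.

Lemma has_signature_det (S : 'M[R]_2) p q : (p + q = 2)%N -> has_signature S p q ->
  \det S != 0.
Proof.
move=> pq [B [d [uB E hp hq]]].
have dd : d 0 0 != 0 /\ d 0 1 != 0.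
  move: pq; rewrite -hp -hq (card_ord2 (fun i => 0 < d 0 i)) (card_ord2 (fun i => d 0 i < 0)).
  by case: (ltgtP (d 0 0) 0) => //; case: (ltgtP (d 0 1) 0).
have : \det (B *m S *m B^T) != 0.
  rewrite E det_diag big_ord_recl big_ord_recl big_ord0 mulr1.
  rewrite (_ : lift ord0 ord0 = 1); last exact: val_inj.
  by rewrite mulf_neq0 //; case: dd.
by rewrite !det_mulmx; apply: contra => /eqP ->; rewrite mulr0 mul0r.
Qed.

Lemma det_mx2 (S : 'M[R]_2) : \det S = S 0 0 * S 1 1 - S 0 1 * S 1 0.
Proof.
rewrite (expand_det_row S 0) sum_ord2 /cofactor !det_mx11 !mxE /=.
rewrite expr0 expr1 mul1r mulN1r mulrN; congr (_ * S _ _ - _ * S _ _); exact: val_inj.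
Qed.

Lemma WB_ricdet C p q : (p + q = 2)%N -> WB p q C -> ricdet C != 0.
Proof.
move=> pq /(_ (row2 1 0)); rewrite /half_plane /= /row2 rowvE /= ltr01 => /(_ isT).
rewrite sym_ricci_nablaB ?rowvE ?oner_neq0 //= expr1n invr1 scale1r.
by move=> /(has_signature_det pq); rewrite det_mx2 /ricmat !mxE /= -expr2.
Qed.

End Signature.

(** * Rigidity of diffeomorphisms between Type B connections *)

Section TypeBMaps.
Variable R : realType.
Local Notation pt := 'rV[R]_2.
Local Notation dir := (@dir R).
Implicit Types C : WB2 R.

(** The exceptional case of the rigidity argument; for a nondegenerate Ricci form it implies Type
    C. *)
Definition flat_dev C := forall i j k, dev (ricA C) (ricB C) (ricD C) 1 C i j k = 0.

Lemma hasd_entry U (F : pt -> pt) x c : smooth_on U F -> U x ->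
  hasd (fun y => F y 0 c) x (fun j => pd F j c x).
Proof. by move=> sF Ux; exact: (hasd_comp c (smooth_differentiable sF Ux)). Qed.

Lemma hasd_pd U (F : pt -> pt) x c j : smooth_on U F -> U x ->
  hasd (pd F j c) x (fun i => pdd F i j c x).
Proof. by move=> sF Ux; exact: (hasd_comp c (smooth_differentiable1 j sF Ux)). Qed.

Lemma pde_nablaB (U V : set pt) Phi Psi C (w : pt -> R) (C' : WB2 R) x :
  diffeo U V Phi Psi -> U x ->
  (forall i j k, pullback Phi Psi (nablaB C) i j k x = (w x)^-1 * C' i j k) ->
  forall i j c, pdd Phi i j c x = (w x)^-1 * (\sum_k C' i j k * pd Phi k c x)
  - (Phi x 0 0)^-1 * (\sum_a \sum_b C a b c * (pd Phi i a x * pd Phi j b x)).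
Proof.
move=> dif Ux pb i j c; rewrite (pullback_pde dif Ux (fun k => pb i j k)).
rewrite !sum_ord2 /nablaB.
by move: (pd _) (Phi x 0 0) => p z; ring.
Qed.

Lemma mdet_row0 (m : 'I_2 -> 'I_2 -> R) : m 0 0 = 0 -> m 0 1 = 0 -> mdet m = 0.
Proof. by move=> h0 h1; rewrite /mdet h0 h1 !mul0r subrr. Qed.

Section Rigidity.
Variables (U V : set pt) (Phi Psi : pt -> pt) (C C' : WB2 R).
Hypothesis dif : diffeo U V Phi Psi.
Hypotheses (Uh : U `<=` @half_plane R) (Vh : V `<=` @half_plane R).
Hypothesis pb : forall x, U x -> forall i j k,
  pullback Phi Psi (nablaB C) i j k x = nablaB C' i j k x.
Hypothesis s0 : ricdet C != 0.

Local Notation M := (frame_jac (fun y : pt => y 0 0) (fun c y => Phi y 0 c) (pd Phi)).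

Let oU : open U. Proof. by case: dif => -[]. Qed.
Let x0 x : U x -> x 0 0 != 0.
Proof. by move=> /Uh h; rewrite gt_eqF. Qed.
Let phi0 x : U x -> Phi x 0 0 != 0.
Proof. by case: dif => _ UV _ _ _ /UV [/Vh h _]; rewrite gt_eqF. Qed.
Let sPhi : smooth_on U Phi. Proof. by case: dif. Qed.
Let hw x : U x -> hasd (fun y : pt => y 0 0) x (fun i => 1 * (i == 0)%:R).
Proof. by move=> _; apply: hasd_eq (hasd_coord 0 x) _ => i; rewrite mul1r. Qed.
Let hphi x c : U x -> hasd (fun y => Phi y 0 c) x (fun j => pd Phi j c x).
Proof. exact: hasd_entry. Qed.
Let hD x c j : U x -> hasd (pd Phi j c) x (fun i => pdd Phi i j c x).
Proof. exact: hasd_pd. Qed.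
Let det0 x : U x -> mdet (fun c j => pd Phi j c x) != 0.
Proof. exact: (mdet_pd dif). Qed.
Let pde x : U x -> forall i j c, pdd Phi i j c x =
  (x 0 0)^-1 * (\sum_k C' i j k * pd Phi k c x)
  - (Phi x 0 0)^-1 * (\sum_a \sum_b C a b c * (pd Phi i a x * pd Phi j b x)).
Proof. by move=> Ux; exact: (pde_nablaB (w := fun y : pt => y 0 0) dif Ux (pb Ux)). Qed.

Lemma typeB_mdet x : U x -> mdet (M x) != 0.
Proof. exact: (mdet_frame_jac x0 phi0 det0). Qed.

Lemma typeB_flat x : U x -> flat_dev C -> flat_dev C'.
Proof.
move=> Ux fC; have H := fun i j c => dev_frame_jac oU x0 hw phi0 hphi hD det0 pde s0 i j c Ux.
move=> i j; have [||z0 z1] := @columns_free R (M x) (dev (ricA C') (ricB C') (ricD C') 1 C' i j 0)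
   (dev (ricA C') (ricB C') (ricD C') 1 C' i j 1).
- exact: typeB_mdet.
- move=> c; have := H i j c; rewrite [RHS]big1 => [|a _].
    by rewrite sum_ord2 => <-; rewrite mulrC [X in _ + X]mulrC.
  by rewrite big1 // => b _; rewrite fC mul0r.
by apply: forall_ord2.
Qed.

Lemma typeB_rigid P : U P -> ~ flat_dev C ->
  [/\ M P 0 0 = 1, M P 0 1 = 0,
      (forall i j c, qform (frame_symbol 1 C') (frame_symbol 1 C) (M P) i c j = 0) &
      exists d, \forall x \near P, Phi x = row2 (Phi P 0 0 / P 0 0 * x 0 0)
        (pd Phi 0 1 P * x 0 0 + pd Phi 1 1 P * x 0 1 + d)].
Proof.
move=> UP nf.
have tri x (Ux : U x) := frame_jac_triangular oU x0 hw phi0 hphi hD det0 pde s0 Ux nf.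
have q0 x (Ux : U x) i c j := qform_frame_jac0 oU x0 hw phi0 hphi hD det0 pde s0 i Ux nf c j.
have [t0 t1] := tri P UP; split=> // [i j c|]; first exact: q0.
have [|d hd] := frame_jac_integrate oU x0 phi0 hphi UP _ tri.
  move=> x c j Ux.
  apply: hasd_eq (hasd_frame_jac x0 hw phi0 hphi hD pde c j Ux) _ => i.
  by rewrite q0 // mulr0.
exists d; apply: filterS hd => x [e0 e1].
by apply/rowP; apply: forall_ord2; rewrite /row2 rowvE /= ?e0 ?e1.
Qed.

End Rigidity.

(** A Type A chart is taken as the source, with [w = 1] and [e = 0]; the first row of [M] is then
    zero, although [M] is invertible. *)
Lemma not_typeA C : ricdet C != 0 -> ~ flat_dev C -> ~ typeA C.
Proof.
move=> s0 nf tA; have [|U [V [Phi [Psi [A [UP Uh dif pb]]]]]] := tA (row2 1 0).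
  by rewrite /half_plane /= /row2 rowvE.
have dif' : diffeo V U Psi Phi by case: dif => -[? ?] ? ? ? ?; split.
have [[_ oV] UV VU _ sPsi] := dif; have [VP _] := UV _ UP.
pose w (_ : pt) : R := 1.
have w0 x : V x -> w x != 0 by rewrite oner_neq0.
have hw x : V x -> hasd w x (fun i => 0 * (i == 0)%:R).
  by move=> _; apply: hasd_eq (hasd_cst 1 x) _ => i; rewrite mul0r.
have phi0 x : V x -> Psi x 0 0 != 0 by move=> /VU [/Uh h _]; rewrite gt_eqF.
have hphi x c : V x -> hasd (fun y => Psi y 0 c) x (fun j => pd Psi j c x).
  exact: hasd_entry.
have hD x c j : V x -> hasd (pd Psi j c) x (fun i => pdd Psi i j c x).
  exact: hasd_pd.
have det0 x : V x -> mdet (fun c j => pd Psi j c x) != 0 by exact: (mdet_pd dif').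
have pde x : V x -> forall i j c, pdd Psi i j c x =
  (w x)^-1 * (\sum_k A i j k * pd Psi k c x)
  - (Psi x 0 0)^-1 * (\sum_a \sum_b C a b c * (pd Psi i a x * pd Psi j b x)).
  move=> Vx; apply: (pde_nablaB dif' Vx) => i j k.
  by rewrite pb // /w invr1 mul1r.
have [h0 h1] := frame_jac_triangular oV w0 hw phi0 hphi hD det0 pde s0 VP nf.
have := mdet_frame_jac (phi := fun c y => Psi y 0 c) w0 phi0 det0 VP.
by rewrite (mdet_row0 h0 h1) eqxx.
Qed.

End TypeBMaps.

(** * Affine maps and the group G *)

Section AffineMaps.
Variables (R : realType) (V : normedModType R).
Local Notation pt := 'rV[R]_2.
Local Notation dir := (@dir R).

Definition affmap (u : 'I_2 -> V) (c : V) (x : pt) : V := x 0 0 *: u 0 + x 0 1 *: u 1 + c.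

Lemma differentiable_affmap u c x : differentiable (affmap u c) x.
Proof.
apply: differentiableD; last exact: differentiable_cst.
apply: differentiableD; apply: differentiableZl; exact: differentiable_coord.
Qed.

Lemma derive_affmap u c v x : 'D_v (affmap u c) x = v 0 0 *: u 0 + v 0 1 *: u 1.
Proof.
have dk i : differentiable (fun y : pt => y 0 i : R) x by exact: differentiable_coord.
have Zl i w : differentiable (fun y : pt => y 0 i *: w : V) x.
  exact: differentiableZl.
have DZ i (w : V) : 'D_v (fun y : pt => y 0 i *: w) x = v 0 i *: w.
  rewrite deriveE // diffZl // -deriveE // (hasd_derive v (hasd_coord i x)).
  by move: i; apply: forall_ord2; rewrite /= ?mulr1 ?mulr0 ?addr0 ?add0r.
have D1 : differentiable (fun y : pt => y 0 0 *: u 0 + y 0 1 *: u 1) x.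
  by apply: differentiableD.
rewrite -!DZ -[RHS]addr0 -(derive_cst c x v) -deriveD; first last.
- exact: diff_derivable.
- exact: diff_derivable.
by apply: deriveD; apply: diff_derivable; [exact: D1|exact: differentiable_cst].
Qed.

(** A partial derivative of an affine map is constant, again of the form [affmap], so induction on
    the list of directions closes. *)
Lemma smooth_affmap U u c : smooth_on U (affmap u c).
Proof.
move=> s x _; suff [u' [c' ->]] : exists u' c', iter_partial s (affmap u c) = affmap u' c'.
  exact: differentiable_affmap.
elim: s => [|i s [u' [c' IH]]]; first by exists u, c.
exists (fun=> 0), (u' i); apply/funext => y /=; rewrite IH derive_affmap.
rewrite /affmap !scaler0 !add0r.
by move: i; apply: forall_ord2; rewrite !dirE /= ?scale1r ?scale0r ?addr0 ?add0r.
Qed.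

Lemma smooth_cst U (c : V) : smooth_on U (fun _ : pt => c).
Proof.
rewrite (_ : (fun _ => c) = affmap (fun=> 0) c); first exact: smooth_affmap.
by apply/funext => y; rewrite /affmap !scaler0 !add0r.
Qed.

End AffineMaps.

Section GroupG.
Variable R : realType.
Local Notation pt := 'rV[R]_2.
Local Notation dir := (@dir R).
Implicit Types C : WB2 R.

Lemma row2E (u v : R) j : row2 u v 0 j = if j == 0 then u else v.
Proof. by rewrite /row2 rowvE. Qed.

Lemma open_half_plane : open (@half_plane R).
Proof.
apply: (@open_comp _ _ (fun x : pt => x 0 0) [set r : R | 0 < r]).
  by move=> x _; exact: coord_continuous.
exact: open_gt.
Qed.

Definition gmap (m a b d : R) (x : pt) : pt :=
  row2 (m * x 0 0) (a * x 0 0 + b * x 0 1 + d).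

Lemma gmap_aff m a b d : gmap m a b d =
  affmap (fun i => if i == 0 then row2 m a else row2 0 b) (row2 0 d).
Proof.
apply/funext => x; apply/rowP; apply: forall_ord2;
  by rewrite /gmap /affmap !(addvE, scalevE) !row2E /=; ring.
Qed.

Lemma gmap_inv m a b d x : m != 0 -> b != 0 ->
  gmap m^-1 (- (a / (m * b))) b^-1 (- (d / b)) (gmap m a b d x) = x.
Proof.
move=> m0 b0; apply/rowP; apply: forall_ord2; rewrite /gmap !row2E /=.
  by rewrite mulKf.
by field; rewrite m0 b0.
Qed.

Lemma gmap_inv' m a b d x : m != 0 -> b != 0 ->
  gmap m a b d (gmap m^-1 (- (a / (m * b))) b^-1 (- (d / b)) x) = x.
Proof.
move=> m0 b0; apply/rowP; apply: forall_ord2; rewrite /gmap !row2E /=.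
  by rewrite mulVKf.
by field; rewrite m0 b0.
Qed.

Lemma gmap_diffeo m a b d : 0 < m -> b != 0 ->
  diffeo (@half_plane R) (@half_plane R) (gmap m a b d)
   (gmap m^-1 (- (a / (m * b))) b^-1 (- (d / b))).
Proof.
move=> m0 b0; have m1 : m != 0 by rewrite gt_eqF.
split; first by split; exact: open_half_plane.
- move=> x; rewrite /half_plane /= => x0; rewrite gmap_inv //; split=> //.
  by rewrite /gmap row2E /= mulr_gt0.
- move=> x; rewrite /half_plane /= => x0; rewrite gmap_inv' //; split=> //.
  by rewrite /gmap row2E /= mulr_gt0 // invr_gt0.
- by rewrite gmap_aff; exact: smooth_affmap.
- by rewrite gmap_aff; exact: smooth_affmap.
Qed.

(** An element of G has constant Jacobian and multiplies [x^1] by [m], so the symbols stay constant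
    multiples of [1 / x^1]: the tensor transform of [C], with the factor [m^-1] coming from
    [1 / (m x^1)]. *)
Lemma gmap_pullback m a b d C (x : pt) i j k : 0 < m -> b != 0 -> half_plane x ->
  pullback (gmap m a b d) (gmap m^-1 (- (a / (m * b))) b^-1 (- (d / b))) (nablaB C) i j k x =
  nablaB (fun i j k => m^-1 * \sum_c
    (if c == 0 then row2 m^-1 (- (a / (m * b))) else row2 0 b^-1) 0 k *
    \sum_p \sum_q (if i == 0 then row2 m a else row2 0 b) 0 p *
      (if j == 0 then row2 m a else row2 0 b) 0 q * C p q c) i j k x.
Proof.
move=> m0 b0 x0; have m1 : m != 0 by rewrite gt_eqF.
set Phi := gmap m a b d; set Psi := gmap _ _ _ _.
pose u (i : 'I_2) : pt := if i == 0 then row2 m a else row2 0 b.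
pose v (i : 'I_2) : pt := if i == 0 then row2 m^-1 (- (a / (m * b))) else row2 0 b^-1.
have pf i' : Defs.pushforward Phi Psi (@coord_field R i') = fun=> u i'.
  apply/funext => y; rewrite /Defs.pushforward /Phi gmap_aff derive_affmap /coord_field.
  by move: i'; apply: forall_ord2; rewrite !mxE /= ?scale1r ?scale0r ?addr0 ?add0r.
rewrite /pullback !pf /Defs.pushforward {1}/Psi gmap_aff derive_affmap.
rewrite addvE 2!scalevE !covdE !derive_cst /nablaB.
have -> : Phi x 0 0 = m * x 0 0 by rewrite /Phi /gmap row2E.
rewrite !sum_ord2 /u !row2E; move: (x0); rewrite /half_plane /= => x1.
have x2 : x 0 0 != 0 by rewrite gt_eqF.
have z c : (0 : pt) 0 c = 0 by rewrite mxE.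
rewrite !z; move: k; apply: forall_ord2; rewrite /= ?row2E /=;
  move: i j; do 2! (apply: forall_ord2); rewrite /= ?row2E /=;
  by field; rewrite ?b0 ?m1 ?x2.
Qed.

End GroupG.

(** * Affine Killing fields of Type B connections *)

Section Killing.
Variable R : realType.
Local Notation pt := 'rV[R]_2.
Local Notation dir := (@dir R).
Implicit Types C : WB2 R.

Lemma coord_fieldE i : @coord_field R i = fun=> dir i.
Proof. by []. Qed.

Lemma lie_bracketE (X Y : pt -> pt) x c : lie_bracket X Y x 0 c =
  ('D_(X x) Y x) 0 c - ('D_(Y x) X x) 0 c.
Proof. by rewrite /lie_bracket addvE oppvE. Qed.

(** The Killing identity on coordinate fields, solved for the second derivatives of [X]. *)
Lemma killing_pde (U : set pt) C (X : pt -> pt) : open U -> U `<=` @half_plane R ->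
  affine_killing U (nablaB C) X -> forall x, U x -> forall i j c, pdd X i j c x =
  X x 0 0 / x 0 0 ^+ 2 * C i j c + (x 0 0)^-1 *
  (\sum_k C i j k * pd X k c x - \sum_k C k j c * pd X i k x - \sum_k C i k c * pd X j k x).
Proof.
move=> oU Uh [sX H] x Ux i j c.
have x0 : x 0 0 != 0 by rewrite gt_eqF //; exact: Uh.
have sc k : smooth_on U (@coord_field R k) by exact: smooth_cst.
have := H _ _ (sc i) (sc j) x Ux.
move=> /(congr1 (fun v : pt => v 0 c)) E.
pose B k y := - 'D_(dir k) X y.
have hB k : lie_bracket X (@coord_field R k) = B k.
  by apply/funext => y; rewrite /lie_bracket /coord_field derive_cst sub0r.
pose W y : pt := \row_k nablaB C i j k y.
have hW : covd (nablaB C) (@coord_field R i) (@coord_field R j) = W.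
  by apply/funext => y; rewrite covd_coord.
have EL : (lie_bracket X W x) 0 c = - (X x 0 0) / x 0 0 ^+ 2 * C i j c
    - \sum_k nablaB C i j k x * pd X k c x.
  rewrite lie_bracketE (derive_row _ (fun c => hasd_nablaB C i j c x0)) rowvE.
  rewrite (pdE _ _ (smooth_differentiable sX Ux)) /W !rowvE sum_ord2 /=.
  rewrite mulr0n mulr1n; move: (pd X 0 c x) (pd X 1 c x) => a b.
  by move: (X x 0 0) (X x 0 1) => u v; field.
have dB k : B k x = - 'D_(dir k) X x by [].
have E1 : (covd (nablaB C) (B i) (@coord_field R j) x) 0 c =
    - \sum_k nablaB C k j c x * pd X i k x.
  rewrite covdE coord_fieldE derive_cst /pd !sum_ord2 dB.
  move: ('D_(dir i) X x) => v; rewrite !oppvE !dirE mxE.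
  by move: j {E hW W EL H}; apply: forall_ord2; rewrite /=; ring.
have E2 : (covd (nablaB C) (@coord_field R i) (B j) x) 0 c =
    - pdd X i j c x - \sum_k nablaB C i k c x * pd X j k x.
  rewrite covdE coord_fieldE.
  have -> : 'D_(dir i) (B j) x = - 'D_(dir i) (fun y => 'D_(dir j) X y) x.
    by apply: deriveN; apply: diff_derivable; exact: (smooth_differentiable1 j sX Ux).
  rewrite oppvE -/(pdd X i j c x) /pd !sum_ord2 dB.
  move: ('D_(dir j) X x) (pdd _ _ _ _ _) => v p; rewrite !oppvE !dirE.
  by move: i {E hW W EL H hB B dB E1}; apply: forall_ord2; rewrite /=; ring.
cbv beta in E; move: E; rewrite [in RHS]addvE !hB hW EL E1 E2 /nablaB.
move: (pdd X i j c x) (pd X) => p q; rewrite !sum_ord2 => E.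
have -> : p = - ((- X x 0 0 / x 0 0 ^+ 2 * C i j c -
     ((x 0 0)^-1 * C i j 0 * q 0 c x + (x 0 0)^-1 * C i j 1 * q 1 c x)))
     - ((x 0 0)^-1 * C 0 j c * q i 0 x + (x 0 0)^-1 * C 1 j c * q i 1 x)
     - ((x 0 0)^-1 * C i 0 c * q j 0 x + (x 0 0)^-1 * C i 1 c * q j 1 x).
  by rewrite E; ring.
by ring.
Qed.

Lemma killing_germ_sub (U : set pt) C (X : pt -> pt) P : open U -> U P ->
  U `<=` @half_plane R -> affine_killing U (nablaB C) X -> ricdet C != 0 -> ~ flat_dev C ->
  exists2 Y, algh Y & \forall x \near P, X x = Y x.
Proof.
move=> oU UP Uh kX s0 nf; have sX := kX.1.
have x0 x : U x -> x 0 0 != 0 by move=> /Uh h; rewrite gt_eqF.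
have hxi x c : U x -> hasd (fun y => X y 0 c) x (fun j => pd X j c x) by exact: hasd_entry.
have hD x c j : U x -> hasd (pd X j c) x (fun i => pdd X i j c x) by exact: hasd_pd.
have pde := killing_pde oU Uh kX.
have N0 x (Ux : U x) c j := frame_der_eq0 oU x0 hxi hD pde s0 Ux nf c j.
have [s [t h]] := killing_integrate oU x0 hxi UP N0.
exists (fun x => s *: row2 (x 0 0) (x 0 1) + t *: row2 0 1); first by exists s, t.
apply: filterS h => x [e0 e1]; apply/rowP.
by apply: forall_ord2; rewrite addvE !scalevE !row2E /= ?e0 ?e1; ring.
Qed.

Lemma near_derive_entry (F : pt -> pt) (f : 'I_2 -> pt -> R) x (d : 'I_2 -> 'I_2 -> R) v c :
  (\forall y \near x, forall c, F y 0 c = f c y) -> (forall c, hasd (f c) x (d c)) ->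
  ('D_v F x) 0 c = v 0 0 * d c 0 + v 0 1 * d c 1.
Proof.
move=> nF hf; have -> : 'D_v F x = 'D_v (fun y => \row_c f c y) x.
  apply: near_eq_derive; apply: filterS nF => y h.
  by apply/rowP => k; rewrite h rowvE.
by rewrite (derive_row _ hf) rowvE.
Qed.

(** The identity is demanded for all smooth [Y] and [Z], so second derivatives of [Z] enter from
    both sides; they cancel because they are symmetric. *)
Lemma killing_algh C (X : pt -> pt) : algh X -> affine_killing (@half_plane R) (nablaB C) X.
Proof.
move=> [s [t eX]].
have aX : X = affmap (fun i => s *: dir i) (t *: dir 1).
  apply/funext => x; rewrite eX /affmap; apply/rowP; apply: forall_ord2;
  by rewrite !(addvE, scalevE) !row2E !dirE /=; ring.
have X0 x : X x 0 0 = s * x 0 0 by rewrite eX addvE !scalevE !row2E /=; ring.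
have dX v x : 'D_v X x = s *: v.
  by rewrite aX derive_affmap {3}[v]pt_decomp scalerDr !scalerA ![s * _]mulrC.
have hX c x : hasd (fun y => X y 0 c) x (fun i => s * (i == c)%:R).
  apply: hasd_eq (hasd_comp c (_ : differentiable X x)) _ => [|i].
    by rewrite aX; exact: differentiable_affmap.
  by rewrite dX scalevE dirE eq_sym.
split; first by rewrite aX; exact: smooth_affmap.
move=> Y Z sY sZ x Ux; have oU := open_half_plane (R := R).
have x0 : x 0 0 != 0 by rewrite gt_eqF.
have hY c := hasd_entry c sY Ux.
have hZ c := hasd_entry c sZ Ux.
have hZ2 c j := hasd_pd c j sZ Ux.
have sym c : pdd Z 1 0 c x = pdd Z 0 1 c x.
  have := @young _ (fun y => Z y 0 c) (fun i => pd Z i c) x _ _ _ (hZ2 c 0) (hZ2 c 1).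
  by apply; exact: (nearU oU Ux (fun y Uy => hasd_entry c sZ Uy)).
have ED (A B : pt -> pt) y c : half_plane y -> smooth_on (@half_plane R) B ->
    ('D_(A y) B y) 0 c = A y 0 0 * pd B 0 c y + A y 0 1 * pd B 1 c y.
  by move=> Uy sB; rewrite (pdE _ _ (smooth_differentiable sB Uy)).
pose f1 c y := Y y 0 0 * pd Z 0 c y + Y y 0 1 * pd Z 1 c y
  + \sum_a \sum_b (Y y 0 a * Z y 0 b) * nablaB C a b c y.
(* This closed form holds only where [Z] is smooth, so the covariant derivative is differentiated
   through an equality near [x]. *)
have n1 : \forall y \near x, forall c, covd (nablaB C) Y Z y 0 c = f1 c y.
  by apply: (nearU oU Ux) => y Uy c; rewrite covdE ED.
pose f2 c y := X y 0 0 * pd Z 0 c y + X y 0 1 * pd Z 1 c y - s * Z y 0 c.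
have n2 : \forall y \near x, forall c, lie_bracket X Z y 0 c = f2 c y.
  by apply: (nearU oU Ux) => y Uy c; rewrite lie_bracketE ED // dX scalevE.
have h1 c : hasd (f1 c) x (fun i =>
   (pd Y i 0 x * pd Z 0 c x + Y x 0 0 * pdd Z i 0 c x
   + (pd Y i 1 x * pd Z 1 c x + Y x 0 1 * pdd Z i 1 c x)) +
   \sum_a \sum_b ((pd Y i a x * Z x 0 b + Y x 0 a * pd Z i b x) * nablaB C a b c x
     + (Y x 0 a * Z x 0 b) * (- (i == 0)%:R / x 0 0 ^+ 2 * C a b c))).
  apply: hasdD; first by apply: hasdD; exact: hasdM.
  apply: hasd_sum => a; apply: hasd_sum => b; apply: hasdM; first exact: hasdM.
  exact: hasd_nablaB.
have h2 c : hasd (f2 c) x (fun i =>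
   (s * (i == 0)%:R * pd Z 0 c x + X x 0 0 * pdd Z i 0 c x) +
   (s * (i == 1)%:R * pd Z 1 c x + X x 0 1 * pdd Z i 1 c x) - s * pd Z i c x).
  by apply: hasdB; [apply: hasdD; exact: hasdM|exact: hasdZ].
apply/rowP => c; rewrite lie_bracketE dX scalevE (near_derive_entry _ _ n1 h1).
rewrite (nbhs_singleton n1) addvE !covdE.
rewrite (near_derive_entry _ _ n2 h2) (ED (lie_bracket X Y)) // /f1.
have bY a : lie_bracket X Y x 0 a = X x 0 0 * pd Y 0 a x + X x 0 1 * pd Y 1 a x - s * Y x 0 a.
  by rewrite lie_bracketE ED // dX scalevE.
have bZ a : lie_bracket X Z x 0 a = X x 0 0 * pd Z 0 a x + X x 0 1 * pd Z 1 a x - s * Z x 0 a.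
  by rewrite lie_bracketE ED // dX scalevE.
have sc := sym c.
move: (lie_bracket X Y x) (lie_bracket X Z x) bY bZ => LY LZ bY bZ.
rewrite !sum_ord2 !bY !bZ /nablaB X0 sc.
move: (pdd Z) (pd Z) (pd Y) (X x 0 1) (Z x 0) (Y x 0) (x 0 0) x0 => q z y X1 zz yy r r0.
by rewrite /=; field.
Qed.

End Killing.

(** * Vanishing deviation implies Type C *)

Section NearDifferentiable.
Variables (R : realType) (V W : normedModType R).

Lemma near_zero_differentiable (h : V -> W) x : (\forall y \near x, h y = 0) ->
  differentiable h x.
Proof.
move=> h0.
have E : continuous (0 : V -> W) /\ h \o shift x = cst (h x) + \0 +o_ (0 : V) id.
  split; first exact: cst_continuous.
  apply/eqaddoP => e e0; have h1 := (nbhs0P _ _).1 h0.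
  apply: filterS h1 => v hv.
  rewrite -![(_ - _ : _ -> _) _]/(_ - _) -![(_ + _ : _ -> _) _]/(_ + _) /=.
  rewrite (nbhs_singleton h0) /shift /= (addrC v) hv.
  by rewrite addr0 subr0 normr0 mulr_ge0 // ltW.
have D : 'd h x = 0 :> (V -> W) by apply/diff_unique; have [] := E.
by apply/diff_locallyP; rewrite D.
Qed.

Lemma near_eq_differentiable (f g : V -> W) x : (\forall y \near x, f y = g y) ->
  differentiable f x -> differentiable g x.
Proof.
move=> fg df; rewrite (_ : g = f + (g - f)); last first.
  by apply/funext => y; rewrite -![(_ + _ : _ -> _) _]/(_ + _) addrC subrK.
apply: differentiableD => //; apply: near_zero_differentiable.
by apply: filterS fg => y; rewrite -![(_ - _ : _ -> _) _]/(_ - _) => ->; rewrite subrr.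
Qed.
End NearDifferentiable.

Section FlatTypeC.
Variable R : realType.
Local Notation pt := 'rV[R]_2.
Local Notation dir := (@dir R).
Implicit Types C : WB2 R.

(** These multiples of powers of [1 / x^1] are closed under partial differentiation, which gives
    smoothness of the metric by induction; the exponent 2 is the weight of the Ricci tensor. *)
Definition ipow n (k : R) (x : pt) : R := k * ((x 0 0)^-1) ^+ n.

Lemma hasd_ipow n k (x : pt) : x 0 0 != 0 ->
  hasd (ipow n k) x (fun i => ipow n.+1 (- (k * n%:R) * (i == 0)%:R) x).
Proof.
move=> x0; rewrite /ipow; elim: n k => [|n IH] k.
  rewrite (_ : (fun y => _) = fun=> k); last by apply/funext => y; rewrite expr0 mulr1.
  by apply: hasd_eq (hasd_cst k x) _ => i; rewrite mulr0 oppr0 !mul0r.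
rewrite (_ : (fun y => _) = fun y : pt => (y 0 0)^-1 * (k * (y 0 0)^-1 ^+ n)); last first.
  by apply/funext => y; rewrite exprS mulrCA.
apply: hasd_eq (hasdM (hasdV x0 (hasd_coord 0 x)) (IH k)) _ => i.
by rewrite !exprS -natr1; field.
Qed.

Lemma smooth_ipow (V : normedModType R) n k (S : V) :
  smooth_on (@half_plane R) (fun x => ipow n k x *: S).
Proof.
have dS m l (x : pt) : half_plane x -> differentiable (fun y => ipow m l y *: S) x.
  move=> x0; apply: differentiableZl.
  by have [] := hasd_ipow m l (x := x) _; rewrite ?gt_eqF.
move=> s; suff [m [l h]] : exists m l, forall x, half_plane x ->
    iter_partial s (fun x => ipow n k x *: S) x = ipow m l x *: S.
  move=> x x0; apply: (@near_eq_differentiable _ _ _ (fun x => ipow m l x *: S)).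
    by apply: (nearU (open_half_plane (R := R)) x0) => y Uy; rewrite h.
  exact: dS.
elim: s => [|i s [m [l IH]]]; first by exists n, k.
exists m.+1, (- (l * m%:R) * (i == 0)%:R) => x x0 /=.
rewrite (@near_eq_derive _ _ _ _ (fun y => ipow m l y *: S)); last first.
  by apply: (nearU (open_half_plane (R := R)) x0) => y Uy; exact: IH.
have [|d1 d2] := hasd_ipow m l (x := x); first by rewrite gt_eqF.
by rewrite deriveE ?diffZl -?deriveE ?d2 //; exact: dS.
Qed.

Lemma bformE (S : 'M[R]_2) (u v : pt) :
  bform S u v = \sum_i \sum_j S i j * u 0 i * v 0 j.
Proof.
rewrite /bform mxE; rewrite !sum_ord2 !mxE !sum_ord2; ring.
Qed.

Lemma flat_symbol C : flat_dev C -> forall i j k, C i j k =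
  (if i == 0 then ricB C else ricD C) / ricdet C * Jmat (ricA C) (ricB C) (ricD C) k j
  - (i == 0)%:R * (j == k)%:R.
Proof.
move=> fl i j k; have /eqP := fl i j k; rewrite /dev subr_eq0 mul1r => /eqP.
by rewrite /frame_symbol -/(ricdet C) => <-; ring.
Qed.

Definition ricmetric C k (x : pt) : 'M[R]_2 := ipow 2 k x *: ricmat C.

Lemma ricmetricE C k x i j : ricmetric C k x i j = ipow 2 k x * ricmat C i j.
Proof. by rewrite /ricmetric mxE. Qed.

Lemma flat_levi_civita C k : ricdet C != 0 -> flat_dev C ->
  levi_civita (@half_plane R) (ricmetric C k) (nablaB C).
Proof.
move=> s0 fl X Y Z sX sY sZ x Ux.
have x0 : x 0 0 != 0 by rewrite gt_eqF.
have fC := flat_symbol fl.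
split.
  apply/rowP => c; rewrite addvE oppvE !covdE lie_bracketE.
  move: (('D_(X x) Y x) 0 c) (('D_(Y x) X x) 0 c) => a b.
  move: (X x) (Y x) => u v; rewrite !sum_ord2 /nablaB !fC.
  move: s0; rewrite /ricdet /Jmat => s0.
  by move: c; apply: forall_ord2; rewrite /=; field; rewrite s0 x0.
have hX c := hasd_entry c sX Ux.
have hY c := hasd_entry c sY Ux.
have hg := hasd_ipow 2 k x0.
pose F (y : pt) := \sum_i \sum_j ((ipow 2 k y * ricmat C i j) * X y 0 i * Y y 0 j).
have EF : (fun y => bform (ricmetric C k y) (X y) (Y y)) = F.
  apply/funext => y; rewrite bformE; apply: eq_bigr => i _; apply: eq_bigr => j _.
  by rewrite ricmetricE.
have hF : hasd F x (fun l => \sum_i \sum_j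
   (((ipow 3 (- (k * 2%:R) * (l == 0)%:R) x * ricmat C i j) * X x 0 i
     + (ipow 2 k x * ricmat C i j) * pd X l i x) * Y x 0 j
     + (ipow 2 k x * ricmat C i j) * X x 0 i * pd Y l j x)).
  apply: hasd_sum => i; apply: hasd_sum => j.
  apply: hasdM => //; apply: hasdM => //.
  by apply: hasd_eq (hasdM hg (hasd_cst (ricmat C i j) x)) _ => l; rewrite mulr0 addr0.
rewrite EF (hasd_derive (Z x) hF) !bformE.
have ED (B : pt -> pt) c : smooth_on (@half_plane R) B ->
    ('D_(Z x) B x) 0 c = Z x 0 0 * pd B 0 c x + Z x 0 1 * pd B 1 c x.
  by move=> sB; rewrite (pdE _ _ (smooth_differentiable sB Ux)).
have cX c : covd (nablaB C) Z X x 0 c = Z x 0 0 * pd X 0 c x + Z x 0 1 * pd X 1 c x +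
    \sum_i \sum_j Z x 0 i * X x 0 j * nablaB C i j c x by rewrite covdE ED.
have cY c : covd (nablaB C) Z Y x 0 c = Z x 0 0 * pd Y 0 c x + Z x 0 1 * pd Y 1 c x +
    \sum_i \sum_j Z x 0 i * Y x 0 j * nablaB C i j c x by rewrite covdE ED.
move: (covd _ Z X x) (covd _ Z Y x) cX cY => U V cX cY.
move: (pd X) (pd Y) (X x) (Y x) (Z x) cX cY => p q u v z cX cY.
rewrite !sum_ord2 !ricmetricE !cX !cY !sum_ord2 /nablaB !fC /ipow /ricmat !mxE.
move: s0; rewrite /ricdet /Jmat /= => s0.
by field; rewrite s0 x0.
Qed.

(** Numerator and determinant both carry the factor [(x^1)^-4], so the quotient does not depend on
    the point. *)
Lemma flat_gauss C k (x : pt) : half_plane x -> k != 0 -> ricdet C != 0 ->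
  gauss_curvature (ricmetric C k) (nablaB C) x =
  (curv 1 C 0 1 * ricA C + curv 1 C 1 1 * ricB C) / (k * ricdet C).
Proof.
move=> x1 k0 s0; have x0 : x 0 0 != 0 by rewrite gt_eqF.
rewrite /gauss_curvature curvature_nablaB // bformE det_mx2.
rewrite !sum_ord2 !ricmetricE /ipow coord_fieldE !rowvE !dirE /ricmat !mxE /= /ricdet.
move: s0; rewrite /ricdet => s0.
have u0 : k * (x 0 0)^-1 ^+ 4 != 0 by rewrite mulf_neq0 // expf_neq0 // invr_eq0.
rewrite -exprVn; move: (x 0 0)^-1 u0 => u u0.
rewrite -[RHS]mul1r -[X in _ = X * _](divff u0) mulf_div.
by apply: f_equal2; [|apply: f_equal]; ring.
Qed.

End FlatTypeC.

(** * Germs of Type B maps and of Killing fields *)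

Section Germs.
Variable R : realType.
Local Notation pt := 'rV[R]_2.
Implicit Types C : WB2 R.

Lemma has_signatureN n (S : 'M[R]_n) p q : has_signature S p q -> has_signature (- S) q p.
Proof.
move=> [B [d [uB E hp hq]]]; exists B, (- d); split=> //.
- by rewrite mulmxN mulNmx E; apply/matrixP => i j; rewrite !mxE mulNrn.
- by rewrite -hq; apply: eq_card => i; rewrite !inE mxE oppr_gt0.
- by rewrite -hp; apply: eq_card => i; rewrite !inE mxE oppr_lt0.
Qed.

Lemma ricmetric_sym_ricci C k (x : pt) : half_plane x ->
  ricmetric C k x = k *: sym_ricci (nablaB C) x.
Proof.
move=> x0; rewrite sym_ricci_nablaB ?gt_eqF // /ricmetric /ipow scalerA exprVn //.
Qed.

Lemma flat_typeC C p q : (p + q = 2)%N -> WB p q C -> flat_dev C -> typeC C.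
Proof.
move=> pq WC fl P hP.
have s0 := WB_ricdet pq WC.
(* Type C admits the signatures (2, 0) and (1, 1) only; a negative definite Ricci form is replaced
   by its opposite, which has the same Levi-Civita connection. *)
suff [k k0 sg] : exists2 k : R, k != 0 &
   (forall x, half_plane x -> has_signature (ricmetric C k x) 2 0) \/
   (forall x, half_plane x -> has_signature (ricmetric C k x) 1 1).
  exists (@half_plane R), (ricmetric C k),
    ((curv 1 C 0 1 * ricA C + curv 1 C 1 1 * ricB C) / (k * ricdet C)).
  split=> //.
  - by split=> //; exact: open_half_plane.
  - split; first exact: smooth_ipow.
    by move=> x _; apply/matrixP => i j; rewrite mxE !ricmetricE /ricmat !mxE;
      move: i j; do 2! (apply: forall_ord2).
  - by split; [exact: flat_levi_civita|move=> x hx; exact: flat_gauss].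
have W1 x : half_plane x -> has_signature (ricmetric C 1 x) p q.
  by move=> hx; rewrite ricmetric_sym_ricci // scale1r; exact: WC.
have W2 x : half_plane x -> has_signature (ricmetric C (-1) x) q p.
  by move=> hx; rewrite ricmetric_sym_ricci // scaleN1r; apply: has_signatureN; exact: WC.
case: p q pq {WC} W1 W2 => [|[|[|//]]] [|[|[|//]]] // _ W1 W2.
- by exists (-1); [rewrite oppr_eq0 oner_neq0|left].
- by exists 1; [rewrite oner_neq0|right].
- by exists 1; [rewrite oner_neq0|left].
Qed.

Lemma germ_eq (P : pt) (f g : pt -> pt) : (\forall x \near P, f x = g x) -> germ P f = germ P g.
Proof.
move=> fg; apply/seteqP; split=> h /= hh.
  by apply: filterS2 fg hh => x -> ->.
by apply: filterS2 fg hh => x -> ->.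
Qed.

Lemma calXE C P : ricdet C != 0 -> ~ flat_dev C -> half_plane P ->
  calX C P = germ P @` @groupG R.
Proof.
move=> s0 nf hP.
apply/seteqP; split=> [_ [Phi [U [V [Psi [C' [UP [Uh Vh] dif pb]]]]] <-]|
  _ [T [m [a [b [d [m0 b0 eT]]]]] <-]].
  have [t0 t1 _ [d hd]] := typeB_rigid dif Uh Vh pb s0 UP nf.
  have [_ UV _ _ _] := dif; have [VP _] := UV _ UP.
  have P0 : 0 < P 0 0 by exact: hP.
  have F0 : 0 < Phi P 0 0 by exact: Vh.
  exists (gmap (Phi P 0 0 / P 0 0) (pd Phi 0 1 P) (pd Phi 1 1 P) d).
    exists (Phi P 0 0 / P 0 0), (pd Phi 0 1 P), (pd Phi 1 1 P), d; split=> //.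
      exact: divr_gt0.
    (* As [M P 0 1 = 0], a zero coefficient here would make the invertible matrix [M P] singular. *)
    apply/negP => /eqP b0; have := typeB_mdet dif Uh Vh UP.
    by rewrite /mdet t1 /frame_jac b0 !(mulr0, mul0r) subrr eqxx.
  by apply: germ_eq; apply: filterS hd => x e; rewrite e.
exists T => //.
exists (@half_plane R), (@half_plane R), (gmap m^-1 (- (a / (m * b))) b^-1 (- (d / b))).
have -> : T = gmap m a b d by apply/funext => x; rewrite eT.
eexists; split; [exact: hP|by split|exact: gmap_diffeo|].
by move=> x hx i j k; rewrite gmap_pullback.
Qed.

Lemma killing_germsE C P : ricdet C != 0 -> ~ flat_dev C -> half_plane P ->
  killing_germs C P = germ P @` @algh R.
Proof.
move=> s0 nf hP.
apply/seteqP; split=> [_ [X [U [oU UP Uh kX]] <-]|_ [X hX <-]].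
  have [Y hY XY] := killing_germ_sub oU UP Uh kX s0 nf.
  by exists Y => //; apply/esym/germ_eq.
exists X => //; exists (@half_plane R); split=> //; first exact: open_half_plane.
exact: killing_algh.
Qed.

End Germs.

(** * The action of the group I+ *)

Section Action.
Variable R : realType.
Local Notation pt := 'rV[R]_2.
Implicit Types (C : WB2 R) (g h : pt).

Definition frame_coef (a b : R) (i l : 'I_2) : R :=
  if i == 0 then if l == 0 then 1 else - (a / b) else if l == 0 then 0 else b^-1.

Definition coframe_coef (a b : R) (k n : 'I_2) : R :=
  if k == 0 then if n == 0 then 1 else 0 else if n == 0 then a else b.

Lemma Iplus_actE g C i j k : Iplus_act g C i j k = \sum_l \sum_m \sum_n
  frame_coef (g 0 0) (g 0 1) i l * frame_coef (g 0 0) (g 0 1) j m *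
  coframe_coef (g 0 0) (g 0 1) k n * C l m n.
Proof.
rewrite /Iplus_act; apply: eq_bigr => l _; apply: eq_bigr => m _; apply: eq_bigr => n _.
rewrite /Iplus_frame /Iplus_coframe /frame_coef /coframe_coef.
by case: (i == 0); case: (j == 0); case: (k == 0); rewrite !row2E.
Qed.

Lemma WB2_ext C C' : (forall i j k, C i j k = C' i j k) -> C = C'.
Proof. by move=> h; do 3! (apply/funext => ?). Qed.

Lemma Iplus_act_mul g h C : Iplus g -> Iplus h ->
  Iplus_act (Iplus_mul g h) C = Iplus_act g (Iplus_act h C).
Proof.
rewrite /Iplus /= => g0 h0; have g1 : g 0 1 != 0 by rewrite gt_eqF.
have h1 : h 0 1 != 0 by rewrite gt_eqF.
apply: WB2_ext => i j k; rewrite !Iplus_actE !sum_ord2 !Iplus_actE !sum_ord2.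
rewrite /Iplus_mul !row2E /=.
move: (g 0 0) (g 0 1) (h 0 0) (h 0 1) g1 h1 => a b c d b0 d0.
by move: i j k; do 3! (apply: forall_ord2);
   rewrite /frame_coef /coframe_coef /=; field; rewrite b0 d0.
Qed.

Lemma Iplus_act1 C : Iplus_act (row2 0 1) C = C.
Proof.
apply: WB2_ext => i j k; rewrite Iplus_actE !sum_ord2 !row2E /=.
by move: i j k; do 3! (apply: forall_ord2);
   rewrite /frame_coef /coframe_coef /= ?invr1; ring.
Qed.

Definition Iplus_inv g : pt := row2 (- (g 0 0 / g 0 1)) (g 0 1)^-1.

Lemma Iplus_row2 (a b : R) : Iplus (row2 a b) = (0 < b) :> Prop.
Proof. by rewrite /Iplus /= row2E. Qed.

Lemma Iplus_one : Iplus (row2 0 1 : pt).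
Proof. by rewrite Iplus_row2. Qed.

Lemma Iplus_invP g : Iplus g -> Iplus (Iplus_inv g).
Proof. by rewrite /Iplus_inv Iplus_row2 invr_gt0. Qed.

Lemma Iplus_mulP g h : Iplus g -> Iplus h -> Iplus (Iplus_mul g h).
Proof. by move=> g0 h0; rewrite /Iplus_mul Iplus_row2; exact: mulr_gt0. Qed.

Lemma pt_ext (u v : pt) : u 0 0 = v 0 0 -> u 0 1 = v 0 1 -> u = v.
Proof. by move=> h0 h1; apply/rowP; apply: forall_ord2. Qed.

Lemma Iplus_mulVg g : Iplus g -> Iplus_mul (Iplus_inv g) g = row2 0 1.
Proof.
rewrite /Iplus /= => g0; have g1 : g 0 1 != 0 by rewrite gt_eqF.
by apply: pt_ext; rewrite /Iplus_mul /Iplus_inv !row2E /=; field.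
Qed.

Lemma Iplus_mulgV g : Iplus g -> Iplus_mul g (Iplus_inv g) = row2 0 1.
Proof.
rewrite /Iplus /= => g0; have g1 : g 0 1 != 0 by rewrite gt_eqF.
by apply: pt_ext; rewrite /Iplus_mul /Iplus_inv !row2E /=; field.
Qed.

Lemma Iplus_mulg1 g : Iplus_mul g (row2 0 1) = g.
Proof. by apply: pt_ext; rewrite /Iplus_mul !row2E /=; ring. Qed.

Lemma Iplus_actK g C : Iplus g -> Iplus_act (Iplus_inv g) (Iplus_act g C) = C.
Proof.
by move=> Ig; rewrite -Iplus_act_mul ?Iplus_mulVg ?Iplus_act1 //; exact: Iplus_invP.
Qed.

Lemma Iplus_actVK g C : Iplus g -> Iplus_act g (Iplus_act (Iplus_inv g) C) = C.
Proof.
by move=> Ig; rewrite -Iplus_act_mul ?Iplus_mulgV ?Iplus_act1 //; exact: Iplus_invP.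
Qed.

Lemma Iplus_act_invM g h C : Iplus g -> Iplus h ->
  Iplus_act (Iplus_inv (Iplus_mul g h)) (Iplus_act g C) = Iplus_act (Iplus_inv h) C.
Proof.
move=> Ig Ih; rewrite -Iplus_act_mul //; last by apply: Iplus_invP; exact: Iplus_mulP.
congr (Iplus_act _ C).
have g1 : g 0 1 != 0 by rewrite gt_eqF.
have h1 : h 0 1 != 0 by rewrite gt_eqF.
by apply: pt_ext; rewrite /Iplus_inv /Iplus_mul !row2E /=; field; rewrite g1 h1.
Qed.

Lemma ric_act g C : Iplus g ->
  [/\ ricA (Iplus_act g C) = ricA C - 2 * (g 0 0 / g 0 1) * ricB C + (g 0 0 / g 0 1) ^+ 2 * ricD C,
      ricB (Iplus_act g C) = (ricB C - g 0 0 / g 0 1 * ricD C) / g 0 1 &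
      ricD (Iplus_act g C) = ricD C / g 0 1 ^+ 2].
Proof.
rewrite /Iplus /= => g0; have g1 : g 0 1 != 0 by rewrite gt_eqF.
rewrite /ricA /ricB /ricD /sA /sB /sD /curv !sum_ord2 !Iplus_actE !sum_ord2.
move: (g 0 0) (g 0 1) g1 => a b b0.
by split; rewrite /frame_coef /coframe_coef /=; field; rewrite b0.
Qed.

Lemma ricdet_act g C : Iplus g -> ricdet (Iplus_act g C) = ricdet C / g 0 1 ^+ 2.
Proof.
move=> Ig; have [eA eB eD] := ric_act C Ig; rewrite /ricdet eA eB eD.
by have g1 : g 0 1 != 0; [rewrite gt_eqF|field].
Qed.

Lemma WB_act g C p q : Iplus g -> WB p q C -> WB p q (Iplus_act g C).
Proof.
move=> Ig WC x hx; have := WC x hx; rewrite !sym_ricci_nablaB ?gt_eqF //.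
have g1 : g 0 1 != 0 by rewrite gt_eqF.
have [eA eB eD] := ric_act C Ig.
pose F : 'M[R]_2 := \matrix_(i, l) frame_coef (g 0 0) (g 0 1) i l.
have uF : F \in unitmx.
  by rewrite unitmxE det_mx2 !mxE /frame_coef /= unitfE mulr0 subr0 mul1r invr_eq0.
have -> : (x 0 0) ^- 2 *: ricmat (Iplus_act g C) = F *m ((x 0 0) ^- 2 *: ricmat C) *m F^T.
  rewrite -scalemxAr -scalemxAl; congr (_ *: _).
  apply/matrixP => i j; rewrite !mxE !sum_ord2 !mxE !sum_ord2 !mxE eA eB eD.
  move: (g 0 0) (g 0 1) g1 => a b b0.
  by move: i j; do 2! (apply: forall_ord2); rewrite /frame_coef /=; field.
move=> [B [d [uB E hp hq]]]; exists (B *m invmx F), d; split=> //.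
  by rewrite unitmx_mul uB unitmx_inv.
rewrite trmx_mul trmx_inv -E !mulmxA mulmxKV // -!mulmxA; congr (_ *m (_ *m _)).
by rewrite mulmxA mulmxV ?mul1mx // unitmx_tr.
Qed.

(** A congruence multiplies the determinant by a square, and the diagonal form has determinant of
    sign [(-1) ^ q]; this later compares two Ricci forms of equal signature. *)
Lemma has_signature_sgn (S : 'M[R]_2) p q : (p + q = 2)%N -> has_signature S p q ->
  0 < (-1) ^+ q * \det S.
Proof.
move=> pq [B [d [uB E hp hq]]].
have B0 : \det B != 0 by rewrite -unitfE -unitmxE.
suff : 0 < (-1) ^+ q * \det (B *m S *m B^T).
  rewrite !det_mulmx det_tr.
  have -> : (-1) ^+ q * (\det B * \det S * \det B) = (-1) ^+ q * \det S * \det B ^+ 2 by ring.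
  by rewrite pmulr_lgt0 // exprn_even_gt0.
rewrite E det_diag big_ord_recl big_ord_recl big_ord0 mulr1.
rewrite (_ : lift ord0 ord0 = 1); last exact: val_inj.
move: pq; rewrite -hp -hq (card_ord2 (fun i => 0 < d 0 i)) (card_ord2 (fun i => d 0 i < 0)).
case: (ltgtP (d 0 0) 0) => // h0; case: (ltgtP (d 0 1) 0) => // h1 _.
- by rewrite /= expr2 mulrNN mulr1 mul1r nmulr_rgt0.
- by rewrite /= expr1 mulN1r oppr_gt0 nmulr_rlt0.
- by rewrite /= expr1 mulN1r oppr_gt0 pmulr_rlt0.
- by rewrite /= expr0 mul1r mulr_gt0.
Qed.

Lemma WB_ricdet_sgn C p q : (p + q = 2)%N -> WB p q C -> 0 < (-1) ^+ q * ricdet C.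
Proof.
move=> pq /(_ (row2 1 0)); rewrite /half_plane /= row2E ltr01 => /(_ isT).
rewrite sym_ricci_nablaB ?row2E ?oner_neq0 //= expr1n invr1 scale1r.
by move=> /(has_signature_sgn pq); rewrite det_mx2 /ricmat !mxE /= -expr2.
Qed.

End Action.

(** * Oriented equivalence classes are orbits *)

Section Orbits.
Variable R : realType.
Local Notation pt := 'rV[R]_2.
Local Notation dir := (@dir R).
Implicit Types (C : WB2 R) (g h : pt).

Lemma jacobianE (F : pt -> pt) x i c : differentiable F x ->
  jacobian F x i c = pd F i c x.
Proof.
move=> dF; rewrite /pd (deriveEjacobian _ dF).
by move: (jacobian F x) => J; rewrite /dir -rowE mxE.
Qed.

Lemma det_jacobian (F : pt -> pt) x : differentiable F x ->
  \det (jacobian F x) = mdet (fun c j => pd F j c x).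
Proof.
move=> dF; rewrite det_mx2 !jacobianE // /mdet.
move: (pd F 0 0 x) (pd F 0 1 x) (pd F 1 0 x) (pd F 1 1 x) => a b c d.
by ring.
Qed.

Definition act_gmap g : pt -> pt := gmap 1 (g 0 0) (g 0 1) 0.
Definition act_gmap_inv g : pt -> pt :=
  gmap 1^-1 (- (g 0 0 / (1 * g 0 1))) (g 0 1)^-1 (- (0 / g 0 1)).

Lemma act_gmap_diffeo g : Iplus g ->
  diffeo (@half_plane R) (@half_plane R) (act_gmap g) (act_gmap_inv g).
Proof. by move=> Ig; apply: gmap_diffeo => //; rewrite gt_eqF. Qed.

Lemma act_gmap_pullback g C x i j k : Iplus g -> half_plane x ->
  pullback (act_gmap g) (act_gmap_inv g) (nablaB (Iplus_act g C)) i j k x = nablaB C i j k x.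
Proof.
move=> Ig hx; have g1 : g 0 1 != 0 by rewrite gt_eqF.
rewrite /act_gmap /act_gmap_inv gmap_pullback // /nablaB; congr (_ * _).
rewrite !sum_ord2 !Iplus_actE !sum_ord2.
move: (g 0 0) (g 0 1) g1 => a b b0.
by move: i j k; do 3! (apply: forall_ord2); rewrite /= !row2E /=
   /frame_coef /coframe_coef /=; field; rewrite ?b0 ?oner_neq0.
Qed.

Lemma act_oriented_equiv g C : Iplus g -> oriented_equiv C (Iplus_act g C).
Proof.
move=> Ig; exists (row2 1 0), (@half_plane R), (@half_plane R), (act_gmap g), (act_gmap_inv g).
have dif := act_gmap_diffeo Ig.
split=> //; [by rewrite /half_plane /= row2E|by split| |].
  move=> x hx; have dF : differentiable (act_gmap g) x.
    by rewrite /act_gmap gmap_aff; exact: differentiable_affmap.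
  rewrite (det_jacobian dF) /mdet /pd /act_gmap gmap_aff !derive_affmap.
  rewrite !(addvE, scalevE) !dirE !row2E /=.
  by rewrite !(mul1r, mul0r, mulr0, addr0, add0r, subr0).
by move=> x hx i j k; exact: act_gmap_pullback.
Qed.

(** [typeB_flat] goes from target to source, so it is applied to the map of the inverse of [g],
    which carries the connection of [Iplus_act g C] to that of [C]. *)
Lemma flat_act g C : Iplus g -> ricdet C != 0 -> flat_dev C -> flat_dev (Iplus_act g C).
Proof.
move=> Ig s0 fC; have Ig' := Iplus_invP Ig.
have h1 : half_plane (row2 1 0 : pt) by rewrite /half_plane /= row2E.
apply: (@typeB_flat _ _ _ _ _ C (Iplus_act g C) (act_gmap_diffeo Ig') _ _ _ s0 _ h1 fC) => //.
move=> x hx i j k; rewrite -[in LHS](Iplus_actK C Ig); exact: act_gmap_pullback.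
Qed.

Lemma flat_ext C C' : flat_dev C -> flat_dev C' -> ricA C = ricA C' -> ricB C = ricB C' ->
  ricD C = ricD C' -> C = C'.
Proof.
move=> fC fC' eA eB eD; apply: WB2_ext => i j k.
by rewrite (flat_symbol fC) (flat_symbol fC') /ricdet eA eB eD.
Qed.

(* When the connection is the Levi-Civita connection of its Ricci metric, that metric
   has Gauss curvature 1, i.e. det = - rho_22; this fixes it up to the action. *)
Lemma flat_orbit C C' p q : (p + q = 2)%N -> WB p q C -> WB p q C' ->
  flat_dev C -> flat_dev C' -> exists2 g, Iplus g & C' = Iplus_act g C.
Proof.
move=> pq WC WC' fC fC'.
have s0 := WB_ricdet pq WC; have s0' := WB_ricdet pq WC'.
have e := dev0_ricdet s0 fC; have e' := dev0_ricdet s0' fC'.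
have D0 : ricD C != 0 by move: s0; rewrite e oppr_eq0.
have D0' : ricD C' != 0 by move: s0'; rewrite e' oppr_eq0.
have sg : 0 < ricD C / ricD C'.
  have := WB_ricdet_sgn pq WC; have := WB_ricdet_sgn pq WC'; rewrite e e'.
  rewrite !mulrN !oppr_gt0 => h' h.
  have h2 : 0 < (-1) ^+ q * ricD C * ((-1) ^+ q * ricD C') by rewrite nmulr_rgt0.
  have h3 : 0 < ricD C * ricD C'.
    by rewrite mulrACA -exprD addnn -mul2n exprM sqrrN !expr1n mul1r in h2.
  by rewrite -(pmulr_lgt0 _ (_ : 0 < ricD C' ^+ 2)) ?exprn_even_gt0 // expr2 mulrA divfK.
(* The action divides [ricD] by [b ^ 2], which fixes [b]; below, [s = a / b] is chosen to match
   [ricB]. *)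
pose b := Num.sqrt (ricD C / ricD C').
have b0 : 0 < b by rewrite sqrtr_gt0.
have b1 : b != 0 by rewrite gt_eqF.
have b2 : b ^+ 2 = ricD C / ricD C' by rewrite sqr_sqrtr // ltW.
have eD : ricD C = b ^+ 2 * ricD C' by rewrite b2 divfK.
pose s := (ricB C - b * ricB C') / ricD C.
exists (row2 (s * b) b); first by rewrite Iplus_row2.
have Ig : Iplus (row2 (s * b) b) by rewrite Iplus_row2.
have [hA hB hD] := ric_act C Ig; rewrite !row2E /= mulfK // in hA hB hD.
have hD' : ricD (Iplus_act (row2 (s * b) b) C) = ricD C' by rewrite hD b2 invf_div mulrC divfK.
have hB' : ricB (Iplus_act (row2 (s * b) b) C) = ricB C'.
  by rewrite hB /s; field; rewrite b1 D0.
apply: flat_ext => //; first exact: flat_act.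
(* With [ricB] and [ricD] matched, the remaining entry follows from [ricdet = - ricD] on both sides,
   as [ricD] is nonzero. *)
apply: (mulIf D0').
have e2 : ricdet (Iplus_act (row2 (s * b) b) C) = - ricD C'.
  by rewrite ricdet_act // row2E /= e eD; field.
by move: e2 e'; rewrite /ricdet hB' hD'; lra.
Qed.

Lemma oriented_equiv_orbit C C' p q : (p + q = 2)%N -> WB p q C -> WB p q C' ->
  oriented_equiv C C' -> exists2 g, Iplus g & C' = Iplus_act g C.
Proof.
move=> pq WC WC' [P [U [V [Phi [Psi [UP [Uh Vh] dif ori pb]]]]]].
have s0' := WB_ricdet pq WC'.
have [fC'|nf] := pselect (flat_dev C').
  have fC := typeB_flat dif Uh Vh pb s0' UP fC'.
  exact: (flat_orbit pq WC WC' fC fC').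
have [t0 t1 q0 _] := typeB_rigid dif Uh Vh pb s0' UP nf.
have [_ UV _ sPhi _] := dif; have [VP _] := UV _ UP.
have P0 : 0 < P 0 0 by exact: Uh.
have F0 : 0 < Phi P 0 0 by exact: Vh.
move: (ori P UP); rewrite (det_jacobian (smooth_differentiable sPhi UP)) => jac.
move: t0 t1 q0; set M := frame_jac _ _ _ P => t0 t1 q0.
have b0 : 0 < M 1 1.
  have : mdet M = (P 0 0 / Phi P 0 0) ^+ 2 * mdet (fun c j => pd Phi j c P).
    rewrite /mdet /M /frame_jac.
    by move: (pd Phi) (Phi P 0 0) F0 => D f F0; field; rewrite gt_eqF.
  rewrite /mdet t0 t1 mul1r mul0r subr0 => ->.
  by rewrite mulr_gt0 // exprn_gt0 // divr_gt0.
(* [M] is the linear part of [Phi] divided by its dilation factor. Dilations preserve every Type B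
   connection, so the bottom row of [M] is the wanted group element. *)
clearbody M; exists (row2 (M 1 0) (M 1 1)); first by rewrite Iplus_row2.
have b1 : M 1 1 != 0 by rewrite gt_eqF.
(* As [M 0 i] is a Kronecker delta, the terms added by the two frame symbols cancel and [Q = 0]
   becomes the transformation law of a tensor. *)
have H i j c : C i j 0 * M c 0 + C i j 1 * M c 1 = \sum_a \sum_b C' a b c * (M a i * M b j).
  rewrite -(sum_ord2 (fun k => C i j k * M c k)).
  have := q0 i j c; rewrite qform_frameE.
  have -> : M 0 i = (i == 0)%:R by move: i {q0}; apply: forall_ord2; rewrite ?t0 ?t1.
  by rewrite mul1r addrK => /eqP; rewrite subr_eq0 => /eqP.
apply: WB2_ext => i j k; rewrite Iplus_actE !row2E /=.
transitivity (\sum_l \sum_m frame_coef (M 1 0) (M 1 1) i l * frame_coef (M 1 0) (M 1 1) j m *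
   (\sum_n C l m n * M k n)).
  rewrite !sum_ord2 !H !sum_ord2 t0 t1.
  move: (M 1 0) (M 1 1) b1 => a b b1.
  by move: i j; do 2! (apply: forall_ord2); rewrite /frame_coef /=; field.
rewrite !sum_ord2; move: k; apply: forall_ord2; rewrite /coframe_coef /= ?t0 ?t1; ring.
Qed.

(** The germs in the defining relation live at unrelated points; in terms of orbits, symmetry and
    transitivity come from the group. *)
Lemma moduli_classE C p q : (p + q = 2)%N -> WB p q C ->
  moduli_class p q C = [set C' | exists2 g, Iplus g & C' = Iplus_act g C].
Proof.
move=> pq WC; apply/seteqP; split=> C' /=.
  by move=> [WC' eq]; exact: (oriented_equiv_orbit pq WC WC' eq).
move=> [g Ig ->]; split; [exact: WB_act|exact: act_oriented_equiv].
Qed.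

Lemma moduli_class_eq C C' p q : (p + q = 2)%N -> WB p q C -> WB p q C' ->
  moduli_class p q C = moduli_class p q C' <-> exists2 g, Iplus g & C' = Iplus_act g C.
Proof.
move=> pq WC WC'; rewrite !(moduli_classE pq) //; split=> [E|[g Ig ->]].
  have : [set C'' | exists2 g, Iplus g & C'' = Iplus_act g C'] C'.
    by exists (row2 0 1); [exact: Iplus_one|rewrite Iplus_act1].
  by rewrite -E.
apply/seteqP; split=> C'' /= [h Ih ->].
  exists (Iplus_mul h (Iplus_inv g)); first exact: Iplus_mulP (Iplus_invP Ig).
  rewrite Iplus_act_mul ?Iplus_actK //; exact: Iplus_invP.
by exists (Iplus_mul h g); [exact: Iplus_mulP|rewrite Iplus_act_mul].
Qed.

End Orbits.

(** * Slices and the moduli space *)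

Section AnalyticFamilies.
Variables (R : realType) (n : nat).
Local Notation pt := 'rV[R]_2.

Definition pans (F : 'rV[R]_n -> WB2 R) x := forall i j k, pan (fun z => F z i j k) x.
Definition panv k (G : 'rV[R]_n -> 'rV[R]_k) x := forall j, pan (fun z => G z 0 j) x.

Lemma pan_ext (f g : 'rV[R]_n -> R) x : (forall z, f z = g z) -> pan f x -> pan g x.
Proof. by move=> e; rewrite (_ : f = g) //; apply/funext. Qed.

Lemma panZ k (f : 'rV[R]_n -> R) x : pan f x -> pan (fun y => k * f y) x.
Proof. by move=> h; apply: panM => //; exact: pan_cst. Qed.

Lemma pan_row2 (u v : 'rV[R]_n -> R) x : pan u x -> pan v x ->
  panv (fun z => row2 (u z) (v z)) x.
Proof.
move=> hu hv j; apply: (pan_ext (f := if j == 0 then u else v)) => [z|].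
  by rewrite row2E; case: ifP.
by case: ifP.
Qed.

Lemma pan_frame_coef (G : 'rV[R]_n -> pt) x i l : panv G x -> G x 0 1 != 0 ->
  pan (fun z => frame_coef (G z 0 0) (G z 0 1) i l) x.
Proof.
move=> hG g1; have hV := panV (hG 1) g1.
by rewrite /frame_coef; case: (i == 0); case: (l == 0); [exact: pan_cst
  |apply: panN; exact: panM|exact: pan_cst|exact: hV].
Qed.

Lemma pans_act (G : 'rV[R]_n -> pt) F x : panv G x -> G x 0 1 != 0 -> pans F x ->
  pans (fun z => Iplus_act (G z) (F z)) x.
Proof.
move=> hG g1 hF i j k; apply: (pan_ext (f := fun z => \sum_l \sum_m \sum_n
  frame_coef (G z 0 0) (G z 0 1) i l * frame_coef (G z 0 0) (G z 0 1) j m *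
  coframe_coef (G z 0 0) (G z 0 1) k n * F z l m n)) => [z|].
  by rewrite Iplus_actE.
apply: pan_sum => l _; apply: pan_sum => m _; apply: pan_sum => o _.
apply: panM => //; apply: panM; first by apply: panM; exact: pan_frame_coef.
by rewrite /coframe_coef; case: (k == 0); case: (o == 0); [exact: pan_cst|exact: pan_cst
  |exact: hG|exact: hG].
Qed.

Lemma panv_inv (G : 'rV[R]_n -> pt) x : panv G x -> G x 0 1 != 0 ->
  panv (fun z => Iplus_inv (G z)) x.
Proof.
move=> hG g1; apply: pan_row2; last exact: panV.
by apply: panN; apply: panM => //; exact: panV.
Qed.

Lemma pan_curv F x c j : pans F x -> pan (fun z => curv 1 (F z) c j) x.
Proof.
move=> hF; apply: panB; last exact: panZ.
by apply: pan_sum => b _; apply: panB; exact: panM.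
Qed.

Lemma pan_ric F x : pans F x -> [/\ pan (fun z => ricA (F z)) x,
  pan (fun z => ricB (F z)) x, pan (fun z => ricD (F z)) x & pan (fun z => ricdet (F z)) x].
Proof.
move=> hF; have h c j := pan_curv c j hF.
have hA : pan (fun z => ricA (F z)) x by apply: panN; exact: h.
have hB : pan (fun z => ricB (F z)) x by apply: panM; [exact: panB|exact: pan_cst].
have hD : pan (fun z => ricD (F z)) x by exact: h.
by split=> //; apply: panB; [exact: panM|exact: panX].
Qed.

End AnalyticFamilies.

Section OpenWB.
Variables (R : realType) (n : nat).

(** Eliminating the off-diagonal entry leaves [S 0 0] and [\det S / S 0 0], which have the signs of
    the entries of [d]. The strict inequalities assumed here are open conditions. *)
Lemma signature_diag2 (S : 'M[R]_2) (d : 'rV[R]_2) : S 0 1 = S 1 0 ->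
  0 < d 0 0 * S 0 0 -> 0 < d 0 0 * d 0 1 * \det S ->
  has_signature S #|[set i | 0 < d 0 i]%SET| #|[set i | d 0 i < 0]%SET|.
Proof.
move=> sy h0 h1; have s0 : S 0 0 != 0 by apply: contraTneq h0 => ->; rewrite mulr0 ltxx.
have s1 : 0 < d 0 1 * (\det S / S 0 0).
  have : 0 < d 0 0 * S 0 0 * (d 0 1 * (\det S / S 0 0)).
    by rewrite [X in 0 < X](_ : _ = d 0 0 * d 0 1 * \det S) //; field.
  by rewrite pmulr_rgt0.
exists (\matrix_(i, j) (if i == 0 then if j == 0 then 1 else 0
   else if j == 0 then - (S 0 1 / S 0 0) else 1)), (row2 (S 0 0) (\det S / S 0 0)); split.
- by rewrite unitmxE det_mx2 !mxE /= mul0r subr0 mulr1 unitr1.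
- apply/matrixP => i j; rewrite !mxE !sum_ord2 !mxE !sum_ord2 !mxE det_mx2 -sy.
  by move: i j; do 2! (apply: forall_ord2); rewrite /= ?row2E /= ?mulr1n ?mulr0n; field.
- rewrite !card_ord2 !row2E /=; congr (_ + _)%N; congr (nat_of_bool _).
    by apply/idP/idP => h; [rewrite -(pmulr_rgt0 _ h) mulrC|rewrite -(pmulr_rgt0 _ h)].
  by apply/idP/idP => h; [rewrite -(pmulr_rgt0 _ h) mulrC|rewrite -(pmulr_rgt0 _ h)].
- rewrite !card_ord2 !row2E /=; congr (_ + _)%N; congr (nat_of_bool _).
    by apply/idP/idP => h; [rewrite -(nmulr_rgt0 _ h) mulrC|rewrite -(nmulr_rgt0 _ h)].
  by apply/idP/idP => h; [rewrite -(nmulr_rgt0 _ h) mulrC|rewrite -(nmulr_rgt0 _ h)].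
Qed.

Lemma has_signature_congr m (S B : 'M[R]_m) p q : B \in unitmx ->
  has_signature (B *m S *m B^T) p q -> has_signature S p q.
Proof.
move=> uB [B' [d [uB' E hp hq]]]; exists (B' *m B), d; split=> //.
  by rewrite unitmx_mul uB' uB.
by rewrite -E trmx_mul !mulmxA.
Qed.

Lemma has_signatureZ m (S : 'M[R]_m) k p q : 0 < k -> has_signature S p q ->
  has_signature (k *: S) p q.
Proof.
move=> k0 [B [d [uB E hp hq]]]; exists B, (k *: d); split=> //.
- rewrite -scalemxAr -scalemxAl E; apply/matrixP => i j; rewrite !mxE mulrnAr //.
- by rewrite -hp; apply: eq_card => i; rewrite !inE mxE pmulr_rgt0.
- by rewrite -hq; apply: eq_card => i; rewrite !inE mxE pmulr_rlt0.
Qed.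

Lemma WB_ricmat (C : WB2 R) p q : WB p q C <-> has_signature (ricmat C) p q.
Proof.
split=> [|h x hx].
  move=> /(_ (row2 1 0)); rewrite /half_plane /= row2E ltr01 => /(_ isT).
  by rewrite sym_ricci_nablaB ?row2E ?oner_neq0 //= expr1n invr1 scale1r.
by rewrite sym_ricci_nablaB ?gt_eqF //; apply: has_signatureZ; rewrite // invr_gt0 exprn_gt0.
Qed.

(** After the congruence [B] that diagonalises the form at [x], the conditions of [signature_diag2]
    hold at [x] and persist nearby, being strict inequalities on analytic functions. *)
Lemma WB_near (F : 'rV[R]_n -> WB2 R) x p q : (p + q = 2)%N -> pans F x -> WB p q (F x) ->
  \forall z \near x, WB p q (F z).
Proof.
move=> pq hF /WB_ricmat [B [d [uB E hp hq]]].
have [hA hB hD _] := pan_ric hF.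
pose S z := B *m ricmat (F z) *m B^T.
have hS i j : pan (fun z => S z i j) x.
  apply: (pan_ext (f := fun z => \sum_k (\sum_l B i l * ricmat (F z) l k) * B j k)).
    by move=> z; rewrite !mxE; apply: eq_bigr => k _; rewrite !mxE.
  apply: pan_sum => k _; apply: panM; last exact: pan_cst.
  apply: pan_sum => l _; apply: panM; first exact: pan_cst.
  apply: (pan_ext (f := fun z => if l == 0 then if k == 0 then ricA (F z) else ricB (F z)
     else if k == 0 then ricB (F z) else ricD (F z))) => [z|]; first by rewrite mxE.
  by case: (l == 0); case: (k == 0).
have Ex : S x = diag_mx d by [].
have dd : d 0 0 != 0 /\ d 0 1 != 0.
  move: pq; rewrite -hp -hq (card_ord2 (fun i => 0 < d 0 i)) (card_ord2 (fun i => d 0 i < 0)).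
  by case: (ltgtP (d 0 0) 0) => //; case: (ltgtP (d 0 1) 0).
have [d0 d1] := dd.
have n0 : \forall z \near x, 0 < d 0 0 * S z 0 0.
  apply: pan_gt0; first exact: panZ.
  by rewrite Ex mxE eqxx mulr1n -expr2 exprn_even_gt0.
have n1 : \forall z \near x, 0 < d 0 0 * d 0 1 * (S z 0 0 * S z 1 1 - S z 0 1 * S z 1 0).
  apply: pan_gt0; first by apply: panZ; apply: panB; exact: panM.
  rewrite Ex !mxE /= !mulr1n !mulr0n mulr0 subr0 -expr2 exprn_even_gt0 //.
  by rewrite mulf_neq0.
apply: filterS2 n0 n1 => z h0 h1; apply/WB_ricmat; apply: (has_signature_congr uB).
rewrite -hp -hq; apply: signature_diag2 => //; last by rewrite det_mx2.
have sym : (S z)^T = S z.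
  rewrite /S !trmx_mul trmxK mulmxA; congr (_ *m _ *m _).
  by apply/matrixP => i j; rewrite !mxE; move: i j; do 2! (apply: forall_ord2).
by have := congr1 (fun T : 'M[R]_2 => T 1 0) sym; rewrite mxE.
Qed.

End OpenWB.

(** * Slices of the action and the equivariant map tau *)

Section Slices.
Variable R : realType.
Local Notation pt := 'rV[R]_2.
Implicit Types (C : WB2 R) (g h : pt) (e : R).

Definition mk8 (a b c d e f g h : R) : WB2 R := fun i j k =>
  if i == 0 then if j == 0 then if k == 0 then a else b else if k == 0 then c else d
  else if j == 0 then if k == 0 then e else f else if k == 0 then g else h.

Lemma mk8_eta C : mk8 (C 0 0 0) (C 0 0 1) (C 0 1 0) (C 0 1 1)
  (C 1 0 0) (C 1 0 1) (C 1 1 0) (C 1 1 1) = C.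
Proof. by apply: WB2_ext; do 3! (apply: forall_ord2). Qed.

Definition row6 (a b c d e f : R) : 'rV[R]_6 := \row_j nth 0 [:: a; b; c; d; e; f] j.

Definition entry n (y : 'rV[R]_n.+1) (k : nat) : R := y 0 (inord k).

Lemma row6_eta (y : 'rV[R]_6) :
  row6 (entry y 0) (entry y 1) (entry y 2) (entry y 3) (entry y 4) (entry y 5) = y.
Proof.
apply/rowP => j; rewrite mxE /entry.
by case: j => [[|[|[|[|[|[|//]]]]]] h] /=; congr (y _ _); apply: val_inj; rewrite /= inordK.
Qed.

Lemma pan_row6 n (a b c d e f : 'rV[R]_n -> R) x :
  pan a x -> pan b x -> pan c x -> pan d x -> pan e x -> pan f x ->
  panv (fun z => row6 (a z) (b z) (c z) (d z) (e z) (f z)) x.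
Proof.
move=> ha hb hc hd he hf j.
apply: (pan_ext (f := nth (fun=> 0) [:: a; b; c; d; e; f] j)) => [z|].
  by rewrite mxE; case: j => [[|[|[|[|[|[|//]]]]]] h].
by case: j => [[|[|[|[|[|[|//]]]]]] h].
Qed.

Lemma pan_mk8 n (a b c d e f g h : 'rV[R]_n -> R) x :
  pan a x -> pan b x -> pan c x -> pan d x -> pan e x -> pan f x -> pan g x -> pan h x ->
  pans (fun z => mk8 (a z) (b z) (c z) (d z) (e z) (f z) (g z) (h z)) x.
Proof. by move=> *; do 3! (apply: forall_ord2). Qed.

(* A local section of the orbit map: snorm is equivariant on the invariant open set sdom,
   and ssec parametrises snorm = 1 by six of the coordinates. *)
Record slice := Slice {
  sdom : set (WB2 R);
  snorm : WB2 R -> pt;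
  scoord : WB2 R -> 'rV[R]_6;
  ssec : 'rV[R]_6 -> WB2 R;
  sdom_act : forall g C, Iplus g -> sdom C -> sdom (Iplus_act g C);
  snormP : forall C, sdom C -> Iplus (snorm C);
  snorm_act : forall g C, Iplus g -> sdom C ->
    snorm (Iplus_act g C) = Iplus_mul g (snorm C);
  ssecK : forall C, sdom C -> snorm C = row2 0 1 -> ssec (scoord C) = C;
  ssec_norm : forall y, sdom (ssec y) -> snorm (ssec y) = row2 0 1;
  scoordK : forall y, scoord (ssec y) = y;
  sdom_near : forall n (F : 'rV[R]_n -> WB2 R) x, pans F x -> sdom (F x) ->
    \forall z \near x, sdom (F z);
  pan_snorm : forall n (F : 'rV[R]_n -> WB2 R) x, pans F x -> sdom (F x) ->
    panv (fun z => snorm (F z)) x;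
  pan_scoord : forall n (F : 'rV[R]_n -> WB2 R) x, pans F x ->
    panv (fun z => scoord (F z)) x;
  pan_ssec : forall n (G : 'rV[R]_n -> 'rV[R]_6) x, panv G x -> pans (fun z => ssec (G z)) x
}.

(** The component along [d_2] of the one-form [2 C_ij^i - C_ji^i] (index [j]) obtained by
    contracting [C]; [inv1_pair] is minus the component along [d_1]. When [C 1 1 0] and [inv1]
    vanish, [ricD] is [-2] times the square of [C 0 1 0], which decides the covering by slices. *)
Definition inv1 C := C 1 1 1 - C 1 0 0 + 2 * C 0 1 0.
Definition inv1_pair C := - (C 0 0 0 - C 0 1 1 + 2 * C 1 0 1).

Lemma act_components g C : Iplus g ->
  [/\ Iplus_act g C 1 1 0 = C 1 1 0 / g 0 1 ^+ 2,
      Iplus_act g C 0 1 0 = (C 0 1 0 - g 0 0 / g 0 1 * C 1 1 0) / g 0 1,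
      inv1 (Iplus_act g C) = inv1 C / g 0 1 &
      inv1_pair (Iplus_act g C) = inv1_pair C + g 0 0 / g 0 1 * inv1 C].
Proof.
move=> Ig; have g1 : g 0 1 != 0 by rewrite gt_eqF.
rewrite /inv1 /inv1_pair !Iplus_actE !sum_ord2.
move: (g 0 0) (g 0 1) g1 => a b b0.
by split; rewrite /frame_coef /coframe_coef /=; field.
Qed.

Lemma row2_eq1 (a b : R) : row2 a b = row2 0 1 -> a = 0 /\ b = 1.
Proof.
move=> h; have := congr1 (fun v : pt => v 0 0) h; have := congr1 (fun v : pt => v 0 1) h.
by rewrite !row2E.
Qed.

Lemma sqrtr_inv1 (x : R) : 0 < x -> (Num.sqrt x)^-1 = 1 -> x = 1.
Proof.
move=> x0 /(congr1 GRing.inv); rewrite invrK invr1 => h.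
by rewrite -[x]sqr_sqrtr ?ltW // h expr1n.
Qed.

Lemma pan_entry n (G : 'rV[R]_n -> 'rV[R]_6) x k : panv G x -> pan (fun z => entry (G z) k) x.
Proof. by move=> h; exact: h. Qed.

Lemma sign_sq_eq e x : e * e = 1 -> e * x = 1 -> x = e.
Proof. by move=> ee ex; rewrite -[x]mul1r -ee -mulrA ex mulr1. Qed.

(** Normal form [C 0 1 0 = 0], [C 1 1 0 = e]; the sign [e] is invariant because the action divides
    [C 1 1 0] by [b ^ 2]. The definition is transparent so that [sdom] computes when the covering is
    proved. *)
Definition slice1 e (ee : e * e = 1) : slice.
Proof.
refine (@Slice [set C | 0 < e * C 1 1 0]
  (fun C => row2 (- (C 0 1 0 / C 1 1 0)) (Num.sqrt (e * C 1 1 0))^-1)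
  (fun C => row6 (C 0 0 0) (C 0 0 1) (C 0 1 1) (C 1 0 0) (C 1 0 1) (C 1 1 1))
  (fun y => mk8 (entry y 0) (entry y 1) 0 (entry y 2) (entry y 3) (entry y 4) e (entry y 5))
  _ _ _ _ _ _ _ _ _ _).
- move=> g C Ig /= h; have [-> _ _ _] := act_components C Ig.
  by rewrite mulrA divr_gt0 // exprn_gt0.
- by move=> C /= h; rewrite Iplus_row2 invr_gt0 sqrtr_gt0.
- move=> g C Ig /= h; have [-> -> _ _] := act_components C Ig.
  have k0 : C 1 1 0 != 0 by apply: contraTneq h => ->; rewrite mulr0 ltxx.
  have g1 : g 0 1 != 0 by rewrite gt_eqF.
  apply: pt_ext; rewrite /Iplus_mul !row2E /=; first by field; rewrite k0.
  rewrite mulrA sqrtrM ?ltW // sqrtrV ?sqr_ge0 // sqrtr_sqr ger0_norm; last exact: ltW.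
  by rewrite invfM invrK mulrC.
- move=> C /= h /row2_eq1 [h0 h1].
  have k0 : C 1 1 0 != 0 by apply: contraTneq h => ->; rewrite mulr0 ltxx.
  have a0 : C 0 1 0 = 0.
    by move/eqP: h0; rewrite oppr_eq0 mulf_eq0 invr_eq0 (negbTE k0) orbF => /eqP.
  have k1 := sign_sq_eq ee (sqrtr_inv1 h h1).
  by rewrite -[RHS]mk8_eta a0 k1 /entry !mxE !inordK.
- by move=> y /= _; rewrite /mk8 /= mul0r oppr0 ee sqrtr1 invr1.
- by move=> y; rewrite /mk8 /= row6_eta.
- by move=> n F x hF /= h; apply: pan_gt0 => //; exact: panZ.
- move=> n F x hF /= h.
  have k0 : F x 1 1 0 != 0 by apply: contraTneq h => ->; rewrite mulr0 ltxx.
  apply: pan_row2; first by apply: panN; apply: panM => //; exact: panV.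
  apply: panV; last by rewrite gt_eqF // sqrtr_gt0.
  by apply: pan_sqrt => //; exact: panZ.
- by move=> n F x hF; apply: pan_row6.
- by move=> n G x hG; apply: pan_mk8; try exact: pan_entry; exact: pan_cst.
Defined.

(** Normal form [inv1 = e], [inv1_pair = 0]: both equations are linear in [C] and are solved for
    [C 1 1 1] and [C 0 0 0]. *)
Definition slice2 e (ee : e * e = 1) : slice.
Proof.
refine (@Slice [set C | 0 < e * inv1 C]
  (fun C => row2 (inv1_pair C / inv1 C) (e * inv1 C)^-1)
  (fun C => row6 (C 1 1 0) (C 0 1 0) (C 1 0 0) (C 0 1 1) (C 1 0 1) (C 0 0 1))
  (fun y => mk8 (entry y 3 - 2 * entry y 4) (entry y 5) (entry y 1) (entry y 3)
     (entry y 2) (entry y 4) (entry y 0) (e + entry y 2 - 2 * entry y 1))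
  _ _ _ _ _ _ _ _ _ _).
- move=> g C Ig /= h; have [_ _ -> _] := act_components C Ig.
  by rewrite mulrA divr_gt0.
- by move=> C /= h; rewrite Iplus_row2 invr_gt0.
- move=> g C Ig /= h; have [_ _ -> ->] := act_components C Ig.
  have k0 : inv1 C != 0 by apply: contraTneq h => ->; rewrite mulr0 ltxx.
  have e0 : e != 0 by apply: contraTneq h => ->; rewrite mul0r ltxx.
  have g1 : g 0 1 != 0 by rewrite gt_eqF.
  by apply: pt_ext; rewrite /Iplus_mul !row2E /=; field; rewrite k0 ?e0.
- move=> C /= h /row2_eq1 [h0 h1].
  have k0 : inv1 C != 0 by apply: contraTneq h => ->; rewrite mulr0 ltxx.
  have a0 : inv1_pair C = 0.
    by move/eqP: h0; rewrite mulf_eq0 invr_eq0 (negbTE k0) orbF => /eqP.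
  have k1 : inv1 C = e.
    by apply: (sign_sq_eq ee); move/(congr1 GRing.inv): h1; rewrite invrK invr1.
  rewrite -[RHS]mk8_eta /entry !mxE !inordK //=; move: a0 k1; rewrite /inv1 /inv1_pair => a0 k1.
  congr mk8; lra.
- move=> y /= _; rewrite /inv1_pair /inv1 /mk8 /=.
  have -> : e + entry y 2 - 2 * entry y 1 - entry y 2 + 2 * entry y 1 = e by ring.
  have -> : entry y 3 - 2 * entry y 4 - entry y 3 + 2 * entry y 4 = 0 by ring.
  by rewrite oppr0 mul0r ee invr1.
- by move=> y; rewrite /mk8 /= row6_eta.
- move=> n F x hF /= h; apply: pan_gt0 => //; apply: panZ.
  by apply: panD; [exact: panB|exact: panZ].
- move=> n F x hF /= h.
  have hi : pan (fun z => inv1 (F z)) x by apply: panD; [exact: panB|exact: panZ].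
  have hp : pan (fun z => inv1_pair (F z)) x.
    by apply: panN; apply: panD; [exact: panB|exact: panZ].
  have k0 : inv1 (F x) != 0 by apply: contraTneq h => ->; rewrite mulr0 ltxx.
  apply: pan_row2; first by apply: panM => //; exact: panV.
  by apply: panV; [exact: panZ|rewrite gt_eqF].
- by move=> n F x hF; apply: pan_row6.
- move=> n G x hG; have hE k := pan_entry k hG.
  apply: pan_mk8 => //; first by apply: panB => //; exact: panZ.
  apply: panB; last exact: panZ.
  by apply: panD => //; exact: pan_cst.
Defined.

Lemma ricBE C : ricB C = (C 1 1 1 - C 1 0 0) / 2 + C 0 1 0 * C 1 0 1 - C 1 1 0 * C 0 0 1.
Proof. by rewrite /ricB /sB /curv !sum_ord2; field. Qed.

Lemma ricDE C : ricD C = C 1 1 0 * (C 0 0 0 - C 0 1 1 - 1) + C 0 1 0 * (C 1 1 1 - C 1 0 0).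
Proof. by rewrite /ricD /sD /curv !sum_ord2; ring. Qed.

(** The value [C(v, d_2, dx^1)] at [v = d_1 - (ricB / ricD) d_2], the vector with [dx^1(v) = 1]
    orthogonal to [d_2] for the Ricci form; this description is preserved by the action. *)
Definition inv2 C := C 0 1 0 - ricB C / ricD C * C 1 1 0.

Lemma inv2_act g C : Iplus g -> ricD C != 0 -> inv2 (Iplus_act g C) = inv2 C / g 0 1.
Proof.
move=> Ig D0; have [e1 e2 _ _] := act_components C Ig; have [_ eB eD] := ric_act C Ig.
have g1 : g 0 1 != 0 by rewrite gt_eqF.
by rewrite /inv2 e1 e2 eB eD; field; rewrite g1 D0.
Qed.

(** Normal form [ricB = 0], [C 0 1 0 = e]. By [ricBE] the first equation is then linear in [C 1 0 1]
    with coefficient [e], which is its own inverse. *)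
Definition slice3 e (ee : e * e = 1) : slice.
Proof.
refine (@Slice [set C | ricD C != 0 /\ 0 < e * inv2 C]
  (fun C => row2 (- (ricB C / ricD C)) (e * inv2 C)^-1)
  (fun C => row6 (C 1 1 0) (C 1 0 0) (C 1 1 1) (C 0 0 0) (C 0 1 1) (C 0 0 1))
  (fun y => mk8 (entry y 3) (entry y 5) e (entry y 4) (entry y 1)
     (e * (entry y 0 * entry y 5 - (entry y 2 - entry y 1) / 2)) (entry y 0) (entry y 2))
  _ _ _ _ _ _ _ _ _ _).
- move=> g C Ig /= [D0 h]; have [_ _ eD] := ric_act C Ig; rewrite inv2_act //.
  have g1 : g 0 1 != 0 by rewrite gt_eqF.
  split; first by rewrite eD mulf_neq0 // invr_eq0 expf_neq0.
  by rewrite mulrA divr_gt0.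
- by move=> C /= [D0 h]; rewrite Iplus_row2 invr_gt0.
- move=> g C Ig /= [D0 h]; have [_ eB eD] := ric_act C Ig; rewrite inv2_act // eB eD.
  have k0 : inv2 C != 0 by apply: contraTneq h => ->; rewrite mulr0 ltxx.
  have e0 : e != 0 by apply: contraTneq h => ->; rewrite mul0r ltxx.
  have g1 : g 0 1 != 0 by rewrite gt_eqF.
  by apply: pt_ext; rewrite /Iplus_mul !row2E /=; field; rewrite ?k0 ?D0 ?e0.
- move=> C /= [D0 h] /row2_eq1 [h0 h1].
  have k0 : inv2 C != 0 by apply: contraTneq h => ->; rewrite mulr0 ltxx.
  have B0 : ricB C = 0.
    by move/eqP: h0; rewrite oppr_eq0 mulf_eq0 invr_eq0 (negbTE D0) orbF => /eqP.
  have k1 : inv2 C = e.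
    by apply: (sign_sq_eq ee); move/(congr1 GRing.inv): h1; rewrite invrK invr1.
  rewrite /inv2 B0 mul0r mul0r subr0 in k1.
  rewrite -[RHS]mk8_eta /entry !mxE !inordK //= k1.
  rewrite ricBE k1 in B0.
  have -> : C 1 1 0 * C 0 0 1 - (C 1 1 1 - C 1 0 0) / 2 = e * C 1 0 1 by lra.
  by rewrite mulrA ee mul1r.
- move=> y /=; set C := mk8 _ _ _ _ _ _ _ _ => -[D0 _].
  have B0 : ricB C = 0 by rewrite ricBE /C /mk8 /= mulrA ee; ring.
  by rewrite /inv2 B0 !mul0r oppr0 addr0 {1}/C /mk8 /= ee invr1.
- by move=> y; rewrite /mk8 /= row6_eta.
- move=> n F x hF /= [D0 h]; have [_ hB hD _] := pan_ric hF.
  apply: filterS2 (pan_neq0 hD D0) (pan_gt0 (f := fun z => e * inv2 (F z)) _ h) => [z a b //|].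
  by apply: panZ; apply: panB => //; apply: panM => //; apply: panM => //; exact: panV.
- move=> n F x hF /= [D0 h]; have [_ hB hD _] := pan_ric hF.
  have hi : pan (fun z => inv2 (F z)) x.
    by apply: panB => //; apply: panM => //; apply: panM => //; exact: panV.
  apply: pan_row2; first by apply: panN; apply: panM => //; exact: panV.
  by apply: panV; [exact: panZ|rewrite gt_eqF].
- by move=> n F x hF; apply: pan_row6.
- move=> n G x hG; have hE k := pan_entry k hG.
  apply: pan_mk8 => //; first exact: pan_cst.
  apply: panZ; apply: panB; first exact: panM.
  by apply: panM; [exact: panB|exact: pan_cst].
Defined.

Definition slices : set (slice) := [set s | exists e (ee : e * e = 1),
  [\/ s = slice1 ee, s = slice2 ee | s = slice3 ee]].

Lemma signed_pos (x : R) : x != 0 -> exists e, exists2 ee : e * e = 1, True & 0 < e * x.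
Proof.
move=> x0; have [h|h] := ltP 0 x.
  by exists 1, (mul1r 1) => //; rewrite mul1r.
have ee : (-1) * (-1) = 1 :> R by rewrite mulrNN mul1r.
exists (-1), ee => //; rewrite mulN1r oppr_gt0 lt_neqAle x0 h //.
Qed.

(** If [C 1 1 0] and [inv1] vanish, then [ricD = - 2 * C 0 1 0 ^ 2] and [ricB] is a multiple of
    [C 0 1 0]. Nondegeneracy forces [C 0 1 0 <> 0], and this entry equals [inv2], so the third kind
    of slice applies. *)
Lemma slices_cover C : ricdet C != 0 -> exists2 s, slices s & sdom s C.
Proof.
move=> s0.
have [k0|/eqP k0] := boolP (C 1 1 0 != 0).
  have [e [ee _ h]] := signed_pos k0.
  by exists (slice1 ee) => //; exists e, ee; apply: Or31.
have [v0|/eqP v0] := boolP (inv1 C != 0).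
  have [e [ee _ h]] := signed_pos v0.
  by exists (slice2 ee) => //; exists e, ee; apply: Or32.
move/eqP: k0; rewrite negbK => /eqP k0; move/eqP: v0; rewrite negbK => /eqP v0.
have xi : C 1 1 1 - C 1 0 0 = - 2 * C 0 1 0 by move: v0; rewrite /inv1; lra.
have eD : ricD C = - 2 * C 0 1 0 ^+ 2 by rewrite ricDE k0 xi; ring.
have a0 : C 0 1 0 != 0.
  apply: contra s0 => /eqP a0; rewrite /ricdet eD ricBE xi k0 a0; apply/eqP; ring.
have ei : inv2 C = C 0 1 0 by rewrite /inv2 k0 mulr0 subr0.
have [e [ee _ h]] := signed_pos a0.
exists (slice3 ee); first by exists e, ee; apply: Or33.
split; last by rewrite ei.
by rewrite eD mulf_neq0 ?expf_neq0 // oppr_eq0 pnatr_eq0.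
Qed.

(** For each of the pairs [(C 1 1 0, - C 0 1 0)], [(ricD, - ricB)] and [(inv1, inv1_pair)], the
    quotient of the second entry by the first transforms by [t => a + b t]. [tau_num / tau_den] is
    their average with weights [C 1 1 0 ^ 2], [ricD ^ 2] and [inv1 ^ 4]: even powers that all scale
    by [b ^ -4] and have no common zero where [ricdet <> 0]. *)
Definition tau_den C := C 1 1 0 ^+ 2 + ricD C ^+ 2 + inv1 C ^+ 4.
Definition tau_num C := - C 1 1 0 * C 0 1 0 - ricD C * ricB C + inv1 C ^+ 3 * inv1_pair C.

(** The second entry is [|ricdet| ^ (-1/2)], since [ricdet] scales by [b ^ -2]; the absolute value
    is written as the root of a square to bring it under [pan_sqrt]. *)
Definition tau C : pt := row2 (tau_num C / tau_den C) (Num.sqrt (Num.sqrt (ricdet C ^+ 2)))^-1.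

Lemma tau_den_gt0 C : ricdet C != 0 -> 0 < tau_den C.
Proof.
move=> s0; have p0 : 0 <= tau_den C.
  by rewrite /tau_den !addr_ge0 ?sqr_ge0 // exprn_even_ge0.
rewrite lt_neqAle p0 andbT eq_sym; apply: contra s0.
rewrite /tau_den paddr_eq0 ?addr_ge0 ?sqr_ge0 ?exprn_even_ge0 //.
rewrite paddr_eq0 ?sqr_ge0 // !expf_eq0 /= => /andP[/andP[/eqP k0 /eqP D0] /eqP v0].
have xi : C 1 1 1 - C 1 0 0 = - 2 * C 0 1 0 by move: v0; rewrite /inv1; lra.
have : ricD C = - 2 * C 0 1 0 ^+ 2 by rewrite ricDE k0 xi; ring.
rewrite D0 => /esym/eqP; rewrite mulf_eq0 oppr_eq0 pnatr_eq0 expf_eq0 /= => /eqP a0.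
by rewrite /ricdet D0 ricBE xi k0 a0; apply/eqP; ring.
Qed.

Lemma tauP C : ricdet C != 0 -> Iplus (tau C).
Proof.
move=> s0; by rewrite Iplus_row2 invr_gt0 !sqrtr_gt0 exprn_even_gt0.
Qed.

Lemma tau_act g C : Iplus g -> ricdet C != 0 -> tau (Iplus_act g C) = Iplus_mul g (tau C).
Proof.
move=> Ig s0; have W0 := tau_den_gt0 s0.
have W1 : tau_den C != 0 by rewrite gt_eqF.
have b0 : 0 < g 0 1 by [].
have g1 : g 0 1 != 0 by rewrite gt_eqF.
have [e1 e2 e3 e4] := act_components C Ig; have [_ eB eD] := ric_act C Ig.
have eW : tau_den (Iplus_act g C) = tau_den C / g 0 1 ^+ 4.
  by rewrite /tau_den e1 eD e3; field.
have eN : tau_num (Iplus_act g C) = (tau_num C + g 0 0 / g 0 1 * tau_den C) / g 0 1 ^+ 3.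
  by rewrite /tau_num /tau_den e1 e2 eB eD e3 e4; field.
apply: pt_ext; rewrite /Iplus_mul /tau !row2E /=.
  by rewrite eW eN; field; rewrite W1.
rewrite ricdet_act //.
have -> : (ricdet C / g 0 1 ^+ 2) ^+ 2 = ricdet C ^+ 2 * ((g 0 1)^-1 ^+ 2) ^+ 2 by field.
rewrite sqrtrM ?sqr_ge0 // [Num.sqrt (_ ^+ 2 ^+ 2)]sqrtr_sqr ger0_norm ?sqr_ge0 //.
rewrite sqrtrM ?sqrtr_ge0 // sqrtr_sqr ger0_norm ?invr_ge0 ?ltW //.
by rewrite invfM invrK mulrC.
Qed.

Lemma pan_tau n (F : 'rV[R]_n -> WB2 R) x : pans F x -> ricdet (F x) != 0 ->
  panv (fun z => tau (F z)) x.
Proof.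
move=> hF s0; have [_ hB hD hs] := pan_ric hF.
have hi : pan (fun z => inv1 (F z)) x by apply: panD; [exact: panB|exact: panZ].
have hp : pan (fun z => inv1_pair (F z)) x.
  by apply: panN; apply: panD; [exact: panB|exact: panZ].
have s2 : 0 < ricdet (F x) ^+ 2 by rewrite exprn_even_gt0.
apply: pan_row2.
  apply: panM.
    by apply: panD; [apply: panB; apply: panM => //; exact: panN|apply: panM => //; exact: panX].
  apply: panV; last by rewrite gt_eqF // tau_den_gt0.
  by apply: panD; [apply: panD|]; exact: panX.
apply: panV; last by rewrite gt_eqF // !sqrtr_gt0.
by apply: pan_sqrt; [apply: pan_sqrt => //; exact: panX|rewrite sqrtr_gt0].
Qed.

End Slices.

(** * Open sets and coordinates on the space of structures *)

Section Topology.
Variable R : realType.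

Lemma near_open_panv n k (G : 'rV[R]_n -> 'rV[R]_k) x (Y : set 'rV[R]_k) :
  panv G x -> open Y -> Y (G x) -> \forall z \near x, Y (G z).
Proof.
move=> hG oY YG; have := open_nbhs_nbhs (conj oY YG) => /nbhs_ballP [e /= e0 he].
have h j : \forall z \near x, `|G z 0 j - G x 0 j| < e.
  by have [d d0 hd] := pan_near (hG j) e0; apply: (near_box d0) => z; exact: hd.
have h' : \forall z \near x, forall j, `|G z 0 j - G x 0 j| < e 
  by apply: (@filter_forall _ _ _ _ _ h).
apply: filterS h' => z hz; apply: he; split=> // i j.
by rewrite /ball /= (ord1 i) distrC.
Qed.

Lemma open_near n (A : set 'rV[R]_n) : (forall x, A x -> \forall z \near x, A z) -> open A.
Proof. by move=> h; rewrite openE => x /h. Qed.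

Lemma panv_id n (x : 'rV[R]_n) : panv (fun z => z) x.
Proof. by move=> j; exact: pan_coord. Qed.

Definition WB_of (v : 'rV[R]_8) : WB2 R :=
  mk8 (entry v 0) (entry v 1) (entry v 2) (entry v 3)
      (entry v 4) (entry v 5) (entry v 6) (entry v 7).

Lemma WB_ofK v : WB_coord (WB_of v) = v.
Proof.
apply/rowP => l; rewrite mxE /WB_of /mk8 /entry.
have E (k : nat) (h : (k < 2)%N) : (inord k == 0 :> 'I_2) = (k == 0)%N.
  by rewrite -val_eqE /= inordK.
by case: l => [[|[|[|[|[|[|[|[|//]]]]]]]] h]; rewrite !E //=; congr (v _ _);
  apply: val_inj; rewrite /= inordK.
Qed.

Lemma inord2_0 : (inord 0 : 'I_2) = 0. Proof. by apply: val_inj; rewrite /= inordK. Qed.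
Lemma inord2_1 : (inord 1 : 'I_2) = 1. Proof. by apply: val_inj; rewrite /= inordK. Qed.

Lemma WB_coordK C : WB_of (WB_coord C) = C.
Proof.
rewrite -[RHS]mk8_eta /WB_of /entry !mxE !inordK //.
by rewrite /= -?inord2_1 -?inord2_0.
Qed.

Lemma pans_WB_of n (G : 'rV[R]_n -> 'rV[R]_8) x : panv G x -> pans (fun z => WB_of (G z)) x.
Proof. by move=> hG; apply: pan_mk8; exact: hG. Qed.

Lemma panv_WB_coord n (F : 'rV[R]_n -> WB2 R) x : pans F x -> panv (fun z => WB_coord (F z)) x.
Proof.
move=> hF j; apply: pan_ext (hF (inord (j %/ 4)) (inord (j %/ 2 %% 2)) (inord (j %% 2))) => z.
by rewrite mxE.
Qed.

Lemma WB_coord_inj (C C' : WB2 R) : WB_coord C = WB_coord C' -> C = C'.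
Proof. by move=> h; rewrite -[C]WB_coordK h WB_coordK. Qed.

End Topology.

(** * The quotient manifold and its trivialisation *)

Section Quotient.
Variables (R : realType) (W : set (WB2 R)) (pi : WB2 R -> set (WB2 R)).
Local Notation pt := 'rV[R]_2.
Local Notation M := (pi @` W).
Local Notation WA := [set Chart W (@WB_coord R)].
Local Notation I := (@Iplus R).
Implicit Types (C : WB2 R) (g : pt) (s : slice R) (X : set (WB2 R)).

(* Abstracting over WB p q and moduli_class p q prevents the unifier from unfolding them. *)
Hypothesis W_act : forall g C, Iplus g -> W C -> W (Iplus_act g C).
Hypothesis W_ricdet : forall C, W C -> ricdet C != 0.
Hypothesis W_near : forall n (F : 'rV[R]_n -> WB2 R) x, pans F x -> W (F x) ->
  \forall z \near x, W (F z).
Hypothesis pi_eqP : forall C C', W C -> W C' ->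
  (pi C = pi C' <-> exists2 g, Iplus g & C' = Iplus_act g C).

Lemma pi_act g C : W C -> Iplus g -> pi (Iplus_act g C) = pi C.
Proof.
move=> WC Ig; apply/esym/pi_eqP => //; first exact: W_act.
by exists g.
Qed.

Lemma pi_eq C C' : W C -> W C' -> pi C = pi C' -> exists2 g, Iplus g & C' = Iplus_act g C.
Proof. by move=> WC WC' /(pi_eqP WC WC'). Qed.

Lemma moduli_pi C : W C -> M (pi C).
Proof. by move=> WC; exists C. Qed.

(** An arbitrary choice of representative: charts are defined on classes, and the functions composed
    with this choice are constant on orbits. *)
Definition class_repr X : WB2 R := xget (fun _ _ _ => 0) [set C | W C /\ pi C = X].

Lemma class_reprP X : M X -> W (class_repr X) /\ pi (class_repr X) = X.
Proof.
move=> [C WC eC]; have : [set C | W C /\ pi C = X] (class_repr X).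
  by apply: (@xgetI _ _ _ C).
by [].
Qed.

Lemma class_repr_pi C : W C -> exists2 g, Iplus g & class_repr (pi C) = Iplus_act g C.
Proof.
move=> WC; have [Wr er] := class_reprP (moduli_pi WC).
by apply: pi_eq.
Qed.

(** The point of the orbit lying on the slice; [sy] gives its coordinates. *)
Definition scanon s C := Iplus_act (Iplus_inv (snorm s C)) C.
Definition sy s C := scoord s (scanon s C).

Lemma scanon_act s g C : Iplus g -> sdom s C -> scanon s (Iplus_act g C) = scanon s C.
Proof.
by move=> Ig dC; rewrite /scanon snorm_act // Iplus_act_invM //; exact: snormP.
Qed.

Lemma sy_act s g C : Iplus g -> sdom s C -> sy s (Iplus_act g C) = sy s C.
Proof. by move=> Ig dC; rewrite /sy scanon_act. Qed.

Lemma sdom_canon s C : sdom s C -> sdom s (scanon s C).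
Proof. by move=> dC; apply: sdom_act => //; exact/Iplus_invP/snormP. Qed.

Lemma ssec_sy s C : sdom s C -> ssec s (sy s C) = scanon s C.
Proof.
move=> dC; have Is := snormP dC; apply: ssecK; first exact: sdom_canon.
by rewrite /scanon snorm_act ?Iplus_mulVg //; exact: Iplus_invP.
Qed.

Lemma sy_ssec s y : sdom s (ssec s y) -> sy s (ssec s y) = y.
Proof.
move=> dy; rewrite /sy /scanon ssec_norm // (_ : Iplus_inv _ = row2 0 1).
  by rewrite Iplus_act1 scoordK.
by apply: pt_ext; rewrite /Iplus_inv !row2E /= ?mul0r ?oppr0 ?invr1.
Qed.

Lemma W_canon s C : W C -> sdom s C -> W (scanon s C).
Proof. by move=> WC dC; apply: W_act => //; exact/Iplus_invP/snormP. Qed.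

Lemma pi_canon s C : W C -> sdom s C -> pi (scanon s C) = pi C.
Proof. by move=> WC dC; apply: pi_act => //; exact/Iplus_invP/snormP. Qed.

Lemma pan_sy n (F : 'rV[R]_n -> WB2 R) x s : pans F x -> sdom s (F x) ->
  panv (fun z => sy s (F z)) x.
Proof.
move=> hF d; apply: pan_scoord; have hn := pan_snorm hF d.
have n0 : snorm s (F x) 0 1 != 0 by rewrite gt_eqF //; exact: (snormP d).
apply: pans_act => //; first exact: panv_inv.
by rewrite /Iplus_inv row2E /= invr_eq0.
Qed.

Definition slice_chart s : chart R (set (WB2 R)) 6 :=
  Chart (pi @` (W `&` sdom s)) (fun X => sy s (class_repr X)).

Definition moduli_atlas : set (chart R (set (WB2 R)) 6) := slice_chart @` @slices R.

Local Notation A := moduli_atlas.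

Lemma sy_class_repr s C : W C -> sdom s C -> sy s (class_repr (pi C)) = sy s C.
Proof. by move=> WC dC; have [g Ig ->] := class_repr_pi WC; exact: sy_act. Qed.

Lemma sdom_pi s C : W C -> (pi @` (W `&` sdom s)) (pi C) -> sdom s C.
Proof.
move=> WC [C' [WC' dC'] e]; have [g Ig ->] := pi_eq WC' WC e.
exact: sdom_act.
Qed.

(** The section [ssec] inverts the chart, so images of sets of classes become preimages under an
    analytic map, and their openness can be checked point by point. *)
Lemma slice_chart_image s (V : set (set (WB2 R))) :
  chart_map (slice_chart s) @` (chart_dom (slice_chart s) `&` V) =
  [set y | [/\ W (ssec s y), sdom s (ssec s y) & V (pi (ssec s y))]].
Proof.
apply/seteqP; split=> [_ [X [[C [WC dC] <-] VC] <-]|y [Wy dy Vy]] /=.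
  rewrite sy_class_repr // ssec_sy // pi_canon //.
  by split=> //; [exact: W_canon|exact: sdom_canon].
exists (pi (ssec s y)); last by rewrite sy_class_repr // sy_ssec.
by split=> //; exists (ssec s y).
Qed.

Lemma near_slice s y : W (ssec s y) -> sdom s (ssec s y) ->
  \forall z \near y, W (ssec s z) /\ sdom s (ssec s z).
Proof.
move=> Wy dy; have hs := pan_ssec s (panv_id y).
exact: filterS2 (W_near hs Wy) (sdom_near hs dy).
Qed.

Lemma WB_coord_image (V : set (WB2 R)) :
  @WB_coord R @` (W `&` V) = [set v | W (WB_of v) /\ V (WB_of v)].
Proof.
apply/seteqP; split=> [_ [C [WC VC] <-]|v [Wv Vv]] /=; first by rewrite WB_coordK.
by exists (WB_of v); rewrite ?WB_ofK.
Qed.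

Lemma moduli_cover X : M X -> exists2 s, slices s & (pi @` (W `&` sdom s)) X.
Proof.
move=> [C WC <-]; have [s ss ds] := slices_cover (W_ricdet WC).
by exists s => //; exists C.
Qed.

Lemma moduli_analytic_atlas : analytic_atlas M A.
Proof.
split.
- move=> _ [s ss <-]; split=> [_ [C [WC _] <-]|X X']; first exact: moduli_pi.
  rewrite !inE /= => -[C [WC dC] <-] [C' [WC' dC'] <-].
  rewrite !sy_class_repr // => e.
  by rewrite -(pi_canon WC dC) -(pi_canon WC' dC') -!ssec_sy // e.
- move=> X /moduli_cover [s ss dX]; exists (slice_chart s) => //.
  by exists s.
- move=> _ _ [s ss <-] [s' ss' <-]; rewrite /chart_analytic.
  have -> : id @^-1` chart_dom (slice_chart s') = chart_dom (slice_chart s') by [].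
  rewrite slice_chart_image.
  have near y : W (ssec s y) -> (pi @` (W `&` sdom s')) (pi (ssec s y)) ->
      \forall z \near y, W (ssec s z) /\ sdom s' (ssec s z).
    move=> Wy /(sdom_pi Wy) dy; have hs := pan_ssec s (panv_id y).
    exact: filterS2 (W_near hs Wy) (sdom_near hs dy).
  split.
    apply: open_near => y [Wy dy Vy]; apply: filterS2 (near_slice Wy dy) (near y Wy Vy).
    by move=> z [Wz dz] [_ dz']; split=> //; exists (ssec s z).
  (* The transition map: lift to one slice, then renormalise to the other. *)
  exists (fun y => sy s' (ssec s y)).
    move=> y [Wy dy Vy] j; apply: pan_analytic_at.
    by apply: (pan_sy (pan_ssec s (panv_id y))); exact: sdom_pi Vy.
  move=> X [[C [WC dC] <-] dX] /=; have dC' := sdom_pi WC dX.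
  rewrite !sy_class_repr // ssec_sy //; apply: sy_act => //.
  exact/Iplus_invP/snormP.
Qed.

(** From left to right openness is pulled back along [sy], from right to left along [ssec]; thus the
    charts induce the quotient topology. *)
Lemma mopen_moduli (V : set (set (WB2 R))) : V `<=` M ->
  (mopen M A V <-> mopen W WA (W `&` pi @^-1` V)).
Proof.
move=> VM; split=> [[_ hV]|[_ hV]]; split=> //.
- move=> _ ->; rewrite /= setIA setIid WB_coord_image.
  apply: open_near => v [Wv Vv]; have [s ss ds] := slices_cover (W_ricdet Wv).
  have hF := pans_WB_of (panv_id v).
  have := hV (slice_chart s); rewrite slice_chart_image => oY.
  have {}oY := oY (ex_intro2 _ _ s ss erefl).
  have Yv : [set y | [/\ W (ssec s y), sdom s (ssec s y) & V (pi (ssec s y))]] (sy s (WB_of v)).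
    by rewrite /= ssec_sy // pi_canon //; split=> //; [exact: W_canon|exact: sdom_canon].
  apply: filterS3 (W_near hF Wv) (sdom_near hF ds) (near_open_panv (pan_sy hF ds) oY Yv).
  move=> z Wz dz [_ _]; rewrite ssec_sy // pi_canon //.
- move=> _ [s ss <-]; rewrite slice_chart_image.
  have := hV _ erefl; rewrite /= setIA setIid WB_coord_image => oY.
  apply: open_near => y [Wy dy Vy]; have hs := pan_ssec s (panv_id y).
  have Yy : [set v | W (WB_of v) /\ (pi @^-1` V) (WB_of v)] (WB_coord (ssec s y)).
    by rewrite /= WB_coordK.
  apply: filterS2 (near_slice Wy dy) (near_open_panv (panv_WB_coord hs) oY Yy).
  by move=> z [Wz dz]; rewrite /= WB_coordK => -[].
Qed.

Lemma mopen_moduli_near (V : set (set (WB2 R))) : V `<=` M ->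
  (forall v, W (WB_of v) -> V (pi (WB_of v)) ->
     \forall z \near v, W (WB_of z) -> V (pi (WB_of z))) -> mopen M A V.
Proof.
move=> VM h; apply/(mopen_moduli VM); split=> [C [] //|_ ->] /=.
rewrite setIA setIid WB_coord_image; apply: open_near => v [Wv Vv].
apply: filterS2 (W_near (pans_WB_of (panv_id v)) Wv) (h v Wv Vv) => z Wz Vz.
by split=> //; exact: Vz.
Qed.

(** A global normal form, the point of the orbit with [tau = 1]. Its coordinates separate orbits
    continuously, also those that share no chart. *)
Definition tau_normal C := Iplus_act (Iplus_inv (tau C)) C.

Lemma W_tau C : W C -> Iplus (tau C). Proof. by move=> /W_ricdet; exact: tauP. Qed.

Lemma tau_normal_class_repr C : W C -> tau_normal (class_repr (pi C)) = tau_normal C.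
Proof.
move=> WC; have [g Ig ->] := class_repr_pi WC; have s0 := W_ricdet WC.
by rewrite /tau_normal tau_act // Iplus_act_invM //; exact: tauP.
Qed.

Lemma W_tau_normal C : W C -> W (tau_normal C).
Proof. by move=> WC; apply: W_act => //; exact/Iplus_invP/W_tau. Qed.

Lemma pi_tau_normal C : W C -> pi (tau_normal C) = pi C.
Proof. by move=> WC; apply: pi_act => //; exact/Iplus_invP/W_tau. Qed.

Lemma pans_tau_normal n (F : 'rV[R]_n -> WB2 R) x : pans F x -> W (F x) ->
  pans (fun z => tau_normal (F z)) x.
Proof.
move=> hF WF; have s0 := W_ricdet WF; have ht := pan_tau hF s0.
have t0 : tau (F x) 0 1 != 0 by rewrite gt_eqF //; exact: W_tau.
apply: pans_act => //; first exact: panv_inv.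
by rewrite /Iplus_inv row2E /= invr_eq0.
Qed.

Lemma mopen_tau_normal (Y : set 'rV[R]_8) : open Y ->
  mopen M A [set X | M X /\ Y (WB_coord (tau_normal (class_repr X)))].
Proof.
move=> oY; apply: mopen_moduli_near => [X [] //|v Wv [_]].
rewrite tau_normal_class_repr // => Yv.
have hc := panv_WB_coord (pans_tau_normal (pans_WB_of (panv_id v)) Wv).
apply: filterS (near_open_panv hc oY Yv) => z Yz Wz.
by split; [exact: moduli_pi|rewrite tau_normal_class_repr].
Qed.

Lemma moduli_hausdorff : mhausdorff M A.
Proof.
move=> _ _ [C WC <-] [C' WC' <-] ne.
have ne' : WB_coord (tau_normal C) != WB_coord (tau_normal C').
  apply/eqP => /WB_coord_inj e; apply: ne.
  by rewrite -(pi_tau_normal WC) -(pi_tau_normal WC') e.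
have := @norm_hausdorff R 'rV[R]_8; rewrite open_hausdorff => /(_ _ _ ne').
move=> [[Y Y'] /= [/set_mem Yx /set_mem Yy] [oY oY' /eqP e]].
exists [set X | M X /\ Y (WB_coord (tau_normal (class_repr X)))].
exists [set X | M X /\ Y' (WB_coord (tau_normal (class_repr X)))].
split; [exact: mopen_tau_normal|exact: mopen_tau_normal| | |].
- by split; [exact: moduli_pi|rewrite tau_normal_class_repr].
- by split; [exact: moduli_pi|rewrite tau_normal_class_repr].
- apply/seteqP; split=> // X [[_ Y1] [_ Y2]].
  have : (Y `&` Y') (WB_coord (tau_normal (class_repr X))) by [].
  by rewrite e.
Qed.

(** The images of these boxes form a countable base, because the projection is an open map. *)
Definition rat_box (c : {ffun 'I_8 -> rat}) (r : rat) : set (WB2 R) :=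
  [set C | forall l, `|WB_coord C 0 l - ratr (c l)| < ratr r].

Lemma mopen_rat_box c r : mopen M A (pi @` (W `&` rat_box c r)).
Proof.
apply: mopen_moduli_near => [_ [C [WC _] <-]|v Wv [C [WC bC] eC]]; first exact: moduli_pi.
(* [g] moves the given point into the box; by continuity the same [g] moves all nearby points into
   it. *)
have [g Ig e] := pi_eq Wv WC (esym eC).
have g1 : g 0 1 != 0 by rewrite gt_eqF.
have hg : panv (fun=> g) v by move=> j; exact: pan_cst.
have hc := panv_WB_coord (pans_act hg g1 (pans_WB_of (panv_id v))).
have h l : \forall z \near v, `|WB_coord (Iplus_act g (WB_of z)) 0 l - ratr (c l)| < ratr r.
  have := bC l; rewrite e => b0.
  have e0 : 0 < ratr r - `|WB_coord (Iplus_act g (WB_of v)) 0 l - ratr (c l)| by rewrite subr_gt0.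
  have [d d0 hd] := pan_near (hc l) e0; apply: (near_box d0) => z hz.
  apply: le_lt_trans (ler_distD (WB_coord (Iplus_act g (WB_of v)) 0 l) _ _) _.
  by rewrite -ltrBrDr; exact: hd.
apply: filterS (@filter_forall _ _ _ _ _ h) => z hz Wz.
exists (Iplus_act g (WB_of z)); last exact: pi_act.
by split; [exact: W_act|].
Qed.

Lemma moduli_second_countable : msecond_countable M A.
Proof.
pose B i : set (set (WB2 R)) :=
  if unpickle i is Some z then pi @` (W `&` rat_box z.1 z.2) else set0.
exists B; split=> [i|V X hV VX]; last first.
  have [C WC eC] := hV.1 _ VX; rewrite -{X}eC in VX *.
  pose U := @WB_coord R @` (W `&` pi @^-1` V).
  have [_ oU] := (mopen_moduli hV.1).1 hV.
  have {}oU : open U by have := oU _ erefl; rewrite /= setIA setIid.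
  have UC : U (WB_coord C) by exists C.
  have := open_nbhs_nbhs (conj oU UC) => /nbhs_ballP [e /= e0 he].
  (* Below half of [e]: two points of the box differ by less than twice [r] in each coordinate. *)
  have [r] := rat_in_itvoo (divr_gt0 e0 (ltr0n R 2)).
  rewrite in_itv /= => /andP[r0 re].
  have hc l : exists k : rat, `|WB_coord C 0 l - ratr k| < ratr r.
    have [|k] := @rat_in_itvoo R (WB_coord C 0 l - ratr r) (WB_coord C 0 l + ratr r).
      by rewrite ltrD2l; lra.
    by rewrite in_itv /= -ltr_distlC => h; exists k.
  have [c hcl] := choice hc.
  exists (pickle ([ffun l => c l], r)); rewrite /B pickleK; split.
    by exists C => //; split=> // l; rewrite ffunE.
  move=> _ [C' [WC' bC'] <-].
  have [C1 [WC1 VC1] e1] : U (WB_coord C').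
    apply: he; split=> // i l; rewrite (ord1 i) /ball /=.
    apply: le_lt_trans (ler_distD (ratr (c l)) _ _) _.
    have := bC' l; have := hcl l; rewrite ffunE [`|ratr _ - _|]distrC; lra.
  by rewrite -(WB_coord_inj e1).
rewrite /B; case: (unpickle i) => [[c r]|]; first exact: mopen_rat_box.
by apply: mopen_moduli_near.
Qed.

Definition trivialization C : pt * set (WB2 R) := (tau C, pi C).
(** The fibre over a class is the orbit, parametrised by the group starting from its point with
    [tau = 1]. *)
Definition untrivialization (z : pt * set (WB2 R)) : WB2 R :=
  Iplus_act z.1 (tau_normal (class_repr z.2)).

Lemma untrivialization_pi g C : W C -> untrivialization (g, pi C) = Iplus_act g (tau_normal C).
Proof. by move=> WC; rewrite /untrivialization /= tau_normal_class_repr. Qed.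

Lemma tau_tau_normal C : W C -> tau (tau_normal C) = row2 0 1.
Proof.
move=> WC; have It := W_tau WC.
by rewrite /tau_normal tau_act ?Iplus_mulVg //; [exact: Iplus_invP|exact: W_ricdet].
Qed.

Lemma panv_row_mx n k l (G : 'rV[R]_n -> 'rV[R]_k) (H : 'rV[R]_n -> 'rV[R]_l) x :
  panv G x -> panv H x -> panv (fun z => row_mx (G z) (H z)) x.
Proof.
move=> hG hH j; case: (split_ordP j) => i ->.
  by apply: pan_ext (hG i) => z; rewrite row_mxEl.
by apply: pan_ext (hH i) => z; rewrite row_mxEr.
Qed.

Lemma panv_lsubmx k l (x : 'rV[R]_(k + l)) : panv (@lsubmx R 1 k l) x.
Proof. by move=> j; apply: pan_ext (pan_coord (lshift l j) x) => z; rewrite mxE. Qed.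

Lemma panv_rsubmx k l (x : 'rV[R]_(k + l)) : panv (@rsubmx R 1 k l) x.
Proof. by move=> j; apply: pan_ext (pan_coord (rshift k j) x) => z; rewrite mxE. Qed.

Lemma trivialization_analytic :
  analytic_map W WA (I `*` M) (prod_atlas (@Iplus_atlas R) A) trivialization.
Proof.
split=> [C WC|_ _ -> [_ -> [_ [s ss <-] <-]]].
  by split; [exact: W_tau|exact: moduli_pi].
rewrite /chart_analytic /= WB_coord_image; split.
  apply: open_near => v [Wv [_ /= /(sdom_pi Wv) dv]].
  have hF := pans_WB_of (panv_id v).
  apply: filterS2 (W_near hF Wv) (sdom_near hF dv) => z Wz dz; split=> //.
  by split; [exact: W_tau|exists (WB_of z)].
exists (fun v => row_mx (tau (WB_of v)) (sy s (WB_of v))).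
  move=> v [Wv [_ /= /(sdom_pi Wv) dv]] j; apply: pan_analytic_at.
  have hF := pans_WB_of (panv_id v).
  by apply: panv_row_mx; [apply: pan_tau => //; exact: W_ricdet|exact: pan_sy].
move=> C [WC [_ /= /(sdom_pi WC) dC]].
by rewrite WB_coordK sy_class_repr.
Qed.

Lemma untrivialization_analytic :
  analytic_map (I `*` M) (prod_atlas (@Iplus_atlas R) A) W WA untrivialization.
Proof.
have Wu z : (I `*` M) z -> W (untrivialization z).
  case: z => g X [/= Ig [C WC <-]]; rewrite untrivialization_pi //.
  by apply: W_act => //; exact: W_tau_normal.
split=> // _ _ [_ -> [_ [s ss <-] <-]] ->; rewrite /chart_analytic /=.
set D := (X in open [set _ | _ in X]).
pose G (z : 'rV[R]_(2 + 6)) := lsubmx z.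
pose S (z : 'rV[R]_(2 + 6)) := ssec s (rsubmx z).
have hS z : pans S z by apply: pan_ssec; exact: panv_rsubmx.
have ED : [set row_mx z.1 (sy s (class_repr z.2)) | z in D] =
    [set z | [/\ I (G z), W (S z) & sdom s (S z)]].
  apply/seteqP; split=> [_ [[g _] [[/= Ig [C [WC dC] <-]] _] <-]|z [Iz Wz dz]] /=.
    rewrite sy_class_repr // /G /S row_mxKl row_mxKr ssec_sy //.
    by split=> //; [exact: W_canon|exact: sdom_canon].
  exists (G z, pi (S z)); last by rewrite /= sy_class_repr // sy_ssec // hsubmxK.
  split; first by split=> //; exists (S z).
  by apply: Wu; split=> //; exact: moduli_pi.
split.
  rewrite ED; apply: open_near => z [Iz Wz dz].
  apply: filterS3 (pan_gt0 (panv_lsubmx z 1) Iz) (W_near (hS z) Wz) (sdom_near (hS z) dz).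
  by move=> y Iy Wy dy.
exists (fun z => WB_coord (Iplus_act (G z) (tau_normal (S z)))).
  rewrite ED => z [Iz Wz dz] j; apply: pan_analytic_at; apply: panv_WB_coord.
  apply: pans_act; [exact: panv_lsubmx|by rewrite gt_eqF|exact: pans_tau_normal].
move=> [g _] [[/= Ig [C [WC dC] <-]] _].
rewrite sy_class_repr // untrivialization_pi // /G /S row_mxKl row_mxKr ssec_sy //.
congr (WB_coord (Iplus_act _ _)).
have Is := Iplus_invP (snormP dC).
by rewrite /tau_normal /scanon tau_act ?Iplus_act_invM //; [exact: W_tau|exact: W_ricdet].
Qed.

Lemma moduli_bundle : trivial_principal_bundle I (@Iplus_atlas R) (@Iplus_mul R)
  W WA (@Iplus_act R) M A pi.
Proof.
split=> [g C Ig WC|]; first exact: W_act.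
exists (@tau R), untrivialization; split.
- exact: trivialization_analytic.
- exact: untrivialization_analytic.
- by move=> C WC; rewrite untrivialization_pi // Iplus_actVK //; exact: W_tau.
- move=> [g _] [/= Ig [C WC <-]]; have Wc := W_tau_normal WC.
  have sc := W_ricdet Wc; rewrite untrivialization_pi // tau_act // (pi_act Wc Ig).
  by rewrite tau_tau_normal // Iplus_mulg1 pi_tau_normal.
- move=> g C Ig WC; have s0 := W_ricdet WC.
  by rewrite tau_act // (pi_act WC Ig).
Qed.

End Quotient.

Unset Implicit Arguments.
Set Strict Implicit.
Set Printing Implicit Defensive.

Theorem theorem1p5 (R : realType) (p q : nat) (hpq : (p + q = 2)%N) :
  (* (1) *)
  (forall C : WB2 R, WB p q C -> ~ typeC C ->
     forall P : 'rV[R]_2, half_plane P ->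
       [/\ calX C P = germ P @` groupG (R := R),
           killing_germs C P = germ P @` algh (R := R) &
           ~ typeA C]) /\
  (* (2) *)
  (forall C C' : WB2 R, WB p q C -> WB p q C' ->
     (moduli_class p q C = moduli_class p q C' <->
      exists2 g : 'rV[R]_2, Iplus g & C' = Iplus_act g C)) /\
  (* (3) and (4) *)
  (exists A : set (chart R (set (WB2 R)) 6),
     [/\ analytic_manifold (moduli p q) A,
         (forall V : set (set (WB2 R)), V `<=` moduli p q ->
            (mopen (moduli p q) A V <->
             mopen (WB p q) (WB_atlas p q) (WB p q `&` moduli_class p q @^-1` V))) &
         trivial_principal_bundle
           (Iplus (R := R)) (Iplus_atlas (R := R)) (Iplus_mul (R := R))
           (WB p q) (WB_atlas p q) (Iplus_act (R := R))
           (moduli p q) A (moduli_class p q)]).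
Proof.
split; [|split].
- move=> C WC ntC P hP; have s0 := WB_ricdet hpq WC.
  (* The exclusion of Type C enters through the contrapositive of [flat_typeC]. *)
  have nf : ~ flat_dev C by move=> /(flat_typeC hpq WC).
  by split; [exact: calXE|exact: killing_germsE|exact: not_typeA].
- by move=> C C'; exact: (moduli_class_eq hpq).
- have W_act g C := @WB_act R g C p q; have W_ricdet C := @WB_ricdet R C p q hpq.
  have W_near n F x := @WB_near R n F x p q hpq.
  have pi_eqP C C' := @moduli_class_eq R C C' p q hpq.
  exists (moduli_atlas (WB p q) (moduli_class p q)); split.
  + by split; [exact: moduli_analytic_atlas|exact: moduli_hausdorff|exact: moduli_second_countable].
  + by move=> V; exact: mopen_moduli.
  + exact: moduli_bundle.
Qed.
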